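(* Consider the Bradley–Terry–Luce model described in the context, with $\theta^*\in\Theta(\kappa)$. Suppose that $\kappa=\mathcal{O}(1)$ and $np\gg(\log n)^{3/2}$. Let $\hat\theta$ be the maximum likelihood estimator and define, for $i\in[n]$, $$b_i=\sum_{j:j\neq i}A_{ij}\big(\bar y_{ij}-\psi(\theta_i^*-\theta_j^* )\big),\qquad d_i=\sum_{j:j\neq i}A_{ij}\psi'(\theta_i^*-\theta_j^* ).$$ Then for every $i\in[n]$, $$\hat\theta_i-\theta_i^*=(1+\epsilon_{1,i})\frac{b_i}{d_i}+\epsilon_{2,i},$$ where $\epsilon_1,\epsilon_2\in\mathbb{R}^n$ are vectors such that, with probability $1-\mathcal{O}(n^{-10})$, $\|\epsilon_1\|_\infty=\mathfrak{o}(1)$ and $\|\epsilon_2\|_\infty=\mathfrak{o}(1/\sqrt{npL})$.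
   Context: Let $n\ge2$, $\psi(t)=e^t/(1+e^t)$ and $\psi'(t)=e^t/(1+e^t)^2$. For $\kappa>0$ let $\Theta(\kappa)=\{\theta\in\mathbb{R}^n:\max_i\theta_i-\min_i\theta_i\le\kappa,\ \sum_{i}\theta_i=0\}$. BTL model: given $\theta^*\in\Theta(\kappa)$, $p\in(0,1]$ and a positive integer $L$, the variables $\{A_{ij}\}_{i<j}$ are i.i.d. Bernoulli$(p)$, with $A_{ji}=A_{ij}$, $A_{ii}=0$; for each $i<j$ with $A_{ij}=1$ one observes $y_{ij\ell}$, $\ell=1,\dots,L$, i.i.d. Bernoulli$(\psi(\theta_i^*-\theta_j^* ))$, independent across pairs and independent of $A$. Put $\bar y_{ij}=L^{-1}\sum_{\ell=1}^L y_{ij\ell}$ and $\bar y_{ji}=1-\bar y_{ij}$ for $i<j$. The maximum likelihood estimator is $\hat\theta\in\arg\min_{\theta\in\mathbb{R}^n:\mathbf 1_n^\top\theta=0}\ell_n(\theta)$, where $\ell_n(\theta)=\sum_{i<j}A_{ij}\big[\bar y_{ij}\log\frac{1}{\psi(\theta_i-\theta_j)}+\bar y_{ji}\log\frac{1}{\psi(\theta_j-\theta_i)}\big]$ (it exists and is unique with probability $1-\mathcal{O}(n^{-10})$; one works on this event). Asymptotics: $n\to\infty$; $p,L,\kappa,\theta^*$ may depend on $n$; $a_n\ll b_n$ means $a_n/b_n\to0$; $\mathfrak{o}(\cdot)$ is the corresponding little-o; $\kappa=\mathcal{O}(1)$ means $\kappa$ is bounded by a constant independent of $n$. ''With probability $1-\mathcal{O}(n^{-10})$''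 means with probability at least $1-Cn^{-10}$ for a constant $C$ not depending on $n$. *)

(* Defs.v *)
From HB Require Import structures.
From mathcomp Require Import all_boot all_order all_algebra.
From mathcomp Require Import all_classical all_reals.
From mathcomp Require Import topology normedtype sequences exp.
Set Implicit Arguments. Unset Strict Implicit. Unset Printing Implicit Defensive.
Import Order.TTheory GRing.Theory Num.Theory.
Local Open Scope ring_scope.

Section BTL.
Variable R : realType.

Definition psi (t : R) : R := expR t / (1 + expR t).
Definition dpsi (t : R) : R := expR t / (1 + expR t) ^+ 2.

Definition Theta (n : nat) (kappa : R) (theta : 'I_n -> R) : Prop :=
  (forall i j : 'I_n, theta i - theta j <= kappa) /\ \sum_(i < n) theta i = 0.

Definition Pair (n : nat) := {x : 'I_n * 'I_n | (x.1 < x.2)%N}.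

(* sample space: the edge indicators A_{ij} (i<j) and the comparison
   outcomes y_{ijl} (i<j, l<L).  The y's are drawn for every pair,
   independently of A; only those with A_{ij}=1 are used (observed). *)
Definition Omega (n L : nat) :=
  ({ffun Pair n -> bool} * {ffun Pair n * 'I_L -> bool})%type.

Definition weight (n L : nat) (p : R) (theta : 'I_n -> R) (w : Omega n L) : R :=
  (\prod_(e : Pair n) (if w.1 e then p else 1 - p)) *
  \prod_(el : Pair n * 'I_L)
     (let e := el.1 in
      let q := psi (theta (val e).1 - theta (val e).2) in
      if w.2 el then q else 1 - q).

Definition Prob (n L : nat) (p : R) (theta : 'I_n -> R) (E : Omega n L -> Prop) : R :=
  \sum_(w : Omega n L | `[< E w >]) weight p theta w.

Definition Aij (n L : nat) (w : Omega n L) (i j : 'I_n) : bool :=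
  match insub (i, j) : option (Pair n) with
  | Some e => w.1 e
  | None => match insub (j, i) : option (Pair n) with
            | Some e => w.1 e
            | None => false
            end
  end.

Definition ybar_lt (n L : nat) (w : Omega n L) (i j : 'I_n) : R :=
  match insub (i, j) : option (Pair n) with
  | Some e => (\sum_(l < L) (w.2 (e, l) : nat)%:R) / L%:R
  | None => 0
  end.

Definition ybar (n L : nat) (w : Omega n L) (i j : 'I_n) : R :=
  if (i < j)%N then ybar_lt w i j
  else if (j < i)%N then 1 - ybar_lt w j i else 0.

Definition loglik (n L : nat) (w : Omega n L) (theta : 'I_n -> R) : R :=
  \sum_(i < n) \sum_(j < n | (i < j)%N)
    (Aij w i j)%:R *
    (ybar w i j * ln (psi (theta i - theta j))^-1 +
     ybar w j i * ln (psi (theta j - theta i))^-1).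

Definition is_MLE (n L : nat) (w : Omega n L) (th : 'I_n -> R) : Prop :=
  \sum_(i < n) th i = 0 /\
  forall theta : 'I_n -> R, \sum_(i < n) theta i = 0 -> loglik w th <= loglik w theta.

Definition bvec (n L : nat) (w : Omega n L) (theta : 'I_n -> R) (i : 'I_n) : R :=
  \sum_(j < n | j != i) (Aij w i j)%:R * (ybar w i j - psi (theta i - theta j)).

Definition dvec (n L : nat) (w : Omega n L) (theta : 'I_n -> R) (i : 'I_n) : R :=
  \sum_(j < n | j != i) (Aij w i j)%:R * dpsi (theta i - theta j).

Definition normInf (n : nat) (v : 'I_n -> R) : R := \big[Num.max/0]_(i < n) `|v i|.

End BTL.

(* Main.v *)
(* Write [theta + delta] for the maximum likelihood estimator. The likelihood
   equations say that [\sum_j A i j * phi i j (delta i - delta j) = b i], where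
   [phi] is odd and increasing. Truncating the link function linearly outside a
   bounded interval makes [phi] bi-Lipschitz; a Cheeger inequality for the random
   graph then makes the system strongly monotone on zero-sum vectors, so that it
   has a unique solution, which is the estimator as soon as its sup norm is at
   most 1/2.

   The sup norm is bounded by leave-one-out: the solution [f] of the system in
   which the edges at [m] are replaced by their mean and made noiseless is close
   to [delta] in Euclidean norm by strong monotonicity, and it is independent of
   the edges at [m], so that Bernstein's inequality controls
   [\sum_j A m j * f j ^+ 2] and [\sum_j (A m j - p) * W m j * f j]. Expanding
   the [m]-th equation to first order, the only remaining term is the mean
   [\sum_j W m j * delta j / n]; testing the system against the solution [z] of
   the linearised one with right-hand side [W m / n] (centred) turns it into
   [\sum_i z i * b i], which is small by concentration, plus a quadratic error.
   With [a = (ln n)^(1/4)] and [s = sqrt (n p)], all errors are of relative order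
   [a^3 / s], which is where the hypothesis [n p >> (ln n)^(3/2)] enters. *)
Require Import Defs.
From HB Require Import structures.
From mathcomp Require Import all_boot all_order all_algebra.
From mathcomp Require Import all_classical all_reals.
From mathcomp Require Import topology normedtype sequences exp realfun.
From mathcomp Require Import ring lra zify.
Set Implicit Arguments. Unset Strict Implicit. Unset Printing Implicit Defensive.
Import Order.TTheory GRing.Theory Num.Theory numFieldNormedType.Exports.
Local Open Scope ring_scope.

(** * Scalar inequalities *)

(** The power [a^3] is decided by the Euclidean norm of [delta]. Each [|b i|] is bounded by a
    multiple of [s^2 tau], but the l1 norm of [b], a maximum over [2^n] sign patterns, pays no
    logarithm and gains a factor [a^2] over [n] times that bound. Interpolating, [nrm2 delta] is of
    order [n tau^2 / a^2]. The variance term of Bernstein's inequality in row [m] is then about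
    [a^2 * (s tau / a) = a s tau]; divided by the degree [s^2] it is [a tau / s], that is [a^3 / s]
    times [1 / sqrt (n p L)]. The sup norm alone would give [a^4 / s] and require [n p >> (ln n)^2].

    Averaging the edges at [m], rather than deleting them, keeps the vertex attached, so the
    modified system is still coercive on zero-sum vectors. All tail bounds share one device: each
    summand carries a compensator that makes its exponential moment at most 1, so random
    coefficients are allowed as long as they ignore the variables being redrawn. The exponent
    [12 ln n] leaves [n^-10] after a union bound over [n^2] pairs. *)

Section ScalarInequalities.
Variable R : realType.
Implicit Types q g B s t x y : R.

(** Since [expR (- x) >= 1 - x], [expR x] is at most [1 / (1 - x)], and the quadratic times [1 - x]
    equals [1 + x^2 (1 - 2 x)], which is at least 1. *)
Lemma expR_le_quad x : `|x| <= 1 / 2 -> expR x <= 1 + x + 2 * x ^+ 2.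
Proof.
rewrite ler_norml => /andP[h1 h2].
have h : 1 - x <= expR (- x) by have := expR_ge1Dx (- x).
have hx := expR_gt0 x.
have e : expR x * expR (- x) = 1 by rewrite expRxMexpNx_1.
have : expR x * (1 - x) <= 1 by rewrite -[leRHS]e ler_pM2l.
have : 1 <= (1 + x + 2 * x ^+ 2) * (1 - x).
  have : 0 <= x ^+ 2 * (1 - 2 * x) by rewrite mulr_ge0 ?sqr_ge0 //; lra.
  have -> : (1 + x + 2 * x ^+ 2) * (1 - x) = 1 + x ^+ 2 * (1 - 2 * x) by ring.
  lra.
move=> a b; have c : expR x * (1 - x) <= (1 + x + 2 * x ^+ 2) * (1 - x).
  exact: le_trans b a.
by move: c; rewrite ler_pM2r //; lra.
Qed.

(** The linear term stays bare because it averages out for a centred variable. Small [x] is the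
    quadratic bound; for [x > 1/2] one has [x <= 2 x^2]; for [x < -1/2] the left side is at most
    1. *)
Lemma expR_le_add_expR_sqr x : expR x <= x + expR (2 * x ^+ 2).
Proof.
have h2 := expR_ge1Dx (2 * x ^+ 2).
have [h|h] := lerP `|x| (1 / 2).
  by have := expR_le_quad h; lra.
have [x0|x0] := lerP 0 x.
  move: h; rewrite ger0_norm // => h.
  have : expR x <= expR (2 * x ^+ 2) by rewrite ler_expR; nra.
  lra.
move: h; rewrite ltr0_norm // => h.
have : expR x <= 1 by rewrite expR_le1 ltW.
nra.
Qed.

Lemma bernoulli_subgaussian q x : 0 <= q <= 1 ->
  q * expR (x * (1 - q)) + (1 - q) * expR (- (x * q)) <= expR (2 * x ^+ 2).
Proof.
move=> /andP[q0 q1].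
have h1 := expR_le_add_expR_sqr (x * (1 - q)).
have h2 := expR_le_add_expR_sqr (- (x * q)).
have m1 : expR (2 * (x * (1 - q)) ^+ 2) <= expR (2 * x ^+ 2).
  rewrite ler_expR ler_pM2l // exprMn ler_piMr ?sqr_ge0 //.
  by rewrite expr_le1 //; lra.
have m2 : expR (2 * (- (x * q)) ^+ 2) <= expR (2 * x ^+ 2).
  by rewrite ler_expR ler_pM2l // sqrrN exprMn ler_piMr ?sqr_ge0 // expr_le1.
have : q * expR (x * (1 - q)) <= q * (x * (1 - q) + expR (2 * x ^+ 2)).
  by apply: ler_wpM2l => //; lra.
have : (1 - q) * expR (- (x * q)) <= (1 - q) * (- (x * q) + expR (2 * x ^+ 2)).
  by apply: ler_wpM2l; lra.
lra.
Qed.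

(** Restricting [x] buys the variance factor [q] in the exponent, which the sub-Gaussian bound
    lacks; it is indispensable for edges, since [p] may tend to 0. *)
Lemma bernoulli_bernstein q x : 0 <= q <= 1 -> `|x| <= 1 / 2 ->
  q * expR (x * (1 - q)) + (1 - q) * expR (- (x * q)) <= expR (2 * q * x ^+ 2).
Proof.
move=> /andP[q0 q1] hx.
have b1 : `|x * (1 - q)| <= 1 / 2.
  have h := normr_ge0 x; rewrite normrM (ger0_norm (_ : 0 <= 1 - q)); last by lra.
  by nra.
have b2 : `|- (x * q)| <= 1 / 2.
  by have h := normr_ge0 x; rewrite normrN normrM (ger0_norm q0); nra.
have h1 := expR_le_quad b1; have h2 := expR_le_quad b2.
have h3 := expR_ge1Dx (2 * q * x ^+ 2).
have : q * expR (x * (1 - q)) <= q * (1 + x * (1 - q) + 2 * (x * (1 - q)) ^+ 2).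
  exact: ler_wpM2l.
have : (1 - q) * expR (- (x * q)) <= (1 - q) * (1 + - (x * q) + 2 * (- (x * q)) ^+ 2).
  by rewrite ler_wpM2l // subr_ge0.
have : 0 <= q * q * x ^+ 2 by apply: mulr_ge0; [exact: mulr_ge0|exact: sqr_ge0].
have -> : q * (1 + x * (1 - q) + 2 * (x * (1 - q)) ^+ 2) =
   q + x * q * (1 - q) + 2 * (1 - q) * (q * (1 - q)) * x ^+ 2 by ring.
have -> : (1 - q) * (1 + - (x * q) + 2 * (- (x * q)) ^+ 2) =
   1 - q - x * q * (1 - q) + 2 * (q * (1 - q)) * q * x ^+ 2 by ring.
lra.
Qed.

(** The tilt 1/2 costs [q * g], twice the mean of the exponent; hence the factor 2 in front of the
    mean in [row_tail]. *)
Lemma bernoulli_upper q g : 0 <= q <= 1 -> 0 <= g <= 1 ->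
  q * expR (g / 2) + (1 - q) <= expR (q * g).
Proof.
move=> /andP[q0 q1] /andP[g0 g1].
have b : `|g / 2| <= 1 / 2 by rewrite ger0_norm; lra.
have h := expR_le_quad b.
have h3 := expR_ge1Dx (q * g).
have : q * expR (g / 2) <= q * (1 + g / 2 + 2 * (g / 2) ^+ 2) by exact: ler_wpM2l.
have : q * (1 + g / 2 + 2 * (g / 2) ^+ 2) <= q * (1 + g).
  by apply: ler_wpM2l => //; nra.
lra.
Qed.

Lemma bernoulli_lower q : 0 <= q <= 1 ->
  q * expR (-1) + (1 - q) <= expR (- (q / 2)).
Proof.
move=> /andP[q0 q1].
have h1 : 2 <= expR 1 :> R by have := expR_ge1Dx (1 : R).
have e : expR 1 * expR (-1) = 1 :> R by rewrite expRxMexpNx_1.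
have h2 : expR (-1) <= 1 / 2 :> R by have := expR_gt0 (-1 : R); nra.
have h3 := expR_ge1Dx (- (q / 2)).
nra.
Qed.

Lemma psi_gt0 t : 0 < psi t.
Proof. by rewrite /psi divr_gt0 ?addr_gt0 ?expR_gt0. Qed.

Lemma psiN t : psi (- t) = 1 - psi t.
Proof.
rewrite /psi expRN; have h := expR_gt0 t.
by field; rewrite !gt_eqF ?addr_gt0.
Qed.

Lemma psi_lt1 t : psi t < 1.
Proof. by have := psi_gt0 (- t); rewrite psiN; lra. Qed.

Lemma dpsi_ge B t : `|t| <= B -> expR (- B) / (1 + expR B) ^+ 2 <= dpsi t.
Proof.
rewrite ler_norml /dpsi => /andP[h1 h2].
have e1 : expR (- B) <= expR t by rewrite ler_expR.
have e2 : expR t <= expR B by rewrite ler_expR.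
have p1 := expR_gt0 t; have p2 := expR_gt0 (- B).
apply: ler_pM => //; rewrite ?invr_ge0 ?exprn_ge0 ?addr_ge0 ?expR_ge0 //.
rewrite lef_pV2 ?posrE ?exprn_gt0 ?addr_gt0 ?expR_gt0 //.
by rewrite lerXn2r ?nnegrE ?addr_ge0 ?expR_ge0 ?lerD2l.
Qed.

Lemma dpsi_le1 t : 0 <= dpsi t <= 1.
Proof.
have p1 := expR_gt0 t; rewrite /dpsi divr_ge0 ?exprn_ge0 ?addr_ge0 ?expR_ge0 //=.
by rewrite ler_pdivrMr ?exprn_gt0 ?addr_gt0 // mul1r; nra.
Qed.

Lemma psiB s t : psi t - psi s =
  (expR t - expR s) / ((1 + expR t) * (1 + expR s)).
Proof.
rewrite /psi; have h := expR_gt0 t; have h' := expR_gt0 s.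
by field; rewrite !gt_eqF ?addr_gt0.
Qed.

Lemma psi_bilip B s t : `|s| <= B -> `|t| <= B -> s <= t ->
  expR (- B) / (1 + expR B) ^+ 2 * (t - s) <= psi t - psi s <= t - s.
Proof.
rewrite !ler_norml => /andP[s1 s2] /andP[t1 t2] st.
have p1 := expR_gt0 t; have p2 := expR_gt0 s.
have P : 0 < (1 + expR t) * (1 + expR s) by rewrite mulr_gt0 ?addr_gt0.
rewrite psiB; apply/andP; split; last first.
  rewrite ler_pdivrMr //.
  have h : 1 + (s - t) <= expR (s - t) by exact: expR_ge1Dx.
  have e : expR s = expR t * expR (s - t) by rewrite -expRD; congr expR; lra.
  have : expR t - expR s <= expR t * (t - s).
    by rewrite e; have := ler_wpM2l (ltW p1) h; lra.
  have : expR t * (t - s) <= (1 + expR t) * (1 + expR s) * (t - s).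
    by apply: ler_wpM2r; [lra|nra].
  lra.
have h : 1 + (t - s) <= expR (t - s) by exact: expR_ge1Dx.
have e : expR t = expR s * expR (t - s) by rewrite -expRD; congr expR; lra.
have a1 : expR (- B) * (t - s) <= expR t - expR s.
  have : expR (- B) <= expR s by rewrite ler_expR.
  have : expR s * (t - s) <= expR t - expR s.
    by rewrite e; have := ler_wpM2l (ltW p2) h; lra.
  move=> a b; have := ler_wpM2r (_ : 0 <= t - s) b; lra.
have e1 : expR t <= expR B by rewrite ler_expR.
have e2 : expR s <= expR B by rewrite ler_expR.
rewrite mulrAC; apply: ler_pM => //.
- by rewrite mulr_ge0 ?expR_ge0 // subr_ge0.
- by rewrite invr_ge0 exprn_ge0 // addr_ge0 // expR_ge0.
rewrite lef_pV2 ?posrE ?exprn_gt0 ?addr_gt0 ?expR_gt0 //.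
by rewrite expr2; apply: ler_pM; rewrite ?addr_ge0 ?expR_ge0 ?lerD2l.
Qed.

(** Exact algebra instead of derivatives: the remainder is [dpsi t] times a quotient with numerator
    [u - e^t e^x v], where [u] and [v] lie in [[0, 2 x^2]]. The denominator [1 + e^t e^x] is the sum
    of the two weights, so the quotient is at most [2 x^2] in absolute value. *)
Lemma psi_taylor t x : `|x| <= 1 / 2 ->
  `|psi (t + x) - psi t - dpsi t * x| <= 2 * x ^+ 2.
Proof.
move=> hx.
have hx' : `|- x| <= 1 / 2 by rewrite normrN.
have p1 := expR_gt0 t; have p2 := expR_gt0 x; have p3 := expR_gt0 (- x).
have q1 := expR_le_quad hx; have q2 := expR_le_quad hx'.
have r1 := expR_ge1Dx x; have r2 := expR_ge1Dx (- x).
have e : expR x * expR (- x) = 1 by rewrite expRxMexpNx_1.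
have -> : psi (t + x) - psi t - dpsi t * x =
   dpsi t * (((expR x - 1 - x) - expR t * (expR x * (expR (- x) - 1 + x)))
             / (1 + expR t * expR x)).
  rewrite /psi /dpsi expRD.
  have -> : expR x * (expR (- x) - 1 + x) =
            expR x * expR (- x) - expR x + x * expR x by ring.
  rewrite e.
  by field; rewrite !gt_eqF ?addr_gt0 ?mulr_gt0.
have D : 0 < 1 + expR t * expR x by rewrite addr_gt0 ?mulr_gt0.
have [d0 d1] := andP (dpsi_le1 t).
rewrite normrM (ger0_norm d0) normrM normfV (gtr0_norm D).
have : `|(expR x - 1 - x) - expR t * (expR x * (expR (- x) - 1 + x))| <=
   2 * x ^+ 2 * (1 + expR t * expR x).
  have P : 0 < expR t * expR x by rewrite mulr_gt0.
  have P2 : 0 <= expR t * expR x * (expR (- x) - 1 + x).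
    by rewrite mulr_ge0 ?(ltW P) //; lra.
  have P3 : expR t * expR x * (expR (- x) - 1 + x) <= expR t * expR x * (2 * x ^+ 2).
    by rewrite ler_wpM2l ?(ltW P) // -(sqrrN x); lra.
  have P4 := sqr_ge0 x.
  have P5 : 0 <= expR t * expR x * x ^+ 2 by rewrite mulr_ge0 ?(ltW P).
  rewrite ler_norml; apply/andP; split; lra.
rewrite -ler_pdivrMr //; apply: le_trans; apply: ler_piMl => //.
by rewrite divr_ge0 ?(ltW D).
Qed.

(* [y ln (1/psi t) + (1-y) ln (1/psi (-t)) = ln (1+e^t) - y t]. *)
Definition pair_loss y t := y * ln (psi t)^-1 + (1 - y) * ln (psi (- t))^-1.

Lemma pair_lossE y t : pair_loss y t = ln (1 + expR t) - y * t.
Proof.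
have p1 := expR_gt0 t.
have -> : pair_loss y t = y * ln (psi t)^-1 + (1 - y) * ln (psi (- t))^-1 by [].
have -> : (psi (- t))^-1 = 1 + expR t.
  rewrite psiN; have -> : 1 - psi t = (1 + expR t)^-1.
    by rewrite /psi; field; rewrite !gt_eqF ?addr_gt0.
  by rewrite invrK.
have -> : (psi t)^-1 = (1 + expR t) / expR t.
  by rewrite /psi invf_div.
rewrite ln_div ?posrE ?addr_gt0 // expRK; ring.
Qed.

(** Strict Jensen: [(1 + e^t) / (1 + e^s)] is the mean of [1] and [expR (t - s)] with weights
    [1 - q] and [q]. Both exponents are centred at their mean [a], and [1 + u < expR u] is strict at
    [u = - a], which is nonzero because [s != t]. *)
Lemma pair_loss_tangent_lt y s t : s != t ->
  pair_loss y s + (psi s - y) * (t - s) < pair_loss y t.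
Proof.
move=> st; rewrite !pair_lossE; set q := psi s.
have q0 := psi_gt0 s; have q1 := psi_lt1 s.
suff : q * (t - s) < ln (1 + expR t) - ln (1 + expR s) by lra.
have ps := expR_gt0 s; have pt := expR_gt0 t.
rewrite -ln_div ?posrE ?addr_gt0 // -[X in X < _]expRK ltr_ln ?posrE ?expR_gt0 //;
  last by rewrite divr_gt0 ?addr_gt0.
set a := q * (t - s).
have -> : (1 + expR t) / (1 + expR s) =
   expR a * ((1 - q) * expR (- a) + q * expR ((t - s) - a)).
  have -> : expR a * ((1 - q) * expR (- a) + q * expR (t - s - a)) =
     (1 - q) * (expR a * expR (- a)) + q * (expR a * expR (t - s - a)) by ring.
  have -> : expR a * expR (t - s - a) = expR t / expR s.
    by rewrite -expRD -expRB; congr expR; ring.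
  rewrite expRxMexpNx_1 /q /psi.
  by field; rewrite !gt_eqF ?addr_gt0.
rewrite -{1}[expR a]mulr1 ltr_pM2l ?expR_gt0 //.
have a0 : - a != 0 by rewrite oppr_eq0 mulf_eq0 subr_eq0 (gt_eqF q0) eq_sym.
have h1 := expR_gt1Dx a0; have h2 := expR_ge1Dx (t - s - a).
have : (1 - q) * (1 + - a) < (1 - q) * expR (- a).
  by rewrite ltr_pM2l // subr_gt0.
have : q * (1 + (t - s - a)) <= q * expR (t - s - a) by rewrite ler_pM2l.
rewrite /a; lra.
Qed.

Lemma pair_loss_tangent y s t :
  pair_loss y s + (psi s - y) * (t - s) <= pair_loss y t.
Proof.
have [->|st] := eqVneq s t; first by rewrite subrr mulr0 addr0.
exact/ltW/pair_loss_tangent_lt.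
Qed.

End ScalarInequalities.

(** * Product Bernoulli measure *)

Section BernoulliProduct.
Variables (R : realType) (I : finType) (q : I -> R).
Implicit Types (f : {ffun I -> bool}) (F : {ffun I -> bool} -> R).

Definition bern_weight f : R := \prod_i (if f i then q i else 1 - q i).

Definition upd f i b : {ffun I -> bool} := [ffun j => if j == i then b else f j].

Lemma bern_weight_ge0 f : (forall i, 0 <= q i <= 1) -> 0 <= bern_weight f.
Proof.
move=> h; apply: prodr_ge0 => i _; have /andP[a b] := h i.
by case: (f i) => //; rewrite subr_ge0.
Qed.

Lemma bern_weight_sum : \sum_f bern_weight f = 1.
Proof.
rewrite -(bigA_distr_bigA (fun i (b : bool) => if b then q i else 1 - q i)).
by rewrite big1 // => i _; rewrite big_bool /= addrC subrK.
Qed.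

Let weight' i f : R := \prod_(j | j != i) (if f j then q j else 1 - q j).

Lemma upd_id f i : upd f i (f i) = f.
Proof. by apply/ffunP => j; rewrite ffunE; case: eqP => [->|]. Qed.

(** [weight'] omits coordinate [i], so flipping that coordinate is a weight-preserving bijection
    between its two fibres. *)
Let reindex_upd i b F :
  \sum_(f : {ffun I -> bool} | f i == b) weight' i f * F f =
  \sum_(f : {ffun I -> bool} | f i == ~~ b) weight' i f * F (upd f i b).
Proof.
pose t f := upd f i (~~ f i).
have tt : involutive t.
  move=> f; apply/ffunP => j; rewrite !ffunE.
  by case: eqP => // ->; rewrite eqxx negbK.
rewrite (reindex_inj (inv_inj tt)); apply: eq_big => [f|f].
  by rewrite /t ffunE eqxx; case: (f i); case: b.
rewrite /t ffunE eqxx => /eqP <-; congr (_ * _).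
by apply: eq_bigr => j ji; rewrite ffunE (negbTE ji).
Qed.

Let sum_split i F : \sum_f bern_weight f * F f =
  q i * \sum_(f : {ffun I -> bool} | f i == true) weight' i f * F f +
  (1 - q i) * \sum_(f : {ffun I -> bool} | f i == false) weight' i f * F f.
Proof.
rewrite (bigID (fun f => f i == true)) /= !mulr_sumr; congr (_ + _).
  apply: eq_bigr => f /eqP fi.
  by rewrite /bern_weight (bigD1 i) //= fi mulrA.
apply: eq_big => [f|f]; first by case: (f i).
by move/negbTE; rewrite /bern_weight (bigD1 i) //= eqb_id => ->; rewrite mulrA.
Qed.

Lemma bern_upd i b F : \sum_f bern_weight f * F (upd f i b) =
  \sum_(f : {ffun I -> bool} | f i == b) weight' i f * F f.
Proof.
have e : \sum_(f : {ffun I -> bool} | f i == b) weight' i f * F (upd f i b) =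
         \sum_(f : {ffun I -> bool} | f i == b) weight' i f * F f.
  by apply: eq_bigr => f /eqP <-; rewrite upd_id.
have h := reindex_upd i b F.
rewrite (sum_split i); case: b e h => e h.
  by rewrite e -h -mulrDl addrC subrK mul1r.
by rewrite e -h -mulrDl addrC subrK mul1r.
Qed.

(** The form in which independence is used: redrawing one coordinate from its own law does not
    change the mean. *)
Lemma bern_resample i F : \sum_f bern_weight f * F f =
  \sum_f bern_weight f * (q i * F (upd f i true) + (1 - q i) * F (upd f i false)).
Proof.
rewrite (sum_split i) -!bern_upd !mulr_sumr -big_split /=.
by apply: eq_bigr => f _; ring.
Qed.

End BernoulliProduct.

(** * Expectation under the model, resampling of one variable, union and Chernoff bounds *)

Section Expectation.
Variables (R : realType) (n L : nat) (p : R) (theta : 'I_n -> R).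
Hypothesis hp : 0 <= p <= 1.
Implicit Types (w : Omega n L) (F G : Omega n L -> R) (E : Omega n L -> Prop).

Definition Ex F : R := \sum_w weight p theta w * F w.

Definition win_prob (el : Pair n * 'I_L) : R :=
  psi (theta (val el.1).1 - theta (val el.1).2).

Lemma win_prob01 el : 0 <= win_prob el <= 1.
Proof. by rewrite /win_prob !ltW ?psi_gt0 ?psi_lt1. Qed.

Lemma weightE w :
  weight p theta w = bern_weight (fun=> p) w.1 * bern_weight win_prob w.2.
Proof. by []. Qed.

Lemma weight_ge0 w : 0 <= weight p theta w.
Proof.
rewrite weightE mulr_ge0 ?bern_weight_ge0 // => el; exact: win_prob01.
Qed.

Lemma Ex_pair F : Ex F =
  \sum_a bern_weight (fun=> p) a * \sum_y bern_weight win_prob y * F (a, y).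
Proof.
rewrite /Ex; under [RHS]eq_bigr do rewrite mulr_sumr.
rewrite pair_bigA /=; apply: eq_bigr => -[a y] _; rewrite weightE /=; ring.
Qed.

Lemma Ex1 : Ex (fun=> 1) = 1.
Proof.
rewrite Ex_pair; under eq_bigr do under eq_bigr do rewrite mulr1.
by under eq_bigr do rewrite bern_weight_sum mulr1; rewrite bern_weight_sum.
Qed.

Lemma Ex_le F G : (forall w, F w <= G w) -> Ex F <= Ex G.
Proof. by move=> h; apply: ler_sum => w _; rewrite ler_wpM2l ?weight_ge0. Qed.

Definition set_edge (e : Pair n) b w : Omega n L := (upd w.1 e b, w.2).
Definition set_outcome (el : Pair n * 'I_L) b w : Omega n L :=
  (w.1, upd w.2 el b).

Lemma Ex_edge e F : Ex F =
  Ex (fun w => p * F (set_edge e true w) + (1 - p) * F (set_edge e false w)).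
Proof.
rewrite !Ex_pair.
under eq_bigr do rewrite mulr_sumr; rewrite exchange_big /=.
under [RHS]eq_bigr do rewrite mulr_sumr; rewrite [RHS]exchange_big /=.
apply: eq_bigr => y _.
transitivity (bern_weight win_prob y * \sum_a bern_weight (fun=> p) a * F (a, y)).
  by rewrite mulr_sumr; apply: eq_bigr => a _; rewrite mulrCA.
rewrite (bern_resample (fun=> p) e) mulr_sumr; apply: eq_bigr => a _.
by rewrite mulrCA.
Qed.

Lemma Ex_outcome el F : Ex F =
  Ex (fun w => win_prob el * F (set_outcome el true w) +
               (1 - win_prob el) * F (set_outcome el false w)).
Proof.
rewrite !Ex_pair; apply: eq_bigr => a _; congr (_ * _).
exact: (bern_resample win_prob el (fun y => F (a, y))).
Qed.

(* Integrating out one coordinate at a time, [\prod_j expR (X j)] is a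
   supermartingale as soon as each factor has conditional mean at most 1. *)
Lemma Ex_expR_sum_le1 (J : eqType) (s : seq J)
    (u : J -> bool -> Omega n L -> Omega n L) (q : J -> R)
    (X : J -> Omega n L -> R) :
  uniq s ->
  (forall j F, j \in s ->
     Ex F = Ex (fun w => q j * F (u j true w) + (1 - q j) * F (u j false w))) ->
  (forall j w x1 x0, j \in s -> X j (u j true w) = x1 -> X j (u j false w) = x0 ->
     q j * expR x1 + (1 - q j) * expR x0 <= 1) ->
  (forall i j b w, i \in s -> j \in s -> i != j -> X i (u j b w) = X i w) ->
  Ex (fun w => expR (\sum_(j <- s) X j w)) <= 1.
Proof.
elim: s => [|x s IH] /=.
  move=> *; rewrite -[leRHS]Ex1; apply: Ex_le => w.
  by rewrite big_nil expR0.
move=> /andP[xs us] hE hX hi.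
rewrite (hE x) ?mem_head //.
apply: le_trans (IH us _ _ _); last first.
- by move=> i j b w hi' hj; apply: hi; rewrite in_cons ?hi' ?hj orbT.
- by move=> j w x1 x0 js; apply: hX; rewrite in_cons js orbT.
- by move=> j F js; apply: hE; rewrite in_cons js orbT.
apply: Ex_le => w.
have e b : \sum_(j <- s) X j (u x b w) = \sum_(j <- s) X j w.
  apply: eq_big_seq => j js; apply: hi; rewrite ?mem_head ?in_cons ?js ?orbT //.
  by apply: contraNneq xs => <-.
rewrite !big_cons !e !expRD !mulrA -mulrDl.
by rewrite ler_piMl ?expR_ge0 //; apply: hX (mem_head _ _) erefl erefl.
Qed.

Lemma ProbE E : Prob p theta E = Ex (fun w => (`[< E w >])%:R).
Proof.
rewrite /Prob /Ex big_mkcond; apply: eq_bigr => w _.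
by case: asboolP => _; rewrite ?mulr1 ?mulr0.
Qed.

Lemma Prob_le E E' : (forall w, E w -> E' w) -> Prob p theta E <= Prob p theta E'.
Proof.
move=> h; rewrite !ProbE; apply: Ex_le => w.
by case: asboolP => [/h/asboolP ->//|_]; rewrite ler0n.
Qed.

Lemma Prob_ge0 E : 0 <= Prob p theta E.
Proof. by apply: sumr_ge0 => w _; exact: weight_ge0. Qed.

Lemma Prob_compl E : Prob p theta E = 1 - Prob p theta (fun w => ~ E w).
Proof.
apply/eqP; rewrite -subr_eq opprK -[X in _ == X]Ex1 !ProbE /Ex -big_split /=.
apply/eqP/eq_bigr => w _; rewrite -mulrDr; congr (_ * _).
rewrite asbool_neg; case: asboolP => _; rewrite ?addr0 ?add0r //.
Qed.

Lemma Prob_or E E' :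
  Prob p theta (fun w => E w \/ E' w) <= Prob p theta E + Prob p theta E'.
Proof.
rewrite !ProbE /Ex -big_split /=; apply: ler_sum => w _.
rewrite -mulrDr ler_wpM2l ?weight_ge0 // asbool_or -natrD ler_nat.
by case: asboolP; case: asboolP.
Qed.

Lemma Prob_exists (T : finType) (P : pred T) (E : T -> Omega n L -> Prop) :
  Prob p theta (fun w => exists2 t, P t & E t w) <= \sum_(t | P t) Prob p theta (E t).
Proof.
under eq_bigr do rewrite ProbE.
rewrite ProbE /Ex exchange_big /=; apply: ler_sum => w _.
rewrite -mulr_sumr ler_wpM2l ?weight_ge0 //.
case: asboolP => [[t Pt Et]|_]; last by apply: sumr_ge0.
rewrite (bigD1 t) //= asboolT // lerDl; exact: sumr_ge0.
Qed.

Lemma Prob_exists_le (T : finType) (E : T -> Omega n L -> Prop) (r : R) :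
  (forall t, Prob p theta (E t) <= r) ->
  Prob p theta (fun w => exists t, E t w) <= #|T|%:R * r.
Proof.
move=> h; apply: le_trans (_ : Prob p theta (fun w => exists2 t : T, true & E t w) <= _).
  by apply: Prob_le => w [t Et]; exists t.
apply: le_trans (Prob_exists _ _) _.
rewrite mulr_natl -sumr_const; exact: ler_sum.
Qed.

(** Chernoff's bound with the tilt and the compensator already absorbed into [F]. *)
Lemma markov_expR F (t : R) : Ex (fun w => expR (F w)) <= 1 ->
  Prob p theta (fun w => t < F w) <= expR (- t).
Proof.
move=> h; rewrite ProbE -[leRHS]mulr1.
apply: le_trans (_ : expR (- t) * Ex (fun w => expR (F w)) <= _); last first.
  by rewrite ler_wpM2l ?expR_ge0.
rewrite /Ex mulr_sumr; apply: ler_sum => w _; rewrite mulrCA.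
rewrite ler_wpM2l ?weight_ge0 //; case: asboolP => [tF|_].
  by rewrite -expRD -[leLHS]expR0 ler_expR addrC subr_ge0 ltW.
by rewrite mulr_ge0 ?expR_ge0.
Qed.

End Expectation.

(** * Weighted graph Laplacians *)

Section Laplacian.
Variables (R : realType) (n : nat).
Implicit Types (x y u g : 'I_n -> R) (alpha : 'I_n -> 'I_n -> R).

Definition nrm2 x : R := \sum_i x i ^+ 2.

(** The sum runs over ordered pairs, so for symmetric weights it is twice the usual graph energy;
    hence the factors 2 in [flow_monotone] and [dirichlet_lt]. *)
Definition dirichlet alpha x : R := \sum_i \sum_j alpha i j * (x i - x j) ^+ 2.

Definition symmetric_fun alpha := forall i j, alpha i j = alpha j i.

Lemma nrm2_ge0 x : 0 <= nrm2 x.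
Proof. by apply: sumr_ge0 => i _; exact: sqr_ge0. Qed.

Lemma nrm2_coord x i : x i ^+ 2 <= nrm2 x.
Proof.
by rewrite /nrm2 (bigD1 i) //= lerDl; apply: sumr_ge0 => j _; exact: sqr_ge0.
Qed.

Lemma nrm2D x y : nrm2 (fun i => x i + y i) <= 2 * nrm2 x + 2 * nrm2 y.
Proof.
rewrite /nrm2 !mulr_sumr -big_split; apply: ler_sum => i _ /=.
by have := sqr_ge0 (x i - y i); nra.
Qed.

Lemma nrm2_shift x (a : R) : nrm2 (fun i => x i + a) =
  nrm2 x + 2 * a * (\sum_i x i) + n%:R * a ^+ 2.
Proof.
rewrite /nrm2 mulr_sumr -big_split /=.
have -> : n%:R * a ^+ 2 = \sum_(i < n) a ^+ 2.
  by rewrite sumr_const card_ord mulr_natl.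
by rewrite -big_split; apply: eq_bigr => i _ /=; ring.
Qed.

(** Lagrange's identity: twice the gap is the weighted double sum of the squared minors
    [x i * y j - x j * y i]. *)
Lemma cauchy_schwarz (I : finType) (w x y : I -> R) : (forall i, 0 <= w i) ->
  (\sum_i w i * (x i * y i)) ^+ 2 <=
  (\sum_i w i * x i ^+ 2) * (\sum_i w i * y i ^+ 2).
Proof.
move=> w0; rewrite -subr_ge0.
set A := \sum_i w i * x i ^+ 2; set B := \sum_i w i * y i ^+ 2.
set C := \sum_i _ * (_ * _).
have : 0 <= \sum_i \sum_j w i * w j * (x i * y j - x j * y i) ^+ 2.
  by do 2! (apply: sumr_ge0 => ? _); rewrite mulr_ge0 ?sqr_ge0 // mulr_ge0.
suff -> : \sum_i \sum_j w i * w j * (x i * y j - x j * y i) ^+ 2 =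
          2 * (A * B - C ^+ 2) by rewrite pmulr_rge0.
have AB : A * B = \sum_i \sum_j w i * w j * (x i ^+ 2 * y j ^+ 2).
  rewrite mulr_suml; apply: eq_bigr => i _; rewrite mulr_sumr.
  by apply: eq_bigr => j _; ring.
have AB' : A * B = \sum_i \sum_j w i * w j * (x j ^+ 2 * y i ^+ 2).
  rewrite mulrC mulr_suml; apply: eq_bigr => i _; rewrite mulr_sumr.
  by apply: eq_bigr => j _; ring.
have CC : C ^+ 2 = \sum_i \sum_j w i * w j * (x i * y i * (x j * y j)).
  rewrite expr2 mulr_suml; apply: eq_bigr => i _; rewrite mulr_sumr.
  by apply: eq_bigr => j _; ring.
have -> : 2 * (A * B - C ^+ 2) = A * B + A * B - 2 * C ^+ 2 by ring.
rewrite {1}AB AB' CC mulr_sumr -big_split -sumrB /=; apply: eq_bigr => i _.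
rewrite mulr_sumr -big_split -sumrB /=; apply: eq_bigr => j _; ring.
Qed.

Lemma cauchy_schwarz1 (I : finType) (x y : I -> R) :
  (\sum_i x i * y i) ^+ 2 <= (\sum_i x i ^+ 2) * (\sum_i y i ^+ 2).
Proof.
have := @cauchy_schwarz I (fun=> 1) x y (fun=> ler01).
have e (f : I -> R) : \sum_i 1 * f i = \sum_i f i.
  by apply: eq_bigr => i _; rewrite mul1r.
by rewrite !e.
Qed.

(** Summation by parts: a potential paired with the divergence of an antisymmetric flow becomes a
    sum of flow times potential difference. *)
Lemma sum_antisym (G : 'I_n -> 'I_n -> R) u : (forall i j, G j i = - G i j) ->
  2 * (\sum_i u i * \sum_j G i j) = \sum_i \sum_j G i j * (u i - u j).
Proof.
move=> hG; rewrite mulr_natl mulr2n.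
have e : \sum_i u i * \sum_j G i j = \sum_i \sum_j u i * G i j.
  by apply: eq_bigr => i _; rewrite mulr_sumr.
rewrite e {2}exchange_big -big_split /=; apply: eq_bigr => i _.
by rewrite -big_split; apply: eq_bigr => j _ /=; rewrite hG; ring.
Qed.

Lemma sum_sym_deg alpha (D : R) (y : 'I_n -> R) : symmetric_fun alpha ->
  (forall i, \sum_j alpha i j <= D) -> (forall i, 0 <= y i) ->
  \sum_i \sum_j alpha i j * (y i + y j) <= 2 * D * \sum_i y i.
Proof.
move=> sym hD y0.
have e : \sum_i \sum_j alpha i j * y j = \sum_i \sum_j alpha i j * y i.
  by rewrite exchange_big; do 2!(apply: eq_bigr => ? _); rewrite sym.
under eq_bigr do under eq_bigr do rewrite mulrDr.
under eq_bigr do rewrite big_split; rewrite big_split /= e -mulr2n -[leLHS]mulr_natl.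
rewrite -[leRHS]mulrA ler_pM2l // mulr_sumr; apply: ler_sum => i _.
by rewrite -mulr_suml ler_wpM2r.
Qed.

Lemma dirichlet_le alpha (D : R) x : (forall i j, 0 <= alpha i j) ->
  symmetric_fun alpha -> (forall i, \sum_j alpha i j <= D) ->
  dirichlet alpha x <= 4 * D * nrm2 x.
Proof.
move=> a0 sym hD; have := @sum_sym_deg alpha D (fun i => x i ^+ 2) sym hD _.
move=> /(_ (fun i => sqr_ge0 _)) h.
apply: le_trans (_ : 2 * (\sum_i \sum_j alpha i j * (x i ^+ 2 + x j ^+ 2)) <= _).
  rewrite mulr_sumr; apply: ler_sum => i _; rewrite mulr_sumr.
  apply: ler_sum => j _; rewrite [leRHS]mulrCA ler_wpM2l //.
  by have := sqr_ge0 (x i + x j); nra.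
rewrite /nrm2; lra.
Qed.

(* Induction on the support: peel off the lowest positive level of [g]. *)
Lemma cut_layer_cake alpha (h : R) g : (forall i j, 0 <= alpha i j) ->
  symmetric_fun alpha ->
  (forall S : {set 'I_n}, (2 * #|S| <= n)%N ->
     h * #|S|%:R <= \sum_(i in S) \sum_(j in ~: S) alpha i j) ->
  (forall i, 0 <= g i) -> (2 * #|[set i | g i != 0%R]| <= n)%N ->
  2 * h * (\sum_i g i) <= \sum_i \sum_j alpha i j * `|g i - g j|.
Proof.
move=> a0 sym hcut.
have [k] := ubnP #|[set i | g i != 0%R]|.
elim: k g => // k IH g; rewrite ltnS => gk g0 gn.
set T := [set i | g i != 0] in gk gn *.
have [T0|[i1 i1T]] := set_0Vmem T.
  rewrite big1 ?mulr0 => [|i _]; last first.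
    by apply/eqP; have := finset.in_set0 i; rewrite -T0 inE => /negbFE.
  by do 2!(apply: sumr_ge0 => ? _); rewrite mulr_ge0.
pose i0 := [arg min_(i < i1 in T) g i]%O.
have [i0T i0min] : i0 \in T /\ forall j, j \in T -> g i0 <= g j.
  by rewrite /i0; case: arg_minP.
set t := g i0.
have t0 : 0 < t by rewrite lt_def g0 andbT; move: i0T; rewrite inE.
pose g' i := if i \in T then g i - t else 0.
have gE i : g i = g' i + t * (i \in T)%:R.
  rewrite /g'; case: ifP => iT; first by rewrite mulr1 subrK.
  by rewrite mulr0 addr0; move/negbT: iT; rewrite inE negbK => /eqP.
have g'0 i : 0 <= g' i by rewrite /g'; case: ifP => // /i0min; rewrite subr_ge0.
have subT : [set i | g' i != 0] \proper T.
  apply/properP; split; last by exists i0 => //; rewrite inE /g' i0T subrr eqxx.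
  by apply/fintype.subsetP => i; rewrite inE /g'; case: ifP => //; rewrite eqxx.
have hk := proper_card subT.
have {}IH := IH g' (leq_trans hk gk) g'0
  (leq_trans (leq_mul (leqnn 2) (ltnW hk)) gn).
have absE i j : `|g i - g j| = `|g' i - g' j| + t * `|(i \in T)%:R - (j \in T)%:R|.
  have := g'0 i; have := g'0 j; have t0' := ltW t0.
  rewrite !gE /g'; case: (i \in T); case: (j \in T) => /= a b;
    rewrite ?mulr1n ?mulr0n.
  - by rewrite !subrr normr0 mulr0 addr0; congr `|_|; ring.
  - by rewrite mulr0 !addr0 !subr0 normr1 !mulr1 (ger0_norm b) !subrK ger0_norm.
  - rewrite mulr0 !addr0 !sub0r !normrN normr1 !mulr1 (ger0_norm a) !subrK.
    by rewrite ger0_norm.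
  - by rewrite !mulr0 !addr0 !subrr normr0 mulr0 addr0.
have cutE : \sum_i \sum_j alpha i j * `|(i \in T)%:R - (j \in T)%:R| =
            2 * \sum_(i in T) \sum_(j in ~: T) alpha i j.
  rewrite (bigID (mem T)) /= mulr_natl mulr2n; congr (_ + _).
    apply: eq_bigr => i iT; rewrite [RHS]big_mkcond /=; apply: eq_bigr => j _.
    rewrite iT finset.in_setC; case: (j \in T) => /=; first by rewrite mulr1n subrr normr0 mulr0.
    by rewrite mulr1n mulr0n subr0 normr1 mulr1.
  transitivity (\sum_(i in ~: T) \sum_(j in T) alpha j i).
    rewrite (eq_bigl (fun i => i \in ~: T)) => [|i]; last by rewrite finset.in_setC.
    apply: eq_bigr => i; rewrite finset.in_setC => /negbTE iT.
    rewrite [RHS]big_mkcond /=; apply: eq_bigr => j _; rewrite iT sym.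
    case: (j \in T) => /=; first by rewrite mulr0n sub0r normrN normr1 mulr1.
    by rewrite mulr0n subrr normr0 mulr0.
  by rewrite exchange_big.
have -> : \sum_i \sum_j alpha i j * `|g i - g j| =
    \sum_i \sum_j alpha i j * `|g' i - g' j| +
    t * (2 * \sum_(i in T) \sum_(j in ~: T) alpha i j).
  rewrite -cutE mulr_sumr -big_split; apply: eq_bigr => i _.
  rewrite mulr_sumr -big_split; apply: eq_bigr => j _.
  by rewrite absE /=; ring.
have -> : \sum_i g i = \sum_i g' i + t * #|T|%:R.
  under eq_bigr do rewrite gE; rewrite big_split -mulr_sumr /=; congr (_ + _ * _).
  by rewrite -sum1_card natr_sum [RHS]big_mkcond; apply: eq_bigr => i _; case: (i \in T).
have := ler_wpM2l (ltW t0) (hcut _ gn); lra.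
Qed.

(** Take the smallest value [x i] exceeded by at most half of the coordinates. If [x k] is the
    largest value strictly below it, minimality says that more than half of the coordinates exceed
    [x k], and these are exactly the coordinates that are not below [x i]. *)
Lemma median_exists x : (0 < n)%N -> exists m : R,
  (2 * #|[set i | (m < x i)%R]| <= n)%N /\ (2 * #|[set i | (x i < m)%R]| <= n)%N.
Proof.
move=> n0; pose P i := (2 * #|[set j | (x i < x j)%R]| <= n)%N.
have o : 'I_n by case: (n) n0 => // k _; exact: ord0.
pose b := [arg max_(i > o) x i]%O.
have Pb : P b.
  rewrite /P /b; case: arg_maxP => // i _ hi.
  rewrite (_ : [set _ | _] = finset.set0) ?cards0 //.
  by apply/setP => j; rewrite !inE; apply/negbTE; rewrite -leNgt; exact: hi.
have [i Pi hi] := @arg_minP _ _ _ b P x Pb.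
exists (x i); split=> //.
set S := [set j | (x j < x i)%R].
have [S0|[j1 j1S]] := set_0Vmem S; first by rewrite S0 cards0.
have [k kS hk] := @arg_maxP _ _ _ j1 (fun j => j \in S) x j1S.
have : ~~ P k.
  by apply/negP => /hi; move: kS; rewrite inE => h; rewrite leNgt h.
rewrite /P -ltnNge.
have -> : [set j | (x k < x j)%R] = ~: S.
  apply/setP => j; rewrite !inE -leNgt; apply/idP/idP => h; last first.
    by apply: lt_le_trans h; move: kS; rewrite inE.
  rewrite leNgt; apply/negP => ji; have := hk j; rewrite inE ji => /(_ isT) hh.
  by have := lt_le_trans h hh; rewrite ltxx.
by have := cardsC S; rewrite card_ord; lia.
Qed.

(** After centring at a median, the positive and negative parts of [y * |y|] each live on at most
    half of the vertices, so the cut bound integrates over their level sets. Centring leaves the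
    energy unchanged and, [x] having mean zero, can only increase the norm. *)
Lemma cheeger alpha (h D : R) x : (0 < n)%N -> (forall i j, 0 <= alpha i j) ->
  symmetric_fun alpha -> 0 < h -> 0 < D ->
  (forall S : {set 'I_n}, (2 * #|S| <= n)%N ->
     h * #|S|%:R <= \sum_(i in S) \sum_(j in ~: S) alpha i j) ->
  (forall i, \sum_j alpha i j <= D) ->
  \sum_i x i = 0 -> h ^+ 2 / D * nrm2 x <= dirichlet alpha x.
Proof.
move=> n0 a0 sym h0 D0 hcut hD x0.
have [m [mgt mlt]] := median_exists x n0.
pose y i := x i - m.
have yx : nrm2 x <= nrm2 y.
  have -> : nrm2 y = nrm2 x + n%:R * m ^+ 2.
    by rewrite /y nrm2_shift x0 mulr0 addr0 sqrrN.
  by rewrite lerDl mulr_ge0 ?sqr_ge0.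
have dE : dirichlet alpha x = dirichlet alpha y.
  by do 2!(apply: eq_bigr => ? _); rewrite /y; congr (_ * _ ^+ 2); ring.
rewrite dE; apply: le_trans (ler_wpM2l _ yx) _.
  by rewrite divr_ge0 ?sqr_ge0 // ltW.
pose gp i := Num.max (y i * `|y i|) 0; pose gm i := Num.max (- (y i * `|y i|)) 0.
have ygt i : (0 < y i) = (m < x i) by rewrite /y subr_gt0.
have ylt i : (y i < 0) = (x i < m) by rewrite /y subr_lt0.
have gpn : (2 * #|[set i | gp i != 0%R]| <= n)%N.
  apply: leq_trans mgt; rewrite leq_mul2l /=; apply: subset_leq_card.
  apply/fintype.subsetP => i; rewrite !inE -ygt; apply: contraR; rewrite -leNgt => yi.
  by apply/eqP/max_idPr; rewrite mulr_le0_ge0.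
have gmn : (2 * #|[set i | gm i != 0%R]| <= n)%N.
  apply: leq_trans mlt; rewrite leq_mul2l /=; apply: subset_leq_card.
  apply/fintype.subsetP => i; rewrite !inE -ylt; apply: contraR; rewrite -leNgt => yi.
  by apply/eqP/max_idPr; rewrite oppr_le0 mulr_ge0.
have gp0 i : 0 <= gp i by rewrite le_max lexx orbT.
have gm0 i : 0 <= gm i by rewrite le_max lexx orbT.
have hp := cut_layer_cake a0 sym hcut gp0 gpn.
have hm := cut_layer_cake a0 sym hcut gm0 gmn.
have mE (a : R) : Num.max a 0 = (a + `|a|) / 2.
  by rewrite maxr_absE subr0 addr0.
have nE (a : R) : `|a * `|a| | = `|a| ^+ 2 by rewrite normrM normr_id.
have key : 2 * h * nrm2 y <=
   \sum_i \sum_j alpha i j * (`|y i - y j| * (`|y i| + `|y j|)).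
  have -> : nrm2 y = \sum_i gp i + \sum_i gm i.
    rewrite -big_split; apply: eq_bigr => i _; rewrite /gp /gm !mE normrN nE /=.
    by rewrite real_normK ?num_real //; field.
  rewrite mulrDr; apply: le_trans (lerD hp hm) _.
  rewrite -big_split; apply: ler_sum => i _; rewrite -big_split.
  apply: ler_sum => j _; rewrite /= -mulrDr ler_wpM2l //.
  rewrite /gp /gm !mE !normrN !nE.
  set a := y i; set b := y j.
  have [a1|a1] := lerP 0 a; have [b1|b1] := lerP 0 b;
    rewrite ?(ger0_norm a1) ?(ltr0_norm a1) ?(ger0_norm b1) ?(ltr0_norm b1).
  - have -> : (a * a + a ^+ 2) / 2 - (b * b + b ^+ 2) / 2 = (a - b) * (a + b).
      by field.
    have -> : (- (a * a) + a ^+ 2) / 2 - (- (b * b) + b ^+ 2) / 2 = 0 by field.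
    by rewrite normr0 addr0 normrM (ger0_norm (_ : 0 <= a + b)) // addr_ge0.
  - have -> : (a * a + a ^+ 2) / 2 - (b * - b + (- b) ^+ 2) / 2 = a ^+ 2 by field.
    have -> : (- (a * a) + a ^+ 2) / 2 - (- (b * - b) + (- b) ^+ 2) / 2 = - b ^+ 2
      by field.
    by rewrite normrN !ger0_norm ?sqr_ge0 //; nra.
  - have -> : (a * - a + (- a) ^+ 2) / 2 - (b * b + b ^+ 2) / 2 = - b ^+ 2 by field.
    have -> : (- (a * - a) + (- a) ^+ 2) / 2 - (- (b * b) + b ^+ 2) / 2 = a ^+ 2
      by field.
    rewrite normrN (ler0_norm (_ : a - b <= 0)); last lra.
    by rewrite !ger0_norm ?sqr_ge0 //; nra.
  - have -> : (a * - a + (- a) ^+ 2) / 2 - (b * - b + (- b) ^+ 2) / 2 = 0 by field.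
    have -> : (- (a * - a) + (- a) ^+ 2) / 2 - (- (b * - b) + (- b) ^+ 2) / 2 =
       (a - b) * (a + b) by field.
    rewrite normr0 add0r normrM (ler0_norm (_ : a + b <= 0)); last lra.
    by rewrite [- (a + b)]opprD.
(* Young's inequality in place of Cauchy-Schwarz: the weights [D / h] and [h / (2 D)] are chosen so
   that the second sum is at most [h * nrm2 y], half of the left side of [key]. *)
have key2 : \sum_i \sum_j alpha i j * (`|y i - y j| * (`|y i| + `|y j|)) <=
   D / h * dirichlet alpha y + h * nrm2 y.
  have hs := @sum_sym_deg alpha D (fun i => y i ^+ 2) sym hD (fun i => sqr_ge0 _).
  apply: le_trans (_ : D / h * dirichlet alpha y +
     h / (2 * D) * (\sum_i \sum_j alpha i j * (y i ^+ 2 + y j ^+ 2)) <= _); last first.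
    rewrite lerD2l.
    have -> : h * nrm2 y = h / (2 * D) * (2 * D * \sum_i y i ^+ 2).
      by rewrite /nrm2; field; rewrite gt_eqF.
    by rewrite ler_wpM2l // divr_ge0 // ltW // mulr_gt0.
  rewrite /dirichlet !mulr_sumr -big_split; apply: ler_sum => i _.
  rewrite !mulr_sumr -big_split; apply: ler_sum => j _ /=.
  rewrite ![_ / _ * (alpha _ _ * _)]mulrCA -mulrDr ler_wpM2l //.
  set a := `|y i - y j|; set b := `|y i|; set c := `|y j|.
  have -> : (y i - y j) ^+ 2 = a ^+ 2 by rewrite real_normK ?num_real.
  have -> : y i ^+ 2 = b ^+ 2 by rewrite real_normK ?num_real.
  have -> : y j ^+ 2 = c ^+ 2 by rewrite real_normK ?num_real.
  have e : D / h * a ^+ 2 + h / (2 * D) * (b ^+ 2 + c ^+ 2) - a * (b + c) =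
     (h / (4 * D)) * ((2 * D / h * a - (b + c)) ^+ 2 + (b - c) ^+ 2).
    by field; rewrite !gt_eqF.
  rewrite -subr_ge0 e mulr_ge0 ?addr_ge0 ?sqr_ge0 // divr_ge0 // ?ltW // mulr_gt0 //.
have : h * nrm2 y <= D / h * dirichlet alpha y by lra.
move=> hh; have := ler_wpM2l (_ : 0 <= h / D) hh.
rewrite divr_ge0 ?(ltW h0) ?(ltW D0) // => /(_ isT).
have -> : h / D * (D / h * dirichlet alpha y) = dirichlet alpha y.
  by field; rewrite !gt_eqF.
by apply: le_trans; rewrite (_ : h / D * _ = h ^+ 2 / D * nrm2 y) //; ring.
Qed.

(* Setting coordinate [m] to [0] costs at most [2 nrm2 x] because the weights
   at [m] are at most [1]; the new constant weights [p] control [x m]. *)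
Lemma leave_one_out_poincare alpha (lam p : R) (m : 'I_n) x :
  (forall i j, 0 <= alpha i j <= 1) -> symmetric_fun alpha ->
  (forall z, \sum_i z i = 0 -> lam * nrm2 z <= dirichlet alpha z) ->
  4 <= lam -> lam <= n%:R * p -> p <= 1 ->
  \sum_i x i = 0 ->
  lam / 2 * nrm2 x <=
  dirichlet (fun i j => if (i == m) || (j == m) then p else alpha i j) x.
Proof.
move=> a01 sym hP lam4 lamp p1 x0.
have np0 : (0 < n)%N by case: (n) m => // -[].
have n0 : 0 < n%:R :> R by rewrite ltr0n.
set al := fun i j => _.
pose y i := if i == m then 0 else x i.
have a0 i j : 0 <= alpha i j by case/andP: (a01 i j).
have a1 i j : alpha i j <= 1 by case/andP: (a01 i j).
have p0 : 0 <= p by rewrite -(pmulr_rge0 _ n0); lra.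
have xE : nrm2 x = x m ^+ 2 + nrm2 y.
  rewrite /nrm2 (bigD1 m) //=; congr (_ + _).
  rewrite [RHS](bigD1 m) //= /y eqxx expr0n /= add0r.
  by apply: eq_bigr => i /negbTE ->.
have dy : dirichlet alpha y <= dirichlet al x - 2 * p * (\sum_i (x m - x i) ^+ 2)
    + 2 * nrm2 y.
  have split2 (be : 'I_n -> 'I_n -> R) z : symmetric_fun be ->
     dirichlet be z = \sum_(i | i != m) \sum_(j | j != m) be i j * (z i - z j) ^+ 2
       + 2 * \sum_i be m i * (z m - z i) ^+ 2.
    move=> bs.
    have e : \sum_(i | i != m) be i m * (z i - z m) ^+ 2 =
             \sum_i be m i * (z m - z i) ^+ 2.
      rewrite [RHS](bigD1 m) //= subrr expr0n mulr0 add0r.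
      by apply: eq_bigr => i _; rewrite bs -[in RHS]opprB sqrrN.
    rewrite /dirichlet (bigD1 m) //=.
    under [X in _ + X = _]eq_bigr do rewrite (bigD1 m) //=.
    by rewrite big_split /= e; ring.
  have als : symmetric_fun al by move=> i j; rewrite /al orbC sym.
  rewrite !split2 //.
  have -> : \sum_(i | i != m) \sum_(j | j != m) al i j * (x i - x j) ^+ 2 =
            \sum_(i | i != m) \sum_(j | j != m) alpha i j * (y i - y j) ^+ 2.
    apply: eq_bigr => i im; apply: eq_bigr => j jm.
    by rewrite /al /y (negbTE im) (negbTE jm).
  have -> : \sum_i al m i * (x m - x i) ^+ 2 = p * \sum_i (x m - x i) ^+ 2.
    by rewrite mulr_sumr; apply: eq_bigr => i _; rewrite /al eqxx.
  have : \sum_i alpha m i * (y m - y i) ^+ 2 <= nrm2 y.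
    apply: ler_sum => i _; rewrite {1}/y eqxx sub0r sqrrN.
    by rewrite ler_piMl ?sqr_ge0.
  lra.
have sumx : \sum_i (x m - x i) ^+ 2 = n%:R * x m ^+ 2 + nrm2 x.
  transitivity (nrm2 (fun i => x i - x m)).
    by apply: eq_bigr => i _; rewrite -sqrrN opprB.
  by rewrite nrm2_shift x0 mulr0 addr0 sqrrN addrC.
have ysum : \sum_i y i = - x m.
  have : \sum_i x i = x m + \sum_i y i.
    rewrite (bigD1 m) //= [in RHS](bigD1 m) //= {1}/y eqxx add0r; congr (_ + _).
    by apply: eq_bigr => i /negbTE im; rewrite /y im.
  rewrite x0; lra.
pose z i := y i + x m / n%:R.
have zsum : \sum_i z i = 0.
  rewrite big_split /= ysum sumr_const card_ord -[(_ / _) *+ n]mulr_natr divfK ?addNr //.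
  by rewrite gt_eqF.
have zE : nrm2 z = nrm2 y - x m ^+ 2 / n%:R.
  rewrite /z nrm2_shift ysum; field; rewrite gt_eqF //.
have dz : dirichlet alpha z = dirichlet alpha y.
  by do 2!(apply: eq_bigr => ? _); rewrite /z; congr (_ * _ ^+ 2); ring.
have := hP z zsum; rewrite zE dz => hz.
have hxm : lam * (x m ^+ 2 / n%:R) <= p * x m ^+ 2.
  rewrite mulrA mulrAC ler_wpM2r ?sqr_ge0 // ler_pdivrMr //; lra.
have b0 := nrm2_ge0 y; have b1 := sqr_ge0 (x m).
have b2 : 4 * nrm2 y <= lam * nrm2 y by rewrite ler_wpM2r.
have b3 : lam * x m ^+ 2 <= n%:R * p * x m ^+ 2 by rewrite ler_wpM2r.
have b4 : 0 <= p * nrm2 y by rewrite mulr_ge0.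
have b5 : 0 <= p * x m ^+ 2 by rewrite mulr_ge0.
move: dy hz; rewrite sumx xE mulrBr mulrDr; nra.
Qed.

End Laplacian.

(** * Monotone flow equations *)

Section FlowEquation.
Variables (R : realType) (n : nat).
Variables (alpha : 'I_n -> 'I_n -> R) (phi : 'I_n -> 'I_n -> R -> R) (c lam : R).
Implicit Types x y b : 'I_n -> R.

(** A nonlinear graph Laplacian; [phi i j t = W i j * t] gives the linear weighted one. *)
Definition flow x i : R := \sum_j alpha i j * phi i j (x i - x j).

Hypothesis alpha01 : forall i j, 0 <= alpha i j <= 1.
Hypothesis alpha_sym : symmetric_fun alpha.
Hypothesis phi_odd : forall i j t, phi j i (- t) = - phi i j t.
Hypothesis c0 : 0 < c.
Hypothesis phi_mono : forall i j s t,
  c * (s - t) ^+ 2 <= (phi i j s - phi i j t) * (s - t).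
Hypothesis phi_lip : forall i j s t, `|phi i j s - phi i j t| <= `|s - t|.

Let alpha0 i j : 0 <= alpha i j. Proof. by case/andP: (alpha01 i j). Qed.

Lemma flow_antisym x i j :
  alpha j i * phi j i (x j - x i) = - (alpha i j * phi i j (x i - x j)).
Proof. by rewrite -opprB phi_odd alpha_sym mulrN. Qed.

Lemma flow_sum0 x : \sum_i flow x i = 0.
Proof.
have := sum_antisym (fun=> 1) (flow_antisym x).
rewrite (eq_bigr (flow x)) => [|i _]; last by rewrite mul1r.
rewrite [RHS]big1 => [|i _]; last by rewrite big1 // => j _; rewrite subrr mulr0.
by move/eqP; rewrite mulf_eq0 pnatr_eq0 => /eqP.
Qed.

Lemma flow_monotone x y :
  c * dirichlet alpha (fun i => x i - y i) <=
  2 * \sum_i (x i - y i) * (flow x i - flow y i).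
Proof.
pose G i j := alpha i j * (phi i j (x i - x j) - phi i j (y i - y j)).
have Ga i j : G j i = - G i j.
  by rewrite /G !mulrBr (flow_antisym x i j) (flow_antisym y i j) opprB opprK addrC.
have -> : \sum_i (x i - y i) * (flow x i - flow y i) =
          \sum_i (x i - y i) * \sum_j G i j.
  apply: eq_bigr => i _; congr (_ * _); rewrite /flow -sumrB.
  by apply: eq_bigr => j _; rewrite /G mulrBr.
rewrite sum_antisym // mulr_sumr; apply: ler_sum => i _; rewrite mulr_sumr.
apply: ler_sum => j _; rewrite /G [leLHS]mulrCA -mulrA ler_wpM2l //.
have -> : x i - y i - (x j - y j) = (x i - x j) - (y i - y j) by ring.
exact: phi_mono.
Qed.

(** The crude constant only has to be finite: it sets the rate of the iteration in [flow_solvable]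
    and enters no later estimate. *)
Lemma flow_lipschitz x y : nrm2 (fun i => flow x i - flow y i) <=
  4 * n%:R ^+ 2 * nrm2 (fun i => x i - y i).
Proof.
set d := fun i => x i - y i.
have B i : (flow x i - flow y i) ^+ 2 <= n%:R * \sum_j (2 * d i ^+ 2 + 2 * d j ^+ 2).
  rewrite /flow -sumrB.
  pose r j := alpha i j * phi i j (x i - x j) - alpha i j * phi i j (y i - y j).
  have := cauchy_schwarz1 (fun=> 1) r.
  rewrite (eq_bigr r) => [|j _]; last by rewrite mul1r.
  rewrite [X in X * _](eq_bigr (fun=> 1)) => [|j _]; last by rewrite expr1n.
  rewrite sumr_const card_ord => /le_trans; apply.
  apply: ler_wpM2l; first exact: ler0n.
  apply: ler_sum => j _; rewrite /r -mulrBr exprMn.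
  have h1 : alpha i j ^+ 2 <= 1 by case/andP: (alpha01 i j) => ? ?; rewrite expr_le1.
  apply: le_trans (ler_piMl (sqr_ge0 _) h1) _.
  have h2 := phi_lip i j (x i - x j) (y i - y j).
  apply: le_trans (_ : (d i - d j) ^+ 2 <= _); last first.
    by have := sqr_ge0 (d i + d j); nra.
  rewrite -[leLHS]real_normK ?num_real // -[leRHS]real_normK ?num_real //.
  rewrite ler_pXn2r ?nnegrE //; apply: le_trans h2 _.
  by rewrite /d (_ : x i - x j - _ = x i - y i - (x j - y j)) //; ring.
apply: le_trans (ler_sum _ (fun i _ => B i)) _.
rewrite -mulr_sumr.
have -> : \sum_i \sum_j (2 * d i ^+ 2 + 2 * d j ^+ 2) = 4 * n%:R * nrm2 d.
  under eq_bigr do rewrite big_split /= sumr_const card_ord.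
  rewrite big_split /= sumr_const card_ord -!mulr_sumr -/(nrm2 d).
  have -> : \sum_i (2 * d i ^+ 2) *+ n = 2 * n%:R * nrm2 d.
    by rewrite mulr_sumr; apply: eq_bigr => i _; rewrite -[LHS]mulr_natr mulrAC.
  by rewrite -[X in _ + X]mulr_natr; ring.
by rewrite le_eqVlt; apply/orP; left; apply/eqP; ring.
Qed.

Hypothesis lam0 : 0 < lam.
Hypothesis poincare : forall x, \sum_i x i = 0 -> lam * nrm2 x <= dirichlet alpha x.

Let mu := c * lam / 2.
(** Adding [mu^2] keeps this positive for every [n] and at least [mu^2], so that [rho] lies in
    [[0, 1)]. The step [eta] minimises [1 - 2 eta mu + eta^2 Lam2], and [rho] is the minimum. *)
Let Lam2 : R := 4 * n%:R ^+ 2 + mu ^+ 2.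
Let eta := mu / Lam2.
Let rho := 1 - mu ^+ 2 / Lam2.
Let mu0 : 0 < mu. Proof. by rewrite divr_gt0 ?mulr_gt0. Qed.
Let Lam20 : 0 < Lam2.
Proof.
by rewrite ltr_wpDl ?exprn_gt0 // mulr_ge0 // exprn_ge0.
Qed.
Let rho01 : 0 <= rho < 1.
Proof.
rewrite /rho subr_ge0 ler_pdivrMr // mul1r lerDr mulr_ge0 ?exprn_ge0 //=.
by rewrite ltrBlDr ltrDl divr_gt0 ?exprn_gt0.
Qed.

Lemma flow_coercive x y : \sum_i x i = 0 -> \sum_i y i = 0 ->
  mu * nrm2 (fun i => x i - y i) <= \sum_i (x i - y i) * (flow x i - flow y i).
Proof.
move=> x0 y0; have h := flow_monotone x y.
have /poincare : \sum_i (x i - y i) = 0 by rewrite sumrB x0 y0 subrr.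
move=> /(ler_wpM2l (ltW c0)); rewrite mulrA; move: h; rewrite /mu.
set a := dirichlet _ _; set s := \sum_i _; set t := nrm2 _; lra.
Qed.

(** Coercivity followed by Cauchy-Schwarz. The Euclidean estimates below all compare a vector with a
    known solution and bound its residual. *)
Lemma flow_stable x y : \sum_i x i = 0 -> \sum_i y i = 0 ->
  mu ^+ 2 * nrm2 (fun i => x i - y i) <= nrm2 (fun i => flow x i - flow y i).
Proof.
move=> x0 y0; have h := flow_coercive x0 y0.
have cs := cauchy_schwarz1 (fun i => x i - y i) (fun i => flow x i - flow y i).
set N := nrm2 (fun i => x i - y i) in h *.
have N0 : 0 <= N by exact: nrm2_ge0.
have [->|N1] := eqVneq N 0; first by rewrite mulr0 nrm2_ge0.
have Npos : 0 < N by rewrite lt_def N1.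
rewrite -(ler_pM2l Npos); apply: le_trans cs; apply: le_trans (_ : (mu * N) ^+ 2 <= _).
  by rewrite le_eqVlt; apply/orP; left; apply/eqP; ring.
have muN : 0 <= mu * N by rewrite mulr_ge0 // ltW.
by rewrite ler_pXn2r ?nnegrE // (le_trans muN h).
Qed.

(* Picard iteration: [x - eta (flow x - b)] contracts the Euclidean norm on
   the zero-sum hyperplane. *)
Lemma flow_solvable b : \sum_i b i = 0 ->
  exists x, \sum_i x i = 0 /\ forall i, flow x i = b i.
Proof.
move=> b0.
pose T x i := x i - eta * (flow x i - b i).
have T0 x : \sum_i x i = 0 -> \sum_i T x i = 0.
  by move=> x0; rewrite sumrB -mulr_sumr sumrB flow_sum0 x0 b0 subrr mulr0 subrr.
have Tc x y : \sum_i x i = 0 -> \sum_i y i = 0 ->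
    nrm2 (fun i => T x i - T y i) <= rho * nrm2 (fun i => x i - y i).
  move=> x0 y0; have h1 := flow_coercive x0 y0; have h2 := flow_lipschitz x y.
  have -> : nrm2 (fun i => T x i - T y i) = nrm2 (fun i => x i - y i)
     - 2 * eta * (\sum_i (x i - y i) * (flow x i - flow y i))
     + eta ^+ 2 * nrm2 (fun i => flow x i - flow y i).
    rewrite /nrm2 !mulr_sumr -sumrB -big_split; apply: eq_bigr => i _ /=.
    by rewrite /T; ring.
  set N := nrm2 (fun i => x i - y i) in h1 h2 *.
  have N0 : 0 <= N by exact: nrm2_ge0.
  have e1 : 0 < eta by rewrite divr_gt0.
  have := ler_wpM2l (ltW e1) h1.
  have := ler_wpM2l (sqr_ge0 eta) h2.
  have h3 : eta ^+ 2 * (4 * n%:R ^+ 2 * N) <= eta ^+ 2 * (Lam2 * N).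
    by rewrite ler_wpM2l ?sqr_ge0 // ler_wpM2r // /Lam2 lerDl sqr_ge0.
  have e2 : eta ^+ 2 * (Lam2 * N) = eta * mu * N.
    by rewrite /eta; field; rewrite gt_eqF.
  have -> : rho = 1 - eta * mu by rewrite /rho /eta; field; rewrite gt_eqF.
  lra.
pose x k := iter k T (fun=> 0).
have x0 k : \sum_i x k i = 0 by elim: k => [|k IH]; [rewrite big1|exact: T0].
have xD k : nrm2 (fun i => x k.+1 i - x k i) <=
            rho ^+ k * nrm2 (fun i => x 1%N i - x 0%N i).
  elim: k => [|k IH]; first by rewrite expr0 mul1r.
  apply: le_trans (Tc (x k.+1) (x k) (x0 _) (x0 _)) _.
  by rewrite exprS -mulrA ler_wpM2l //; case/andP: rho01.
have xcvg i : cvgn (fun k => x k i).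
  pose C := Num.sqrt (nrm2 (fun i => x 1%N i - x 0%N i)).
  (* [nrm2] is a squared norm, so the increments of one coordinate decay like powers of
     [Num.sqrt rho]. *)
  have hs : cvgn (series (telescope (fun k => x k i))).
    apply: normed_cvg; apply: series_le_cvg (_ : cvgn (series (geometric C (Num.sqrt rho)))).
    - by move=> k /=.
    - by move=> k; rewrite /geometric /= mulr_ge0 ?exprn_ge0 // sqrtr_ge0.
    - move=> k; rewrite /geometric /= /telescope /=.
      have : (x k.+1 i - x k i) ^+ 2 <= (C * Num.sqrt rho ^+ k) ^+ 2.
        apply: le_trans (nrm2_coord (fun i => x k.+1 i - x k i) i) _.
        apply: le_trans (xD k) _.
        rewrite exprMn -exprM mulnC exprM !sqr_sqrtr ?nrm2_ge0 //; last by case/andP: rho01.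
        by rewrite mulrC.
      have C0 : 0 <= C * Num.sqrt rho ^+ k.
        by rewrite mulr_ge0 ?exprn_ge0 ?sqrtr_ge0.
      by rewrite -[X in X <= _]real_normK ?num_real // ler_pXn2r ?nnegrE.
    - apply: is_cvg_geometric_series.
      rewrite ger0_norm ?sqrtr_ge0 // -[ltRHS]sqrtr1 ltr_sqrt //.
      by case/andP: rho01.
  have -> : (fun k => x k i) = (fun k => series (telescope (fun k => x k i)) k).
    by apply/funext => k; rewrite telescopeK /= subr0.
  exact: hs.
pose d i := limn (fun k => x k i).
have xd i : (x^~ i @ \oo --> d i)%classic by exact: xcvg.
have ecvg : ((fun k => nrm2 (fun i => x k i - d i)) @ \oo --> (0 : R))%classic.
  have -> : (0 : R) = \sum_(i < n) (d i - d i) ^+ 2.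
    by rewrite big1 // => i _; rewrite subrr expr0n.
  apply: (@cvg_big _ _ _ _ _ add_continuous) => i _.
  have hd : ((fun k => x k i - d i) @ \oo --> d i - d i)%classic.
    by apply: cvgB; [exact: xd|exact: cvg_cst].
  exact: (cvgM hd hd).
have d0 : \sum_i d i = 0.
  have : ((fun k => \sum_i x k i) @ \oo --> \sum_i d i)%classic.
    by apply: (@cvg_big _ _ _ _ _ add_continuous) => i _; exact: xd.
  under eq_fun do rewrite x0.
  by move/cvg_lim => <- //; rewrite lim_cst.
(* [T d - d] is split as [(T d - T x_N) + (x_(N+1) - d)]; [nrm2D] doubles both squared norms, hence
   the tolerance [e / 4]. *)
have fixT : nrm2 (fun i => T d i - d i) = 0.
  apply/eqP; rewrite eq_le nrm2_ge0 andbT; apply/ler_addgt0Pr => e e0.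
  have e4 : 0 < e / 4 by rewrite divr_gt0.
  have /cvgrPdist_lt /(_ _ e4) := ecvg; case=> N _ hN.
  have hk k : (N <= k)%N -> nrm2 (fun i => x k i - d i) < e / 4.
    by move=> /hN /=; rewrite sub0r normrN ger0_norm ?nrm2_ge0.
  have a1 := hk N (leqnn N); have a2 := hk N.+1 (leqnSn N).
  have a3 := Tc d (x N) d0 (x0 N).
  have -> : nrm2 (fun i => T d i - d i) =
            nrm2 (fun i => (T d i - T (x N) i) + (x N.+1 i - d i)).
    by apply: eq_bigr => i _; congr (_ ^+ 2); rewrite addrA subrK.
  apply: le_trans (nrm2D _ _) _.
  have a4 : nrm2 (fun i => d i - x N i) = nrm2 (fun i => x N i - d i).
    by apply: eq_bigr => i _; rewrite -sqrrN opprB.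
  have a5 : rho * nrm2 (fun i => x N i - d i) <= nrm2 (fun i => x N i - d i).
    by rewrite ler_piMl ?nrm2_ge0 // ltW //; case/andP: rho01.
  move: a3 a5 a1 a2; rewrite a4 add0r; set X := nrm2 _; set Y := nrm2 _.
  set Z := nrm2 _; lra.
exists d; split=> // i; have := nrm2_coord (fun i => T d i - d i) i.
rewrite fixT => h; have /eqP : (T d i - d i) ^+ 2 == 0 by rewrite eq_le h sqr_ge0.
rewrite /T addrAC subrr add0r sqrrN => /eqP; rewrite sqrf_eq0 mulf_eq0.
have e0 : 0 < eta by rewrite divr_gt0.
by rewrite (gt_eqF e0) /= subr_eq0 => /eqP.
Qed.

End FlowEquation.

(** * Truncated link and likelihood *)

Section TruncatedLink.
Variables (R : realType) (B : R).
Hypothesis B0 : 0 <= B.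
Implicit Types s t x : R.

Definition clamp t : R := Num.max (- B) (Num.min t B).

(* Agrees with [psi] on [-B, B] but is bi-Lipschitz on the whole line, so that
   the modified likelihood equations always have a unique solution. *)
Definition psit t : R := psi (clamp t) + (t - clamp t).

Definition slope : R := expR (- B) / (1 + expR B) ^+ 2.

Lemma slope_gt0 : 0 < slope.
Proof. by rewrite divr_gt0 ?exprn_gt0 ?addr_gt0 ?expR_gt0. Qed.

Lemma slope_le1 : slope <= 1.
Proof.
have h := @dpsi_ge R B 0; rewrite normr0 in h.
by apply: le_trans (h B0) _; case/andP: (dpsi_le1 (0 : R)).
Qed.

Lemma clamp_id t : `|t| <= B -> clamp t = t.
Proof.
rewrite ler_norml => /andP[h1 h2]; rewrite /clamp (min_idPl h2).
exact/max_idPr.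
Qed.

Lemma clamp_bound t : `|clamp t| <= B.
Proof.
rewrite ler_norml /clamp le_max lexx /= ge_max ge_min lexx orbT andbT.
by rewrite (le_trans _ B0) // oppr_le0.
Qed.

Lemma clampN t : clamp (- t) = - clamp t.
Proof.
rewrite /clamp; case: (lerP (- t) B) => ?; case: (lerP t B) => ?;
  do ?[case: lerP => ?]; have := B0; lra.
Qed.

Lemma clamp_mono s t : s <= t -> 0 <= clamp t - clamp s <= t - s.
Proof.
move=> st; rewrite /clamp; case: (lerP s B) => ?; case: (lerP t B) => ?;
  case: (lerP (- B) s) => ?; case: (lerP (- B) t) => ?;
  case: (lerP (- B) B) => ?; have := B0; move=> ?; apply/andP; split; lra.
Qed.

Lemma psit_id t : `|t| <= B -> psit t = psi t.
Proof. by move=> h; rewrite /psit clamp_id // subrr addr0. Qed.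

Lemma psitN t : psit (- t) = 1 - psit t.
Proof. by rewrite /psit clampN psiN; ring. Qed.

(** The increment [t - s] splits into the clamped increment, where [psi] is bi-Lipschitz, and the
    excess, on which [psit] has slope 1, which is at least [slope]. *)
Lemma psit_bilip s t : s <= t -> slope * (t - s) <= psit t - psit s <= t - s.
Proof.
move=> st; have /andP[d0 d1] := clamp_mono st.
have cst : clamp s <= clamp t by rewrite -subr_ge0.
have /andP[h1 h2] := psi_bilip (clamp_bound s) (clamp_bound t) cst.
have c1 := slope_le1; have c0 := slope_gt0.
rewrite -/slope in h1; rewrite /psit; move: h1 h2 d0 d1 c1 c0.
set a := clamp s; set b := clamp t; set pa := psi a; set pb := psi b.
set c := slope => h1 h2 d0 d1 c1 c0.
have : 0 <= (1 - c) * (t - s - (b - a)) by rewrite mulr_ge0; lra.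
lra.
Qed.

Lemma psit_mono s t : slope * (s - t) ^+ 2 <= (psit s - psit t) * (s - t).
Proof.
have [st|/ltW st] := lerP s t.
  have /andP[h _] := psit_bilip st.
  have : 0 <= t - s by lra.
  by move=> /ler_wpM2r /(_ _ _ h); nra.
have /andP[h _] := psit_bilip st.
have : 0 <= s - t by lra.
by move=> /ler_wpM2r /(_ _ _ h); nra.
Qed.

Lemma psit_lip s t : `|psit s - psit t| <= `|s - t|.
Proof.
wlog st : s t / s <= t.
  move=> h; case/orP: (le_total s t) => /h //.
  by rewrite distrC [X in _ <= X]distrC.
have /andP[h1 h2] := psit_bilip st.
have h3 : 0 <= slope * (t - s) by rewrite mulr_ge0 ?(ltW slope_gt0) // subr_ge0.
by rewrite distrC [leRHS]distrC !ger0_norm //; lra.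
Qed.

End TruncatedLink.

(** * Convexity of the likelihood: stationary points and uniqueness of the estimator *)

Section Likelihood.
Variables (R : realType) (n L : nat).
Implicit Types (w : Omega n L) (th : 'I_n -> R).

Definition adj w (i j : 'I_n) : R := (Aij w i j)%:R.

Lemma Aij_lt w (i j : 'I_n) (h : (i < j)%N) : Aij w i j = w.1 (Sub (i, j) h).
Proof. by rewrite /Aij insubT. Qed.

Lemma Aii w i : Aij w i i = false.
Proof. by rewrite /Aij insubF /= ?ltnn. Qed.

Lemma AijC w i j : Aij w i j = Aij w j i.
Proof.
have [ij|ji|/val_inj ->] := ltngtP i j => //.
  by rewrite /Aij insubT [in RHS]insubF //= ltnNge ltnW.
by rewrite /Aij [in LHS]insubF ?insubT //= ltnNge ltnW.
Qed.

Lemma adj_sym w : symmetric_fun (adj w).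
Proof. by move=> i j; rewrite /adj AijC. Qed.

Lemma adj_diag w i : adj w i i = 0. Proof. by rewrite /adj Aii. Qed.

Lemma adj01 w i j : 0 <= adj w i j <= 1.
Proof. by rewrite /adj; case: Aij; rewrite lexx ?ler01. Qed.

Lemma adj_ge0 w i j : 0 <= adj w i j.
Proof. exact: ler0n. Qed.

Lemma ybarC w i j : i != j -> ybar R w j i = 1 - ybar R w i j.
Proof.
move=> ij; rewrite /ybar; case: ltngtP => //=.
  by rewrite opprB addrCA subrr addr0.
by move/val_inj => ji; rewrite ji eqxx in ij.
Qed.

Lemma sum_lt_sym (F : 'I_n -> 'I_n -> R) : (forall i j, F i j = F j i) ->
  (forall i, F i i = 0) ->
  2 * (\sum_(i < n) \sum_(j < n | (i < j)%N) F i j) = \sum_i \sum_j F i j.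
Proof.
move=> sym diag.
have e : \sum_(i < n) \sum_(j < n | (i < j)%N) F i j = \sum_(i < n) \sum_(j < n | (j < i)%N) F i j.
  under eq_bigr do rewrite big_mkcond; rewrite exchange_big /=.
  apply: eq_bigr => i _; rewrite [RHS]big_mkcond; apply: eq_bigr => j _.
  by rewrite sym.
rewrite mulr_natl mulr2n {2}e -big_split; apply: eq_bigr => i _ /=.
rewrite !(big_mkcond (fun j : 'I_n => (_ < _)%N)) -big_split.
apply: eq_bigr => j _ /=; case: ltngtP; rewrite ?addr0 ?add0r //.
by move/val_inj ->; rewrite diag.
Qed.

Lemma loglikE w th : loglik w th =
  \sum_(i < n) \sum_(j < n | (i < j)%N) adj w i j * pair_loss (ybar R w i j) (th i - th j).
Proof.
apply: eq_bigr => i _; apply: eq_bigr => j ij; rewrite /adj /pair_loss opprB.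
by rewrite (ybarC w (_ : i != j)) // neq_ltn ij.
Qed.

(** The first-order term of the loss in the direction [u], moved by summation by parts onto the
    score equations. *)
Lemma stationary_linear w th u :
  (forall i, \sum_j adj w i j * (psi (th i - th j) - ybar R w i j) = 0) ->
  \sum_(i < n) \sum_(j < n | (i < j)%N)
     adj w i j * ((psi (th i - th j) - ybar R w i j) * (u i - u j)) = 0.
Proof.
move=> st; pose G i j := adj w i j * (psi (th i - th j) - ybar R w i j).
have Ga i j : G j i = - G i j.
  rewrite /G adj_sym; have [->|ij] := eqVneq i j.
    by rewrite adj_diag !mul0r oppr0.
  by rewrite ybarC // -(opprB (th i)) psiN; ring.
have := sum_antisym u Ga; rewrite big1 ?mulr0 => [|i _]; last by rewrite st mulr0.
rewrite -sum_lt_sym; first last.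
- by move=> i; rewrite subrr mulr0.
- by move=> i j; rewrite Ga; ring.
move/esym/eqP; rewrite mulf_eq0 pnatr_eq0 /= => /eqP e; rewrite -[RHS]e.
by do 2!(apply: eq_bigr => ? _); rewrite /G mulrA.
Qed.

Lemma stationary_is_MLE w th : \sum_i th i = 0 ->
  (forall i, \sum_j adj w i j * (psi (th i - th j) - ybar R w i j) = 0) ->
  is_MLE w th.
Proof.
move=> th0 st; split=> // th' _; rewrite !loglikE -subr_ge0 -sumrB.
rewrite -[leLHS](stationary_linear (fun i => th' i - th i) st); apply: ler_sum => i _.
rewrite -sumrB; apply: ler_sum => j _; rewrite -mulrBr ler_wpM2l ?adj_ge0 //.
have := pair_loss_tangent (ybar R w i j) (th i - th j) (th' i - th' j).
have -> : th' i - th i - (th' j - th j) = th' i - th' j - (th i - th j) by ring.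
lra.
Qed.

(** The tangent gaps [E i j] are nonnegative with nonpositive sum, hence all zero. Strict convexity
    then makes [u] constant along each edge, so its energy vanishes and the Poincaré inequality
    gives [u = 0]. *)
Lemma stationary_MLE_unique w th th' (lam : R) : 0 < lam ->
  (forall x : 'I_n -> R, \sum_i x i = 0 -> lam * nrm2 x <= dirichlet (adj w) x) ->
  \sum_i th i = 0 ->
  (forall i, \sum_j adj w i j * (psi (th i - th j) - ybar R w i j) = 0) ->
  is_MLE w th' -> forall i, th' i = th i.
Proof.
move=> lam0 hP th0 st [th'0 /(_ _ th0) hle].
pose u i := th' i - th i.
have u0 : \sum_i u i = 0 by rewrite sumrB th0 th'0 subrr.
pose E i j := adj w i j * (pair_loss (ybar R w i j) (th' i - th' j) -
  pair_loss (ybar R w i j) (th i - th j) -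
  (psi (th i - th j) - ybar R w i j) * (u i - u j)).
have E0 i j : 0 <= E i j.
  rewrite mulr_ge0 ?adj_ge0 //.
  have := pair_loss_tangent (ybar R w i j) (th i - th j) (th' i - th' j).
  have -> : u i - u j = th' i - th' j - (th i - th j) by rewrite /u; ring.
  lra.
have Esum : \sum_(i < n) \sum_(j < n | (i < j)%N) E i j <= 0.
  rewrite -subr_le0 !loglikE in hle.
  apply: le_trans hle; rewrite -[leRHS]subr0.
  rewrite -[X in _ <= _ - X](stationary_linear u st) -!sumrB.
  apply: ler_sum => i _; rewrite -!sumrB; apply: ler_sum => j _.
  by rewrite /E !mulrBr.
have edge (i j : 'I_n) : (i < j)%N -> adj w i j * (u i - u j) ^+ 2 = 0.
  move=> ij; have Eij : E i j = 0.
    apply/eqP; rewrite eq_le E0 andbT; apply: le_trans Esum.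
    rewrite (bigD1 i) //= (bigD1 j) //= -addrA lerDl addr_ge0 //.
      exact: sumr_ge0.
    by do 2!apply: sumr_ge0 => ? _.
  move/eqP: Eij; rewrite /E mulf_eq0 => /orP[/eqP ->|/eqP h]; first by rewrite mul0r.
  have [tt|tt] := eqVneq (th i - th j) (th' i - th' j).
    have -> : u i - u j = 0.
      by move: tt; rewrite /u; lra.
    by rewrite expr0n mulr0.
  have := pair_loss_tangent_lt (ybar R w i j) tt; move: h.
  have -> : u i - u j = th' i - th' j - (th i - th j) by rewrite /u; ring.
  lra.
have : dirichlet (adj w) u = 0.
  rewrite /dirichlet -sum_lt_sym.
  - by rewrite big1 ?mulr0 // => i _; rewrite big1 // => j; exact: edge.
  - by move=> i j; rewrite adj_sym -(opprB (u i)) sqrrN.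
  - by move=> i; rewrite subrr expr0n mulr0.
move=> d0; have := hP u u0; rewrite d0 pmulr_rle0 // => hu i.
apply/eqP; rewrite -subr_eq0 -sqrf_eq0 eq_le sqr_ge0 andbT.
exact: le_trans (nrm2_coord u i) hu.
Qed.

End Likelihood.

(** * Tail bounds *)

Section Tails.
Variables (R : realType) (n L : nat) (p : R) (theta : 'I_n -> R).
Hypothesis hp : 0 <= p <= 1.
Hypothesis L0 : (0 < L)%N.
Implicit Types w : Omega n L.

Definition noise w (i j : 'I_n) : R := ybar R w i j - psi (theta i - theta j).

Lemma noise_antisym w i j : i != j -> noise w j i = - noise w i j.
Proof. by move=> ij; rewrite /noise ybarC // -(opprB (theta i)) psiN; ring. Qed.

Lemma centered_le1 (q y1 y0 B : R) :
  q * expR y1 + (1 - q) * expR y0 <= expR B ->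
  q * expR (y1 - B) + (1 - q) * expR (y0 - B) <= 1.
Proof.
move=> h; rewrite !expRB !mulrA -mulrDl ler_pdivrMr ?expR_gt0 //.
by rewrite mul1r.
Qed.

Lemma sum_Pair (F : 'I_n -> 'I_n -> R) :
  \sum_(e : Pair n) F (val e).1 (val e).2 =
  \sum_(i < n) \sum_(j < n | (i < j)%N) F i j.
Proof.
rewrite pair_big_dep /=.
rewrite (reindex_omap (val : Pair n -> _) insub) /=; last first.
  by move=> [i j] /= ij; rewrite insubT /=.
by apply: eq_bigl => e; rewrite valK eqxx andbT (valP e).
Qed.

(** One outcome contributes [x (y - q) - 2 x^2] with [x = A z / L], whose exponential moment is at
    most 1 by the sub-Gaussian bound. Only outcomes are redrawn, so [z] may depend on the graph. *)
Lemma noise_tail (z : Omega n L -> 'I_n -> 'I_n -> R) (t : R) :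
  (forall el b w, z (set_outcome el b w) = z w) ->
  Prob p theta (fun w => t <
    \sum_(i < n) \sum_(j < n | (i < j)%N)
       (adj R w i j * (z w i j * noise w i j - 2 / L%:R * z w i j ^+ 2))) <= expR (- t).
Proof.
move=> hz.
have LR : L%:R != 0 :> R by rewrite pnatr_eq0 -lt0n.
pose x (e : Pair n) w := (w.1 e)%:R * z w (val e).1 (val e).2 / L%:R.
pose X el w := x el.1 w * ((w.2 el : nat)%:R - win_prob theta el) - 2 * x el.1 w ^+ 2.
have xi el b w e : x e (set_outcome el b w) = x e w by rewrite /x hz.
have sumE w : \sum_(el <- index_enum (Pair n * 'I_L)%type) X el w =
    \sum_(i < n) \sum_(j < n | (i < j)%N)
       (adj R w i j * (z w i j * noise w i j - 2 / L%:R * z w i j ^+ 2)).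
  transitivity (\sum_(e : Pair n) \sum_(l < L) X (e, l) w).
    by rewrite pair_bigA; apply: eq_bigr => -[].
  rewrite -sum_Pair; apply: eq_bigr => e _.
  have ij := valP e; set i := (val e).1 in ij *; set j := (val e).2 in ij *.
  have eE : Sub (i, j) ij = e by apply: val_inj; rewrite SubK /i /j; case: (val e).
  have -> : adj R w i j = (w.1 e)%:R by rewrite /adj (Aij_lt w ij) eE.
  have yE : ybar R w i j = (\sum_(l < L) (w.2 (e, l) : nat)%:R) / L%:R.
    rewrite /ybar ij /ybar_lt (_ : (i, j) = val e) ?valK //.
    by rewrite /i /j; case: (val e).
  rewrite /X /= sumrB -mulr_sumr sumrB /noise yE /win_prob /= -/i -/j.
  rewrite !sumr_const card_ord -(mulr_natr (psi _)) -(mulr_natr (2 * _)) /x -/i -/j.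
  set q := psi _; set S := \sum_(l < L) _; set a := (w.1 e)%:R.
  (* The compensator is quadratic in the edge indicator; idempotence lets it be charged to present
     edges with weight [A]. *)
  have aa : a ^+ 2 = a by rewrite /a; case: (w.1 e); rewrite ?expr1n ?expr0n.
  have -> : 2 * (a * z w i j / L%:R) ^+ 2 * L%:R = 2 * a ^+ 2 * z w i j ^+ 2 / L%:R.
    by field.
  by rewrite aa; field.
apply: le_trans (_ : Prob p theta (fun w => t <
    \sum_(el <- index_enum (Pair n * 'I_L)%type) X el w) <= _).
  by apply: Prob_le => // w; rewrite sumE.
apply: markov_expR => //.
apply: (@Ex_expR_sum_le1 _ _ _ _ _ hp _ _ (@set_outcome n L) (win_prob theta)) => //.
- exact: index_enum_uniq.
- by move=> el F _; exact: Ex_outcome.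
- move=> el w x1 x0 _.
  have Xb b : X el (set_outcome el b w) =
      x el.1 w * (b%:R - win_prob theta el) - 2 * x el.1 w ^+ 2.
    by rewrite /X xi ffunE eqxx.
  move=> e1 e0; rewrite -(etrans (esym (Xb true)) e1) -(etrans (esym (Xb false)) e0).
  rewrite mulr1n mulr0n.
  have := bernoulli_subgaussian (x el.1 w) (win_prob01 theta el).
  by rewrite sub0r mulrN; exact: centered_le1.
- move=> el el' b w _ _ ne; rewrite /X xi ffunE.
  by rewrite (negbTE ne).
Qed.

(** Acts on the unordered pair, whichever order indexes it, and does nothing on the diagonal. *)
Definition set_adj (i j : 'I_n) b w : Omega n L :=
  match insub (i, j) : option (Pair n) with
  | Some e => set_edge e b w
  | None => match insub (j, i) : option (Pair n) with
            | Some e => set_edge e b w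
            | None => w
            end
  end.

Lemma set_adj_lt (i j : 'I_n) (h : (i < j)%N) b w :
  set_adj i j b w = set_edge (Sub (i, j) h) b w.
Proof. by rewrite /set_adj insubT. Qed.

Lemma set_adjC i j b w : set_adj i j b w = set_adj j i b w.
Proof.
have [ij|ji|/val_inj ->] := ltngtP i j => //.
  by rewrite /set_adj insubT [in RHS]insubF //= ltnNge ltnW.
by rewrite /set_adj [in LHS]insubF ?insubT //= ltnNge ltnW.
Qed.

Lemma Ex_set_adj i j F : i != j -> Ex p theta F =
  Ex p theta (fun w => p * F (set_adj i j true w) + (1 - p) * F (set_adj i j false w)).
Proof.
wlog ij : i j / (i < j)%N.
  move=> h ne; have [lt|lt|/val_inj e] := ltngtP i j; first exact: h.
    rewrite (h j i) // 1?eq_sym //; congr Ex; apply/funext => w.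
    by rewrite !(set_adjC j i).
  by rewrite e eqxx in ne.
move=> _; rewrite (Ex_edge _ _ (Sub (i, j) ij)); congr Ex.
by apply/funext => w; rewrite !(set_adj_lt ij).
Qed.

Lemma adj_set_adj i j b w : i != j -> adj R (set_adj i j b w) i j = b%:R.
Proof.
wlog ij : i j / (i < j)%N.
  move=> h ne; have [lt|lt|/val_inj e] := ltngtP i j; first exact: h.
    by rewrite set_adjC adj_sym h // eq_sym.
  by rewrite e eqxx in ne.
by move=> _; rewrite set_adj_lt /adj Aij_lt /= ffunE eqxx.
Qed.

Lemma Aij_set_adj i j b w i' j' :
  ~~ ((i' == i) && (j' == j)) -> ~~ ((i' == j) && (j' == i)) ->
  Aij (set_adj i j b w) i' j' = Aij w i' j'.
Proof.
wlog ij : i j / (i < j)%N.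
  move=> h h1 h2; have [lt|lt|/val_inj e] := ltngtP i j; first exact: h.
    by rewrite set_adjC h.
  by rewrite e /set_adj insubF //= ltnn.
wlog ij' : i' j' / (i' < j')%N.
  move=> h h1 h2; have [lt|lt|/val_inj e] := ltngtP i' j'; first exact: h.
    by rewrite AijC [RHS]AijC h // andbC.
  by rewrite e !Aii.
move=> h1 _; rewrite set_adj_lt !(Aij_lt _ ij') /= ffunE.
by rewrite -val_eqE /= xpair_eqE (negbTE h1).
Qed.

Lemma adj_set_adj_neq i j b w i' j' :
  ~~ ((i' == i) && (j' == j)) -> ~~ ((i' == j) && (j' == i)) ->
  adj R (set_adj i j b w) i' j' = adj R w i' j'.
Proof. by move=> h1 h2; rewrite /adj Aij_set_adj. Qed.

(** Outcomes are drawn for all pairs, present or not, so redrawing an edge leaves the noise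
    untouched. *)
Lemma ybar_set_adj i j b w : ybar R (set_adj i j b w) =2 ybar R w.
Proof.
by move=> i' j'; rewrite /set_adj; case: insub => //; case: insub.
Qed.

(** Tilt -1: the sum of [p / 2 - A] over the cut exceeds a quarter of the mean cut exactly when the
    cut falls below that quarter. *)
Lemma cut_tail (S : {set 'I_n}) :
  Prob p theta (fun w => \sum_(i in S) \sum_(j in ~: S) adj R w i j <
      p * #|S|%:R * #|~: S|%:R / 4) <= expR (- (p * #|S|%:R * #|~: S|%:R / 4)).
Proof.
pose s := [seq x <- index_enum ('I_n * 'I_n)%type | (x.1 \in S) && (x.2 \in ~: S)].
have ms x : x \in s -> (x.1 \in S) /\ (x.2 \notin S).
  by rewrite mem_filter finset.in_setC => /andP[/andP[-> ->]].
pose X (x : 'I_n * 'I_n) w := p / 2 - adj R w x.1 x.2.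
have sumE w : \sum_(x <- s) X x w =
    p * #|S|%:R * #|~: S|%:R / 2 - \sum_(i in S) \sum_(j in ~: S) adj R w i j.
  rewrite big_filter -(pair_big (fun i => i \in S) (fun j => j \in ~: S)
     (fun i j => X (i, j) w)) /= /X /=.
  under eq_bigr do rewrite sumrB sumr_const.
  rewrite sumrB sumr_const; congr (_ - _).
  by rewrite -[LHS]mulr_natr -[X in X * _]mulr_natr; field.
apply: le_trans (_ : Prob p theta (fun w =>
   p * #|S|%:R * #|~: S|%:R / 4 < \sum_(x <- s) X x w) <= _).
  by apply: Prob_le => // w; rewrite sumE; lra.
apply: markov_expR => //.
apply: (@Ex_expR_sum_le1 _ _ _ _ _ hp _ _ (fun x => set_adj x.1 x.2) (fun=> p)) => //.
- exact/filter_uniq/index_enum_uniq.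
- move=> x F /ms[x1 x2]; apply: Ex_set_adj.
  by apply: contraNneq x2 => <-.
- move=> x w y1 y0 /ms[x1 x2].
  have ne : x.1 != x.2 by apply: contraNneq x2 => <-.
  have Xb b : X x (set_adj x.1 x.2 b w) = p / 2 - b%:R by rewrite /X adj_set_adj.
  move=> e1 e0; rewrite -(etrans (esym (Xb true)) e1) -(etrans (esym (Xb false)) e0).
  rewrite mulr1n mulr0n subr0.
  have h : p * expR (-1) + (1 - p) * expR 0 <= expR (- (p / 2)).
    by rewrite expR0 mulr1; exact: bernoulli_lower.
  by have := centered_le1 h; rewrite !opprK add0r (addrC (-1)).
(* No pair of the cut is the reverse of another, since the first entry is in [S] and the second is
   not; distinct pairs are therefore distinct edges. *)
- move=> x y b w /ms[x1 x2] /ms[y1 y2] xy; rewrite /X adj_set_adj_neq //.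
  by apply/negP => /andP[/eqP e _]; rewrite -e x1 in y2.
Qed.

(** Here leave-one-out independence is consumed: [g] may be random, provided that redrawing an edge
    at [m] leaves it unchanged. The diagonal term only helps, because [A m m = 0] and [g >= 0]. *)
Lemma row_tail (m : 'I_n) (g : Omega n L -> 'I_n -> R) (t : R) :
  (forall w j, 0 <= g w j <= 1) ->
  (forall j b w, g (set_adj m j b w) = g w) ->
  Prob p theta (fun w => 2 * p * (\sum_j g w j) + 2 * t <
    \sum_j adj R w m j * g w j) <= expR (- t).
Proof.
move=> g01 gi; have /andP[p0 p1] := hp.
pose s := [seq j <- index_enum 'I_n | j != m].
have ms j : j \in s -> m != j by rewrite mem_filter eq_sym => /andP[].
pose X j w := adj R w m j * g w j / 2 - p * g w j.
have sumE w : (\sum_j adj R w m j * g w j) / 2 - p * (\sum_j g w j) <=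
    \sum_(j <- s) X j w.
  rewrite big_filter mulr_suml mulr_sumr -sumrB (bigD1 m) //= adj_diag.
  rewrite gerDr !mul0r sub0r oppr_le0 mulr_ge0 //.
  by case/andP: (g01 w m).
apply: le_trans (_ : Prob p theta (fun w => t < \sum_(j <- s) X j w) <= _).
  apply: Prob_le => // w h; apply: lt_le_trans (sumE w); lra.
apply: markov_expR => //.
apply: (@Ex_expR_sum_le1 _ _ _ _ _ hp _ _ (fun j => set_adj m j) (fun=> p)) => //.
- exact/filter_uniq/index_enum_uniq.
- by move=> j F /ms; exact: Ex_set_adj.
- move=> j w x1 x0 /ms mj.
  have Xb b : X j (set_adj m j b w) = b%:R * g w j / 2 - p * g w j.
    by rewrite /X adj_set_adj // gi.
  move=> e1 e0; rewrite -(etrans (esym (Xb true)) e1) -(etrans (esym (Xb false)) e0).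
  rewrite mulr1n mulr0n mul1r !mul0r.
  by apply: centered_le1; rewrite expR0 mulr1; exact: bernoulli_upper.
- move=> i j b w /ms mi /ms mj ij; rewrite /X gi adj_set_adj_neq //.
    by rewrite eqxx.
  by rewrite (negbTE mj).
Qed.

Lemma row_bernstein (m : 'I_n) (g : Omega n L -> 'I_n -> R) (t : R) :
  (forall w j, `|g w j| <= 1 / 2) ->
  (forall j b w, g (set_adj m j b w) = g w) ->
  Prob p theta (fun w => t < \sum_(j | j != m)
    ((adj R w m j - p) * g w j - 2 * p * g w j ^+ 2)) <= expR (- t).
Proof.
move=> g01 gi.
pose s := [seq j <- index_enum 'I_n | j != m].
have ms j : j \in s -> m != j by rewrite mem_filter eq_sym => /andP[].
pose X j w := (adj R w m j - p) * g w j - 2 * p * g w j ^+ 2.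
apply: le_trans (_ : Prob p theta (fun w => t < \sum_(j <- s) X j w) <= _).
  by apply: Prob_le => // w; rewrite big_filter.
apply: markov_expR => //.
apply: (@Ex_expR_sum_le1 _ _ _ _ _ hp _ _ (fun j => set_adj m j) (fun=> p)) => //.
- exact/filter_uniq/index_enum_uniq.
- by move=> j F /ms; exact: Ex_set_adj.
- move=> j w x1 x0 /ms mj.
  have Xb b : X j (set_adj m j b w) = (b%:R - p) * g w j - 2 * p * g w j ^+ 2.
    by rewrite /X adj_set_adj // gi.
  move=> e1 e0; rewrite -(etrans (esym (Xb true)) e1) -(etrans (esym (Xb false)) e0).
  rewrite mulr1n mulr0n.
  apply: centered_le1.
  have -> : (1 - p) * g w j = g w j * (1 - p) by rewrite mulrC.
  have -> : (0 - p) * g w j = - (g w j * p) by ring.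
  exact: bernoulli_bernstein.
- move=> i j b w /ms mi /ms mj ij; rewrite /X gi adj_set_adj_neq //.
    by rewrite eqxx.
  by rewrite (negbTE mj).
Qed.

End Tails.

(** * Deterministic bounds *)

Ltac nneg := repeat first
  [ done | assumption | exact: ler0n | exact: sqr_ge0 | exact: normr_ge0
  | by apply: ltW | apply: exprn_ge0 | apply: mulr_ge0 | apply: addr_ge0
  | rewrite invr_ge0 ].

Section SupNorm.
Variables (R : realType) (n : nat).
Implicit Types v : 'I_n -> R.

Lemma normInf_ge v i : `|v i| <= normInf v.
Proof. by rewrite /normInf (bigD1 i) //= le_max lexx. Qed.

Lemma normInf_ge0 v : 0 <= normInf v.
Proof.
rewrite /normInf; elim/big_rec: _ => // i x _ x0.
by rewrite le_max x0 orbT.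
Qed.

Lemma normInf_le v (b : R) : 0 <= b -> (forall i, `|v i| <= b) -> normInf v <= b.
Proof.
move=> b0 h; rewrite /normInf; elim/big_rec: _ => // i x _ xb.
by rewrite ge_max h xb.
Qed.

Lemma normInf_sqr_le v (b : R) : 0 <= b -> (forall i, v i ^+ 2 <= b) ->
  normInf v ^+ 2 <= b.
Proof.
move=> b0 h; rewrite -(sqr_sqrtr b0) ler_pXn2r ?nnegrE ?normInf_ge0 ?sqrtr_ge0 //.
apply: normInf_le; rewrite ?sqrtr_ge0 // => i.
by rewrite -sqrtr_sqr ler_sqrt.
Qed.

Lemma norm_le_sqr (x y : R) : 0 <= y -> x ^+ 2 <= y ^+ 2 -> `|x| <= y.
Proof.
move=> y0; rewrite -[X in X <= _]real_normK ?num_real //.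
by rewrite ler_pXn2r ?nnegrE.
Qed.

End SupNorm.

Section Constants.
Variables (R : realType) (k : R).

(** With Poincaré constant [s^2 / 192] the coercivity constant is [s^2 / (384 k)], and half of it
    for the averaged graph. The factors 30 and 40 are roots of the rounded residual constants: 900
    dominates 450, and 1600 dominates 36 and 1176. *)
Definition delta_cst := 30 * 384 * k.
Definition loo_cst := 40 * 768 * k.
Definition nbr_cst := 8 * delta_cst ^+ 2 + 96 + 106 * loo_cst ^+ 2.
Definition sup_cst := 128 * k ^+ 2 * (648 + 12 * nbr_cst).
Definition loo_sup_cst := loo_cst * (sup_cst + 1).
Definition mean_cst := 768 * k ^+ 2 + 12 + 384 * 24 * k * sup_cst * delta_cst.
Definition lin_cst := 2 * loo_sup_cst + 25 * (sup_cst + 3 * loo_sup_cst + 2 * delta_cst) +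
  (sup_cst + loo_sup_cst) + loo_sup_cst + mean_cst.
Definition err_cst := 8 * k * (lin_cst + 4 * nbr_cst * (sup_cst ^+ 2 + 2)).

Lemma csts_gt0 : 0 < k -> [/\ 0 < nbr_cst, 0 < sup_cst & 0 < err_cst].
Proof.
move=> k0.
have p1 : 0 < delta_cst by rewrite /delta_cst !mulr_gt0.
have p2 : 0 < loo_cst by rewrite /loo_cst !mulr_gt0.
have p4 : 0 < nbr_cst.
  rewrite /nbr_cst; move: p1 p2; move: delta_cst loo_cst => x y x0 y0.
  by nra.
have p5 : 0 < sup_cst.
  rewrite /sup_cst; apply: mulr_gt0; first by rewrite mulr_gt0 // exprn_gt0.
  by apply: addr_gt0 => //; apply: mulr_gt0.
have p6 : 0 < loo_sup_cst.
  by rewrite /loo_sup_cst; move: p2 p5; move: loo_cst sup_cst => x y ? ?; nra.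
have p7 : 0 < mean_cst.
  rewrite /mean_cst; move: p1 p5; move: delta_cst sup_cst => x y x0 y0.
  have : 0 < k * y * x by rewrite !mulr_gt0.
  by have := sqr_ge0 k; nra.
have p8 : 0 < lin_cst.
  rewrite /lin_cst; move: p1 p5 p6 p7.
  move: delta_cst sup_cst loo_sup_cst mean_cst => x y z v; lra.
split=> //; rewrite /err_cst; move: p8 p4; move: lin_cst nbr_cst sup_cst => x y z x0 y0.
by rewrite mulr_gt0 ?mulr_gt0 // addr_gt0 // mulr_gt0 ?mulr_gt0 // ltr_wpDl ?sqr_ge0.
Qed.

End Constants.

(* In the application [s^2 = n p], [a^4 = ln n], [tau = sqrt (ln n / (n p L))],
   [xi i j] is the noise of the comparisons of [i] and [j], and
   [phi i j x = psit (theta i - theta j + x) - psi (theta i - theta j)]. *)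
Section DeterministicBounds.
Variables (R : realType) (n : nat) (c k a s tau p : R).
Variables (edge : 'I_n -> 'I_n -> bool) (phi : 'I_n -> 'I_n -> R -> R).
Variables (xi : 'I_n -> 'I_n -> R).
Let A i j : R := (edge i j)%:R.

Hypothesis n0 : (0 < n)%N.
Hypothesis c01 : 0 < c <= 1.
Hypothesis ck : c * k = 1.
Hypothesis a1 : 1 <= a.
Hypothesis s_large : 28 <= s.
Hypothesis tau0 : 0 < tau.
Hypothesis p01 : 0 <= p <= 1.
Hypothesis nps : n%:R * p = s ^+ 2.

Hypothesis edge_sym : forall i j, edge i j = edge j i.
Hypothesis phi_zero : forall i j, phi i j 0 = 0.
Hypothesis phi_odd : forall i j t, phi j i (- t) = - phi i j t.
Hypothesis phi_mono : forall i j x y,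
  c * (x - y) ^+ 2 <= (phi i j x - phi i j y) * (x - y).
Hypothesis phi_lip : forall i j x y, `|phi i j x - phi i j y| <= `|x - y|.

Hypothesis deg_le : forall i, \sum_j A i j <= 3 * s ^+ 2.
Hypothesis deg_ge : forall i, s ^+ 2 / 8 <= \sum_j A i j.
Hypothesis poincare : forall x : 'I_n -> R, \sum_i x i = 0 ->
  s ^+ 2 / 192 * nrm2 x <= dirichlet A x.

Let b i := \sum_j A i j * xi i j.

Hypothesis xi_le : forall i j, A i j * `|xi i j| <= 14 * s * tau.
Hypothesis b_le : forall i, `|b i| <= 18 * s ^+ 2 * tau.
Hypothesis b_l1 : \sum_i `|b i| <= 25 * n%:R * s ^+ 2 * tau / a ^+ 2.

Variable delta : 'I_n -> R.
Hypothesis delta0 : \sum_i delta i = 0.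
Hypothesis delta_flow : forall i, flow A phi delta i = b i.

Let M := normInf delta.
Let k1 := delta_cst k.
Let k2 := loo_cst k.

Let a0 : 0 < a. Proof. exact: lt_le_trans a1. Qed.
Let s0 : 0 < s. Proof. exact: lt_le_trans s_large. Qed.
Let s1 : 1 <= s. Proof. by apply: le_trans s_large; rewrite ler1n. Qed.
Let c0 : 0 < c. Proof. by case/andP: c01. Qed.
Let k0 : 0 < k. Proof. by rewrite -(pmulr_rgt0 _ c0) ck. Qed.
Let p0 : 0 <= p. Proof. by case/andP: p01. Qed.
Let nR : 0 < n%:R :> R. Proof. by rewrite ltr0n. Qed.
Let A01 i j : 0 <= A i j <= 1.
Proof. by rewrite /A; case: edge; rewrite ?lexx ?ler01. Qed.
Let A_ge0 i j : 0 <= A i j. Proof. exact: ler0n. Qed.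
Let A_sym : symmetric_fun A. Proof. by move=> i j; rewrite /A edge_sym. Qed.
Let A_sqr i j : A i j ^+ 2 = A i j.
Proof. by rewrite /A; case: edge; rewrite ?expr1n ?expr0n. Qed.
Let M0 : 0 <= M. Proof. exact: normInf_ge0. Qed.
Let delta_le i : `|delta i| <= M. Proof. exact: normInf_ge. Qed.
Let cE : c = k^-1. Proof. by rewrite -[LHS](mulfK (lt0r_neq0 k0)) ck mul1r. Qed.

Lemma flow_zero alpha i : flow alpha phi (fun=> 0) i = 0.
Proof. by rewrite /flow big1 // => j _; rewrite subrr phi_zero mulr0. Qed.

(** Sup norm times l1 norm; the factor [1 / a^2] comes from [b_l1]. *)
Lemma noise_nrm2 : nrm2 b <= 450 * n%:R * s ^+ 4 * (tau ^+ 2 / a ^+ 2).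
Proof.
apply: le_trans (_ : 18 * s ^+ 2 * tau * \sum_i `|b i| <= _).
  rewrite mulr_sumr; apply: ler_sum => i _.
  by rewrite -[leLHS]real_normK ?num_real // expr2 ler_wpM2r.
have h0 : 0 <= 18 * s ^+ 2 * tau by rewrite !mulr_ge0 ?exprn_ge0 ?(ltW s0) ?(ltW tau0).
apply: le_trans (ler_wpM2l h0 b_l1) _.
by rewrite le_eqVlt; apply/orP; left; apply/eqP; field; rewrite gt_eqF.
Qed.

Lemma delta_nrm2 : nrm2 delta <= k1 ^+ 2 * (n%:R * (tau ^+ 2 / a ^+ 2)).
Proof.
have lam0 : 0 < s ^+ 2 / 192 by rewrite divr_gt0 ?exprn_gt0.
have z0 : \sum_(i < n) (0 : R) = 0 by rewrite big1.
have := flow_stable A01 A_sym phi_odd c0 phi_mono lam0 poincare delta0 z0.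
have e1 : nrm2 (fun i => delta i - 0) = nrm2 delta.
  by apply: eq_bigr => i _; rewrite subr0.
have e2 : nrm2 (fun i => flow A phi delta i - flow A phi (fun=> 0) i) = nrm2 b.
  by apply: eq_bigr => i _; rewrite flow_zero subr0 delta_flow.
rewrite e1 e2 => /le_trans /(_ noise_nrm2) h.
have mu0 : 0 < (c * (s ^+ 2 / 192) / 2) ^+ 2.
  by rewrite exprn_gt0 // divr_gt0 // mulr_gt0.
rewrite -(ler_pM2l mu0); apply: le_trans h _.
have -> : (c * (s ^+ 2 / 192) / 2) ^+ 2 * (k1 ^+ 2 * (n%:R * (tau ^+ 2 / a ^+ 2))) =
  900 * n%:R * s ^+ 4 * (tau ^+ 2 / a ^+ 2).
  by rewrite cE /k1 /delta_cst; field; rewrite !gt_eqF.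
apply: ler_wpM2r; first by rewrite divr_ge0 ?sqr_ge0.
by rewrite ler_pM2r ?exprn_gt0 // ler_pM2r // ler_nat.
Qed.

(* [f] solves the equations in which row and column [m] of the graph are
   averaged and noiseless; it does not depend on the edges at [m]. *)
Section LeaveOneOut.
Variable m : 'I_n.
Variable f : 'I_n -> R.
Let Am i j : R := if (i == m) || (j == m) then p else A i j.
Hypothesis f0 : \sum_i f i = 0.
Hypothesis f_flow : forall i, flow Am phi f i =
  \sum_j (if (i == m) || (j == m) then 0 else A i j * xi i j).
Let v i := delta i - f i.

Let phi_dist i j : `|phi i j (delta i - delta j)| <= 2 * M.
Proof.
have h := phi_lip i j (delta i - delta j) 0; rewrite phi_zero !subr0 in h.
apply: le_trans h _; apply: le_trans (ler_normB _ _) _.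
by have := delta_le i; have := delta_le j; lra.
Qed.

(** Row [m] now has [n] terms of weight [p], in total at most [2 n p M]. Any other row changes only
    in its entry [m], by [(p - A) phi + A xi]; as [(p - A)^2 <= p + A], summing over the rows costs
    only one degree. *)
Lemma leave_one_out_residual :
  nrm2 (fun i => flow Am phi delta i - flow Am phi f i) <=
  36 * s ^+ 4 * M ^+ 2 + 1176 * s ^+ 4 * tau ^+ 2.
Proof.
rewrite /nrm2 (bigD1 m) //=.
have em : flow Am phi f m = 0.
  by rewrite f_flow big1 // => j _; rewrite eqxx.
have hm : (flow Am phi delta m - flow Am phi f m) ^+ 2 <= 4 * s ^+ 4 * M ^+ 2.
  rewrite em subr0 /flow.
  have -> : \sum_j Am m j * phi m j (delta m - delta j) =
            p * \sum_j phi m j (delta m - delta j).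
    by rewrite mulr_sumr; apply: eq_bigr => j _; rewrite /Am eqxx.
  have h : `|\sum_j phi m j (delta m - delta j)| <= n%:R * (2 * M).
    apply: le_trans (ler_norm_sum _ _ _) _.
    rewrite -[n in n%:R]card_ord mulr_natl -sumr_const.
    by apply: ler_sum => j _; exact: phi_dist.
  have h2 : `|p * \sum_j phi m j (delta m - delta j)| <= s ^+ 2 * (2 * M).
    rewrite normrM (ger0_norm p0) -nps mulrAC mulrC mulrA [X in _ <= X]mulrC.
    by rewrite mulrC -mulrA; apply: ler_wpM2l.
  rewrite -[leLHS]real_normK ?num_real //.
  have -> : 4 * s ^+ 4 * M ^+ 2 = (s ^+ 2 * (2 * M)) ^+ 2 by ring.
  by rewrite ler_pXn2r ?nnegrE // !mulr_ge0 ?exprn_ge0 // ltW.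
have hi i : i != m -> (flow Am phi delta i - flow Am phi f i) ^+ 2 <=
    8 * M ^+ 2 * (p + A m i) + 392 * s ^+ 2 * tau ^+ 2 * A m i.
  move=> im; rewrite f_flow.
  have -> : flow Am phi delta i -
      \sum_j (if (i == m) || (j == m) then 0 else A i j * xi i j) =
      (p - A i m) * phi i m (delta i - delta m) + A i m * xi i m.
    have D (F : 'I_n -> R) : \sum_j F j = F m + \sum_(j | j != m) F j.
      by rewrite (bigD1 m).
    have := delta_flow i; rewrite /flow /b !D eqxx orbT add0r.
    have -> : \sum_(j | j != m) Am i j * phi i j (delta i - delta j) =
              \sum_(j | j != m) A i j * phi i j (delta i - delta j).
      by apply: eq_bigr => j jm; rewrite /Am (negbTE im) (negbTE jm).
    have -> : \sum_(j | j != m) (if (i == m) || (j == m) then 0 else A i j * xi i j) =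
              \sum_(j | j != m) A i j * xi i j.
      by apply: eq_bigr => j jm; rewrite (negbTE im) (negbTE jm).
    have -> : Am i m = p by rewrite /Am eqxx orbT.
    lra.
  set x := (p - _) * _; set y := A i m * xi i m.
  apply: le_trans (_ : 2 * x ^+ 2 + 2 * y ^+ 2 <= _).
    by have := sqr_ge0 (x - y); nra.
  have hx : x ^+ 2 <= (p + A m i) * (4 * M ^+ 2).
    rewrite /x exprMn; apply: ler_pM; rewrite ?sqr_ge0 //.
      have -> : A m i = A i m by [].
      by have /andP[u1 u2] := A01 i m; have /andP[u3 u4] := p01; nra.
    have -> : 4 * M ^+ 2 = (2 * M) ^+ 2 by ring.
    rewrite -[leLHS]real_normK ?num_real // ler_pXn2r ?nnegrE ?mulr_ge0 //.
  have hy : y ^+ 2 <= A m i * (196 * s ^+ 2 * tau ^+ 2).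
    have -> : y ^+ 2 = A m i * (A i m * `|xi i m|) ^+ 2.
      rewrite /y !exprMn real_normK ?num_real // !A_sqr (A_sym m) [RHS]mulrA.
      by rewrite -[A i m * A i m]expr2 A_sqr.
    rewrite ler_wpM2l //.
    have -> : 196 * s ^+ 2 * tau ^+ 2 = (14 * s * tau) ^+ 2 by ring.
    rewrite ler_pXn2r ?nnegrE // ?mulr_ge0 // ?ltW //.
  lra.
have : \sum_(i | i != m) (flow Am phi delta i - flow Am phi f i) ^+ 2 <=
   \sum_i (8 * M ^+ 2 * (p + A m i) + 392 * s ^+ 2 * tau ^+ 2 * A m i).
  rewrite [leRHS](bigD1 m) //=; apply: le_trans (ler_sum _ hi) _.
  by rewrite lerDr; nneg.
rewrite big_split -!mulr_sumr big_split sumr_const card_ord -[p *+ n]mulr_natl nps /=.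
have d := deg_le m.
have t1 : 8 * M ^+ 2 * (s ^+ 2 + \sum_i A m i) <= 8 * M ^+ 2 * (4 * s ^+ 2).
  by rewrite ler_wpM2l; [lra|nneg|lra].
have t2 : 392 * s ^+ 2 * tau ^+ 2 * (\sum_i A m i) <=
          392 * s ^+ 2 * tau ^+ 2 * (3 * s ^+ 2).
  by rewrite ler_wpM2l //; nneg.
have t3 : s ^+ 2 * M ^+ 2 <= s ^+ 4 * M ^+ 2.
  by rewrite ler_wpM2r ?sqr_ge0 // ler_weXn2l.
have -> : 1176 * s ^+ 4 * tau ^+ 2 = 392 * s ^+ 2 * tau ^+ 2 * (3 * s ^+ 2) by ring.
set S1 := \sum_(i | _) _; lra.
Qed.

Lemma leave_one_out_dist : nrm2 v <= k2 ^+ 2 * (M ^+ 2 + tau ^+ 2).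
Proof.
have Am01 i j : 0 <= Am i j <= 1 by rewrite /Am; case: ifP.
have Am_sym : symmetric_fun Am by move=> i j; rewrite /Am orbC A_sym.
(* 784 exceeds [4 * 192], which is the condition [4 <= lam] of [leave_one_out_poincare]. *)
have s28 : 784 <= s ^+ 2.
  have -> : 784 = 28 ^+ 2 :> R by ring.
  by rewrite ler_pXn2r ?nnegrE // ltW.
have lam0 : 0 < s ^+ 2 / 192 / 2 by rewrite !divr_gt0 ?exprn_gt0.
have P x : \sum_i x i = 0 -> s ^+ 2 / 192 / 2 * nrm2 x <= dirichlet Am x.
  apply: leave_one_out_poincare => //.
  - by rewrite ler_pdivlMr //; lra.
  - by rewrite nps ler_pdivrMr // ler_peMr ?sqr_ge0 // ler1n.
  - by case/andP: p01.
have := flow_stable Am01 Am_sym phi_odd c0 phi_mono lam0 P delta0 f0.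
rewrite -/v => /le_trans /(_ leave_one_out_residual) h.
have mu0 : 0 < (c * (s ^+ 2 / 192 / 2) / 2) ^+ 2.
  by rewrite exprn_gt0 // divr_gt0 // mulr_gt0.
rewrite -(ler_pM2l mu0); apply: le_trans h _.
have -> : (c * (s ^+ 2 / 192 / 2) / 2) ^+ 2 * (k2 ^+ 2 * (M ^+ 2 + tau ^+ 2)) =
  1600 * (s ^+ 4 * M ^+ 2) + 1600 * (s ^+ 4 * tau ^+ 2).
  by rewrite cE /k2 /loo_cst; field; rewrite !gt_eqF.
have q1 : 0 <= s ^+ 4 * M ^+ 2 by rewrite mulr_ge0 ?sqr_ge0 // exprn_ge0 // ltW.
have q2 : 0 <= s ^+ 4 * tau ^+ 2 by rewrite mulr_ge0 ?sqr_ge0 // exprn_ge0 // ltW.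
lra.
Qed.

Let K4 := nbr_cst k.
Let Q := \sum_j A m j * delta j ^+ 2.

Hypothesis row_sqr : \sum_j A m j * f j ^+ 2 <=
  2 * p * nrm2 f + 24 * a ^+ 4 * normInf f ^+ 2.

Let fE i : f i = delta i - v i. Proof. by rewrite /v subKr. Qed.

Lemma leave_one_out_sup : normInf f ^+ 2 <= 2 * M ^+ 2 + 2 * nrm2 v.
Proof.
apply: normInf_sqr_le => [|i].
  by have := nrm2_ge0 v; have := sqr_ge0 M; lra.
have h1 : delta i ^+ 2 <= M ^+ 2.
  by rewrite -[leLHS]real_normK ?num_real // ler_pXn2r ?nnegrE.
have h2 := nrm2_coord v i; rewrite fE.
by have := sqr_ge0 (delta i + v i); nra.
Qed.

Lemma leave_one_out_nrm2 : nrm2 f <= 2 * nrm2 delta + 2 * nrm2 v.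
Proof.
have := nrm2D delta (fun i => - v i).
have -> : nrm2 (fun i => - v i) = nrm2 v by apply: eq_bigr => i _; rewrite sqrrN.
apply: le_trans; rewrite le_eqVlt; apply/orP; left; apply/eqP.
by apply: eq_bigr => i _; rewrite fE.
Qed.

Lemma neighbour_v_le : \sum_j A m j * v j ^+ 2 <= nrm2 v.
Proof.
apply: ler_sum => j _; rewrite ler_piMl ?sqr_ge0 //.
by case/andP: (A01 m j).
Qed.

Lemma p_delta_nrm2 : p * nrm2 delta <= k1 ^+ 2 * (s ^+ 2 * (tau ^+ 2 / a ^+ 2)).
Proof.
apply: le_trans (ler_wpM2l p0 delta_nrm2) _; rewrite -nps.
by rewrite le_eqVlt; apply/orP; left; apply/eqP; ring.
Qed.

(** [delta] depends on row [m], so the row estimate is applied to [f]. The difference [v] is summed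
    with the trivial [A <= 1]: its whole [nrm2] is of the order of a single squared coordinate. *)
Lemma neighbour_sum_le :
  Q <= K4 * (s ^+ 2 * (tau ^+ 2 / a ^+ 2) + a ^+ 4 * (M ^+ 2 + tau ^+ 2)).
Proof.
have h1 := leave_one_out_sup; have h2 := leave_one_out_nrm2.
have h3 := neighbour_v_le; have h4 := p_delta_nrm2; have h5 := leave_one_out_dist.
have h6 := row_sqr; have v0 := nrm2_ge0 v; have [_ p1] := andP p01.
have hQ : Q <= 2 * (\sum_j A m j * f j ^+ 2) + 2 * (\sum_j A m j * v j ^+ 2).
  rewrite !mulr_sumr -big_split; apply: ler_sum => j _ /=.
  rewrite ![2 * (A m j * _)]mulrCA -mulrDr ler_wpM2l // fE.
  by have := sqr_ge0 (delta j - 2 * v j); nra.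
have a41 : 1 <= a ^+ 4 by rewrite exprn_ege1.
have t1 : p * nrm2 f <= p * (2 * nrm2 delta + 2 * nrm2 v) by rewrite ler_wpM2l.
have t2 : p * nrm2 v <= nrm2 v by rewrite ler_piMl.
have t3 : a ^+ 4 * normInf f ^+ 2 <= a ^+ 4 * (2 * M ^+ 2 + 2 * nrm2 v).
  by rewrite ler_wpM2l //; nneg.
have t4 : nrm2 v <= a ^+ 4 * nrm2 v by rewrite ler_peMl.
have t5 : a ^+ 4 * nrm2 v <= a ^+ 4 * (k2 ^+ 2 * (M ^+ 2 + tau ^+ 2)).
  by rewrite ler_wpM2l //; nneg.
set X := s ^+ 2 * (tau ^+ 2 / a ^+ 2) in h4 *.
have X0 : 0 <= X by rewrite /X; nneg.
have q1 : 0 <= a ^+ 4 * tau ^+ 2 by nneg.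
have q2 : 0 <= a ^+ 4 * M ^+ 2 by nneg.
have q3 : 0 <= k1 ^+ 2 * (a ^+ 4 * tau ^+ 2) by nneg.
have q4 : 0 <= k1 ^+ 2 * (a ^+ 4 * M ^+ 2) by nneg.
have q5 : 0 <= k2 ^+ 2 * X by nneg.
rewrite /K4 /nbr_cst -/k1 -/k2; lra.
Qed.

(** Moving all neighbours to 0 changes row [m] by at most the sum of [A m j * |delta j|], after
    which monotonicity bounds [c * deg * |delta m|]. The constants are [64 k^2 = (c / 8)^-2],
    [648 = 2 * 18^2] and [6 = 2 * 3]. *)
Lemma coordinate_le : delta m ^+ 2 <= 64 * k ^+ 2 * (648 * tau ^+ 2 + 6 * (Q / s ^+ 2)).
Proof.
pose X := \sum_j A m j * `|delta j|.
have Q0 : 0 <= Q by apply: sumr_ge0 => j _; nneg.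
have X0 : 0 <= X by apply: sumr_ge0 => j _; nneg.
have hX : X ^+ 2 <= 3 * s ^+ 2 * Q.
  have := cauchy_schwarz (fun=> 1) (fun j => `|delta j|) (A_ge0 m).
  under eq_bigr do rewrite mul1r; rewrite -/X => /le_trans; apply.
  have -> : \sum_j A m j * 1 ^+ 2 = \sum_j A m j.
    by apply: eq_bigr => j _; rewrite expr1n mulr1.
  have -> : \sum_j A m j * `|delta j| ^+ 2 = Q.
    by apply: eq_bigr => j _; rewrite real_normK ?num_real.
  by rewrite ler_wpM2r.
have h1 : c * (\sum_j A m j) * delta m ^+ 2 - X * `|delta m| <= b m * delta m.
  rewrite -delta_flow /flow mulr_suml mulr_sumr !mulr_suml -sumrB.
  apply: ler_sum => j _; rewrite -!mulrA !(mulrCA c) -mulrBr ler_wpM2l //.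
  have h2 := phi_mono m j (delta m) 0.
  have h3 := phi_lip m j (delta m - delta j) (delta m).
  rewrite phi_zero !subr0 in h2; rewrite addrAC subrr sub0r normrN in h3.
  set z := phi m j (delta m) in h2 h3 *.
  set y := phi m j (delta m - delta j) in h3 *.
  have h4 : `|(y - z) * delta m| <= `|delta j| * `|delta m|.
    by rewrite normrM ler_wpM2r.
  move: h4; rewrite ler_norml => /andP[h4 _]; lra.
have h2 : c * (s ^+ 2 / 8) * `|delta m| <= `|b m| + X.
  have [e|e] := eqVneq (delta m) 0; first by rewrite e normr0 mulr0 addr_ge0.
  have e0 : 0 < `|delta m| by rewrite normr_gt0.
  rewrite -(ler_pM2r e0).
  have h3 : b m * delta m <= `|b m| * `|delta m| by rewrite -normrM ler_norm.
  have h4 : c * (s ^+ 2 / 8) * `|delta m| ^+ 2 <= c * (\sum_j A m j) * delta m ^+ 2.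
    rewrite real_normK ?num_real // ler_wpM2r ?sqr_ge0 // ler_wpM2l // ltW //.
  lra.
have h3 : (c * (s ^+ 2 / 8) * `|delta m|) ^+ 2 <= 2 * b m ^+ 2 + 2 * X ^+ 2.
  apply: le_trans (_ : (`|b m| + X) ^+ 2 <= _).
    by rewrite ler_pXn2r ?nnegrE //; nneg.
  rewrite -[in leRHS](real_normK (num_real (b m))).
  by have := sqr_ge0 (`|b m| - X); nra.
have h4 : b m ^+ 2 <= (18 * s ^+ 2 * tau) ^+ 2.
  by rewrite -[leLHS]real_normK ?num_real // ler_pXn2r ?nnegrE //; nneg.
have h5 : (c * (s ^+ 2 / 8) * `|delta m|) ^+ 2 <=
     2 * (18 * s ^+ 2 * tau) ^+ 2 + 2 * (3 * s ^+ 2 * Q).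
  lra.
have e0 : 0 < (c * (s ^+ 2 / 8)) ^+ 2 by rewrite exprn_gt0 // mulr_gt0 // divr_gt0 ?exprn_gt0.
rewrite -(ler_pM2l e0) -[X in _ * X <= _]real_normK ?num_real // -exprMn.
apply: le_trans h5 _; rewrite le_eqVlt; apply/orP; left; apply/eqP.
by rewrite cE; field; rewrite !gt_eqF.
Qed.

End LeaveOneOut.

Let K4 := nbr_cst k.
Let k5 := sup_cst k.
Let k6 := loo_sup_cst k.

Variable fs : 'I_n -> 'I_n -> R.
Hypothesis fs0 : forall m, \sum_i fs m i = 0.
Hypothesis fs_flow : forall m i,
  flow (fun i j => if (i == m) || (j == m) then p else A i j) phi (fs m) i =
  \sum_j (if (i == m) || (j == m) then 0 else A i j * xi i j).
Hypothesis row_sqr : forall m, \sum_j A m j * fs m j ^+ 2 <=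
  2 * p * nrm2 (fs m) + 24 * a ^+ 4 * normInf (fs m) ^+ 2.
Hypothesis a_small : 768 * k ^+ 2 * K4 * a ^+ 4 <= s ^+ 2.
Hypothesis as_small : a ^+ 3 <= s.
Hypothesis tau_le : s * tau <= a ^+ 2.

Let ge1k : 1 <= k.
Proof. by have /andP[h1 h2] := c01; have h3 := k0; have h4 := ck; nra. Qed.
Let K4_ge1 : 1 <= K4.
Proof.
by have := sqr_ge0 k1; have := sqr_ge0 k2; rewrite /K4 /nbr_cst -/k1 -/k2; lra.
Qed.
Let k5_ge1 : 1 <= k5.
Proof.
have h : 1 <= k ^+ 2 by rewrite exprn_ege1.
have := K4_ge1; rewrite /k5 /sup_cst -/K4; nra.
Qed.

(** A self-bounding inequality: [coordinate_le] and [neighbour_sum_le] bound [M^2] by a multiple of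
    [tau^2] plus a multiple of [M^2], and [a_small] makes the latter coefficient at most 1/2. Since
    [k5 >= 1], a bound of [M^2] by [k5 tau^2] also yields [M <= k5 tau]. *)
Lemma delta_sup : M <= k5 * tau.
Proof.
have k5p : 0 <= k5 by apply: le_trans k5_ge1.
have e4 : 768 * k ^+ 2 * K4 * (a ^+ 4 / s ^+ 2) <= 1.
  by rewrite mulrA ler_pdivrMr ?exprn_gt0 // mul1r.
have g1 := ge1k; have g2 := K4_ge1.
have kk : 1 <= k ^+ 2 by rewrite exprn_ege1.
set e := a ^+ 4 / s ^+ 2 in e4.
have e0 : 0 <= e by rewrite /e; nneg.
have K0 : 0 <= K4 by lra.
have kk0 : 0 <= k ^+ 2 by nneg.
have e1 : K4 * e <= 1.
  have : K4 * e <= k ^+ 2 * (K4 * e) by rewrite ler_peMl //; nneg.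
  have : 0 <= k ^+ 2 * (K4 * e) by nneg.
  lra.
have aa : 1 <= a ^+ 2 by rewrite exprn_ege1.
pose U := 64 * k ^+ 2 * (648 * tau ^+ 2 + 6 * (K4 * (tau ^+ 2 + e * (M ^+ 2 + tau ^+ 2)))).
have M2 : M ^+ 2 <= U.
  apply: normInf_sqr_le => [|i]; first by rewrite /U; nneg.
  apply: le_trans (coordinate_le i) _.
  rewrite /U ler_wpM2l //; first by nneg.
  rewrite lerD2l ler_wpM2l // ler_pdivrMr ?exprn_gt0 //.
  apply: le_trans (neighbour_sum_le (fs0 i) (fs_flow i) (row_sqr i)) _.
  rewrite -[leRHS]mulrA ler_wpM2l // mulrDl lerD //.
    rewrite mulrC ler_wpM2r ?sqr_ge0 //.
    by rewrite ler_pdivrMr ?exprn_gt0 // ler_peMr ?sqr_ge0.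
  rewrite (_ : e * _ * _ = a ^+ 4 * (M ^+ 2 + tau ^+ 2)) // /e.
  by field; rewrite gt_eqF.
have M1 : M ^+ 2 <= k5 * tau ^+ 2.
  have u1 : 384 * k ^+ 2 * K4 * e * M ^+ 2 <= 1 / 2 * M ^+ 2.
    by rewrite ler_wpM2r ?sqr_ge0 //; lra.
  have u2 : k ^+ 2 * (K4 * e) * tau ^+ 2 <= k ^+ 2 * K4 * tau ^+ 2.
    rewrite ler_wpM2r ?sqr_ge0 // ler_wpM2l //.
    by apply: le_trans e1 _.
  move: M2; rewrite /U /k5 /sup_cst -/K4; lra.
apply: le_trans (ler_norm _) _; apply: norm_le_sqr.
  by apply: mulr_ge0 => //; exact: ltW.
apply: le_trans M1 _; rewrite exprMn ler_wpM2r ?sqr_ge0 //.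
by rewrite expr2 ler_peMr.
Qed.

(** * First-order expansion of a single coordinate *)

Section Expansion.
Variable m : 'I_n.
Let f := fs m.
Let v i := delta i - f i.

Lemma v_le : nrm2 v <= (k6 * tau) ^+ 2.
Proof.
apply: le_trans (leave_one_out_dist (fs0 m) (fs_flow m)) _.
have h := delta_sup; have k5p := le_trans ler01 k5_ge1.
have h2 : M ^+ 2 <= (k5 * tau) ^+ 2.
  by rewrite ler_pXn2r ?nnegrE // mulr_ge0 // ltW.
have -> : (k6 * tau) ^+ 2 = k2 ^+ 2 * ((k5 + 1) ^+ 2 * tau ^+ 2).
  by rewrite /k6 /loo_sup_cst -/k2 -/k5 -exprMn -exprMn; congr (_ ^+ 2); rewrite mulrA.
apply: ler_wpM2l; first exact: sqr_ge0.
apply: le_trans (_ : (k5 * tau) ^+ 2 + tau ^+ 2 <= _); first by rewrite lerD2r.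
have -> : (k5 + 1) ^+ 2 * tau ^+ 2 =
   (k5 * tau) ^+ 2 + tau ^+ 2 + 2 * (k5 * tau ^+ 2) by ring.
by rewrite lerDl; nneg.
Qed.

Variable W : 'I_n -> 'I_n -> R.
Hypothesis edge_irr : forall i, edge i i = false.
Hypothesis W_sym : symmetric_fun W.
Hypothesis W_bounds : forall i j, c <= W i j <= 1.
Hypothesis phi_taylor : forall i j x, `|x| <= 1 / 2 ->
  `|phi i j x - W i j * x| <= 2 * x ^+ 2.
Hypothesis k5_small : 8 * k * k5 * a ^+ 3 <= s.

Let phiW i j x := W i j * x.
Let wbar := (\sum_j W m j / n%:R) / n%:R.

(* By self-adjointness of the linear flow, [z] turns the weighted mean
   [\sum_j W m j delta j / n] into [\sum_i z i b i] plus a quadratic error. *)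
Variable z : 'I_n -> R.
Hypothesis z0 : \sum_i z i = 0.
Hypothesis z_flow : forall i, flow A phiW z i = W m i / n%:R - wbar.
Hypothesis z_noise : `|\sum_i z i * b i| <=
  tau / Num.sqrt n%:R * (s ^+ 2 * n%:R * dirichlet A z + 12).
Hypothesis row_bern :
  `|\sum_(j | j != m) (A m j - p) * (W m j * f j)| <=
  25 * (a ^+ 4 * normInf f + a ^+ 2 * Num.sqrt (p * nrm2 f)).

(** The unit of error: in the application it equals [(a^3 / s) / sqrt (n p L)], the size aimed at
    for the additive term. *)
Let eta := a * tau / s.
Let eta0 : 0 < eta. Proof. by rewrite divr_gt0 // mulr_gt0. Qed.
Let s_eta : s * eta = a * tau. Proof. by rewrite /eta; field; rewrite gt_eqF. Qed.
Let W0 i j : 0 <= W i j.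
Proof. by have /andP[h _] := W_bounds i j; apply: le_trans h; exact: ltW. Qed.
Let W1 i j : W i j <= 1. Proof. by case/andP: (W_bounds i j). Qed.
Let W_sqr i j : W i j ^+ 2 <= 1. Proof. by rewrite expr_le1. Qed.
Let k1p : 0 < k1. Proof. by rewrite /k1 /delta_cst !mulr_gt0. Qed.
Let k2p : 0 < k2. Proof. by rewrite /k2 /loo_cst !mulr_gt0. Qed.
Let k5p : 0 < k5. Proof. exact: lt_le_trans k5_ge1. Qed.
Let k6p : 0 < k6. Proof. by rewrite /k6 /loo_sup_cst -/k2 -/k5 mulr_gt0 // addr_gt0. Qed.

Let tau_s : tau <= s * eta.
Proof. by rewrite s_eta ler_peMl // ltW. Qed.

Let scale1 : a ^+ 4 * tau <= s ^+ 2 * eta.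
Proof.
have -> : s ^+ 2 * eta = s * (a * tau) by rewrite -s_eta; ring.
have -> : a ^+ 4 * tau = a ^+ 3 * (a * tau) by ring.
by rewrite ler_wpM2r //; nneg.
Qed.

Let a_le_s : a <= s.
Proof.
by apply: le_trans as_small; rewrite -[X in X <= _]expr1 ler_weXn2l.
Qed.

Let a2_le_s : a ^+ 2 <= s.
Proof. by apply: le_trans as_small; rewrite ler_weXn2l. Qed.

Let stau_le x : 0 <= x -> x * (s * tau) <= x * a ^+ 2.
Proof. by move=> x0; rewrite ler_wpM2l. Qed.

Let scale2 : tau ^+ 2 / a ^+ 2 <= eta.
Proof.
rewrite ler_pdivrMr ?exprn_gt0 // -(ler_pM2l s0).
have -> : s * (eta * a ^+ 2) = a ^+ 2 * (a * tau) by rewrite -s_eta; ring.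
have -> : s * tau ^+ 2 = tau * (s * tau) by ring.
apply: le_trans (stau_le _) _; first exact: ltW.
by rewrite mulrC; apply: ler_wpM2l; [nneg|rewrite ler_peMl // ltW].
Qed.

Let scale3 : a ^+ 4 / s ^+ 2 * tau ^+ 2 <= eta.
Proof.
rewrite mulrAC ler_pdivrMr ?exprn_gt0 // -(ler_pM2l s0).
have -> : s * (eta * s ^+ 2) = s ^+ 2 * (a * tau) by rewrite -s_eta; ring.
have -> : s * (a ^+ 4 * tau ^+ 2) = a ^+ 4 * tau * (s * tau) by ring.
apply: le_trans (stau_le _) _; first by nneg.
have -> : a ^+ 4 * tau * a ^+ 2 = (a ^+ 3) ^+ 2 * tau by ring.
apply: ler_pM => //; try by nneg.
  by rewrite ler_pXn2r ?nnegrE //; nneg.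
by rewrite ler_peMl // ltW.
Qed.

Let scale4 : tau ^+ 2 / a <= eta.
Proof.
rewrite ler_pdivrMr // -(ler_pM2l s0).
have -> : s * (eta * a) = a ^+ 2 * tau by rewrite mulrA s_eta; ring.
have -> : s * tau ^+ 2 = tau * (s * tau) by ring.
by rewrite [leRHS]mulrC stau_le // ltW.
Qed.

Lemma loo_sup_le : normInf f <= (k5 + k6) * tau.
Proof.
apply: normInf_le => [|i]; first by nneg.
have -> : f i = delta i - v i by rewrite /v subKr.
apply: le_trans (ler_normB _ _) _; rewrite mulrDl; apply: lerD.
  exact: le_trans (delta_le i) delta_sup.
apply: norm_le_sqr; first by nneg.
exact: le_trans (nrm2_coord v i) v_le.
Qed.

Lemma delta_sqr_le i : delta i ^+ 2 <= (k5 * tau) ^+ 2.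
Proof.
rewrite -[leLHS]real_normK ?num_real // ler_pXn2r ?nnegrE //; last by nneg.
exact: le_trans (delta_le i) delta_sup.
Qed.

Let Q := \sum_j A m j * delta j ^+ 2.

Lemma neighbour_sum_eta : Q <= K4 * (k5 ^+ 2 + 2) * (s ^+ 2 * eta).
Proof.
have K40 : 0 <= K4 by apply: le_trans K4_ge1.
apply: le_trans (neighbour_sum_le (fs0 m) (fs_flow m) (row_sqr m)) _.
rewrite -/K4 -[leRHS]mulrA ler_wpM2l //.
have M2 : M ^+ 2 <= (k5 * tau) ^+ 2.
  by rewrite ler_pXn2r ?nnegrE // ?delta_sup //; nneg.
have t1 : s ^+ 2 * (tau ^+ 2 / a ^+ 2) <= s ^+ 2 * eta.
  by rewrite ler_wpM2l ?scale2 //; nneg.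
have t2 : a ^+ 4 * tau ^+ 2 <= s ^+ 2 * eta.
  have -> : a ^+ 4 * tau ^+ 2 = s ^+ 2 * (a ^+ 4 / s ^+ 2 * tau ^+ 2).
    by field; rewrite gt_eqF.
  by rewrite ler_wpM2l ?scale3 //; nneg.
have t3 : a ^+ 4 * (M ^+ 2 + tau ^+ 2) <= (k5 ^+ 2 + 1) * (a ^+ 4 * tau ^+ 2).
  have -> : (k5 ^+ 2 + 1) * (a ^+ 4 * tau ^+ 2) = a ^+ 4 * ((k5 * tau) ^+ 2 + tau ^+ 2).
    by ring.
  by rewrite ler_wpM2l ?lerD2r //; nneg.
have t4 : (k5 ^+ 2 + 1) * (a ^+ 4 * tau ^+ 2) <= (k5 ^+ 2 + 1) * (s ^+ 2 * eta).
  by rewrite ler_wpM2l //; nneg.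
lra.
Qed.

(** The leading term keeps the gain [1 / a] of [delta_nrm2]; times the [a^2] of [row_bern] it is a
    multiple of exactly [s^2 * eta]. *)
Lemma sqrt_p_nrm2 : Num.sqrt (p * nrm2 f) <= 2 * k1 * (s * tau / a) + 2 * k6 * tau.
Proof.
have R0 : 0 <= 2 * k1 * (s * tau / a) + 2 * k6 * tau by nneg.
rewrite -(ger0_norm R0) -sqrtr_sqr ler_sqrt ?sqr_ge0 //.
have h1 := ler_wpM2l p0 (leave_one_out_nrm2 f).
have h2 := p_delta_nrm2; have h3 := v_le.
have [_ p1] := andP p01.
have h4 : p * nrm2 v <= (k6 * tau) ^+ 2.
  by apply: le_trans h3; rewrite ler_piMl ?nrm2_ge0.
have -> : (2 * k1 * (s * tau / a) + 2 * k6 * tau) ^+ 2 =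
  4 * (k1 ^+ 2 * (s ^+ 2 * (tau ^+ 2 / a ^+ 2))) + 4 * (k6 * tau) ^+ 2 +
  8 * (k1 * (s * tau / a) * (k6 * tau)) by field; rewrite gt_eqF.
have h5 : 0 <= k1 * (s * tau / a) * (k6 * tau) by nneg.
have h6 : 0 <= k1 ^+ 2 * (s ^+ 2 * (tau ^+ 2 / a ^+ 2)) by nneg.
have h7 : 0 <= (k6 * tau) ^+ 2 by nneg.
rewrite -/v in h1; lra.
Qed.

Let phiW_odd i j t : phiW j i (- t) = - phiW i j t.
Proof. by rewrite /phiW W_sym mulrN. Qed.

Let phiW_mono i j x y : c * (x - y) ^+ 2 <= (phiW i j x - phiW i j y) * (x - y).
Proof.
rewrite /phiW -mulrBr -mulrA -expr2 ler_wpM2r ?sqr_ge0 //.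
by case/andP: (W_bounds i j).
Qed.

Let flowW_zero i : flow A phiW (fun=> 0) i = 0.
Proof. by apply: big1 => j _; rewrite /phiW subrr !mulr0. Qed.

Let wbarE : \sum_i W m i / n%:R = n%:R * wbar.
Proof. by rewrite /wbar; field; rewrite gt_eqF. Qed.

Let zu : \sum_i z i * flow A phiW z i = \sum_i z i * (W m i / n%:R).
Proof.
transitivity (\sum_i (z i * (W m i / n%:R) - z i * wbar)).
  by apply: eq_bigr => i _; rewrite z_flow mulrBr.
by rewrite sumrB -mulr_suml z0 mul0r subr0.
Qed.

Let u_nrm2 : nrm2 (fun i => W m i / n%:R) <= n%:R^-1.
Proof.
apply: le_trans (_ : \sum_(i < n) n%:R^-1 ^+ 2 <= _).
  by apply: ler_sum => i _; rewrite exprMn ler_piMl ?sqr_ge0.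
rewrite sumr_const card_ord -[X in X <= _]mulr_natl le_eqVlt; apply/orP; left.
by apply/eqP; field; rewrite gt_eqF.
Qed.

Lemma z_nrm2 : nrm2 z <= (384 * k / s ^+ 2) ^+ 2 / n%:R.
Proof.
have lam0 : 0 < s ^+ 2 / 192 by rewrite divr_gt0 ?exprn_gt0.
have zz : \sum_(i < n) (0 : R) = 0 by rewrite big1.
have := flow_stable A01 A_sym phiW_odd c0 phiW_mono lam0 poincare z0 zz.
have e1 : nrm2 (fun i => z i - 0) = nrm2 z by apply: eq_bigr => i _; rewrite subr0.
have e2 : nrm2 (fun i => flow A phiW z i - flow A phiW (fun=> 0) i) =
          nrm2 (fun i => W m i / n%:R - wbar).
  by apply: eq_bigr => i _; rewrite z_flow flowW_zero subr0.
(* Subtracting the mean [wbar] is an orthogonal projection and cannot increase the norm. *)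
have e3 : nrm2 (fun i => W m i / n%:R - wbar) <= n%:R^-1.
  rewrite nrm2_shift wbarE -addrA; apply: le_trans u_nrm2; rewrite gerDl.
  have -> : 2 * - wbar * (n%:R * wbar) + n%:R * (- wbar) ^+ 2 = - (n%:R * wbar ^+ 2).
    by ring.
  by rewrite oppr_le0; nneg.
rewrite e1 e2 => /le_trans /(_ e3) h.
have mu0 : 0 < (c * (s ^+ 2 / 192) / 2) ^+ 2.
  by rewrite exprn_gt0 // divr_gt0 // mulr_gt0.
rewrite -(ler_pM2l mu0); apply: le_trans h _; rewrite le_eqVlt; apply/orP; left.
by apply/eqP; rewrite cE; field; rewrite !gt_eqF.
Qed.

Lemma z_dirichlet : s ^+ 2 * n%:R * dirichlet A z <= 768 * k ^+ 2.
Proof.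
have := flow_monotone A01 A_sym phiW_odd phiW_mono z (fun=> 0).
have -> : dirichlet A (fun i => z i - 0) = dirichlet A z.
  by do 2!(apply: eq_bigr => ? _); rewrite !subr0.
have -> : \sum_i (z i - 0) * (flow A phiW z i - flow A phiW (fun=> 0) i) =
          \sum_i z i * flow A phiW z i.
  by apply: eq_bigr => i _; rewrite flowW_zero !subr0.
rewrite zu => h.
have cs := cauchy_schwarz1 z (fun i => W m i / n%:R).
have h1 : \sum_i z i * (W m i / n%:R) <= 384 * k / (s ^+ 2 * n%:R).
  apply: le_trans (ler_norm _) _; apply: norm_le_sqr; first by nneg.
  apply: le_trans cs _.
  have -> : (384 * k / (s ^+ 2 * n%:R)) ^+ 2 = (384 * k / s ^+ 2) ^+ 2 / n%:R * n%:R^-1.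
    by field; rewrite !gt_eqF.
  by apply: ler_pM; rewrite ?nrm2_ge0 ?z_nrm2.
have h2 : c * dirichlet A z <= 2 * (384 * k / (s ^+ 2 * n%:R)) by lra.
have sn0 : 0 < s ^+ 2 * n%:R * k by rewrite !mulr_gt0 ?exprn_gt0.
have := ler_wpM2l (ltW sn0) h2.
have -> : s ^+ 2 * n%:R * k * (c * dirichlet A z) = s ^+ 2 * n%:R * dirichlet A z.
  by rewrite cE; field; rewrite gt_eqF.
have -> // : s ^+ 2 * n%:R * k * (2 * (384 * k / (s ^+ 2 * n%:R))) = 768 * k ^+ 2.
by field; rewrite !gt_eqF.
Qed.

Lemma z_noise_le : `|\sum_i z i * b i| <= (768 * k ^+ 2 + 12) * eta.
Proof.
apply: le_trans z_noise _; have h := z_dirichlet.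
have [_ p1] := andP p01.
have sn : s <= Num.sqrt n%:R.
  rewrite -[s]ger0_norm ?(ltW s0) // -sqrtr_sqr ler_sqrt ?ler0n // -nps.
  by rewrite ler_piMr.
have sq0 : 0 < Num.sqrt n%:R :> R by exact: lt_le_trans sn.
have h1 : tau / Num.sqrt n%:R <= eta.
  rewrite ler_pdivrMr //; apply: le_trans tau_s _.
  by rewrite mulrC ler_wpM2l // ltW.
rewrite mulrC; apply: ler_pM => //; last by rewrite lerD2r.
- by rewrite addr_ge0 // mulr_ge0 //; [nneg|do 2!(apply: sumr_ge0 => ? _); nneg].
- by rewrite divr_ge0 // ltW.
Qed.

Let rem i := \sum_j A i j * (phi i j (delta i - delta j) - W i j * (delta i - delta j)).

Hypothesis M_half : k5 * tau <= 1 / 4.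

Let dist_le i j : `|delta i - delta j| <= 1 / 2.
Proof.
apply: le_trans (ler_normB _ _) _.
by have := delta_le i; have := delta_le j; have := delta_sup; have := M_half; lra.
Qed.

Lemma rem_le i : `|rem i| <= 2 * \sum_j A i j * (delta i - delta j) ^+ 2.
Proof.
apply: le_trans (ler_norm_sum _ _ _) _; rewrite mulr_sumr; apply: ler_sum => j _.
rewrite normrM (ger0_norm (A_ge0 _ _)) mulrCA ler_wpM2l //.
exact: phi_taylor (dist_le i j).
Qed.

(** Of the two factors of the quadratic remainder, one is bounded in sup norm and the other in
    Euclidean norm, so that the gain in [nrm2 delta] is kept. *)
Lemma rem_nrm2 : nrm2 rem <= 576 * s ^+ 4 * (k5 * tau) ^+ 2 * nrm2 delta.
Proof.
have h i : rem i ^+ 2 <= 48 * s ^+ 2 * (k5 * tau) ^+ 2 *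
    \sum_j A i j * (delta i - delta j) ^+ 2.
  apply: le_trans (_ : (2 * \sum_j A i j * (delta i - delta j) ^+ 2) ^+ 2 <= _).
    rewrite -[leLHS]real_normK ?num_real // ler_pXn2r ?nnegrE ?rem_le //.
    by rewrite mulr_ge0 //; apply: sumr_ge0 => j _; nneg.
  have := cauchy_schwarz (fun=> 1) (fun j => (delta i - delta j) ^+ 2) (A_ge0 i).
  have -> : \sum_j A i j * (1 * (delta i - delta j) ^+ 2) =
            \sum_j A i j * (delta i - delta j) ^+ 2.
    by apply: eq_bigr => j _; rewrite mul1r.
  have -> : \sum_j A i j * 1 ^+ 2 = \sum_j A i j.
    by apply: eq_bigr => j _; rewrite expr1n mulr1.
  set S := \sum_j A i j * (delta i - delta j) ^+ 2.
  set T := \sum_j A i j * _ ^+ 2 => cs.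
  have T0 : 0 <= T by apply: sumr_ge0 => j _; nneg.
  have hT : T <= 4 * (k5 * tau) ^+ 2 * S.
    rewrite /T /S mulr_sumr; apply: ler_sum => j _.
    rewrite [leRHS]mulrCA; apply: ler_wpM2l => //.
    rewrite [leLHS]expr2; apply: ler_wpM2r; first exact: sqr_ge0.
    have := delta_sqr_le i; have := delta_sqr_le j.
    by have := sqr_ge0 (delta i + delta j); nra.
  have u : (\sum_j A i j) * T <= 3 * s ^+ 2 * (4 * (k5 * tau) ^+ 2 * S).
    by apply: ler_pM => //; apply: sumr_ge0.
  rewrite exprMn; lra.
apply: le_trans (ler_sum _ (fun i _ => h i)) _.
rewrite -mulr_sumr -/(dirichlet A delta).
have d := dirichlet_le delta A_ge0 A_sym deg_le.
have q : 0 <= 48 * s ^+ 2 * (k5 * tau) ^+ 2 by nneg.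
apply: le_trans (ler_wpM2l q d) _.
by rewrite le_eqVlt; apply/orP; left; apply/eqP; ring.
Qed.

Lemma z_rem_le : `|\sum_i z i * rem i| <= 384 * 24 * k * k5 * k1 * eta.
Proof.
apply: le_trans (_ : 384 * 24 * k * k5 * k1 * (tau ^+ 2 / a) <= _); last first.
  by rewrite ler_wpM2l ?scale4 //; nneg.
apply: norm_le_sqr; first by nneg.
apply: le_trans (cauchy_schwarz1 _ _) _.
apply: le_trans (ler_pM (nrm2_ge0 _) (nrm2_ge0 _) z_nrm2 rem_nrm2) _.
have q : 0 <= (384 * k / s ^+ 2) ^+ 2 / n%:R * (576 * s ^+ 4 * (k5 * tau) ^+ 2).
  by nneg.
rewrite [leLHS]mulrA; apply: le_trans (ler_wpM2l q delta_nrm2) _.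
rewrite le_eqVlt; apply/orP; left; apply/eqP.
by field; rewrite !gt_eqF.
Qed.

Let K7 := mean_cst k.

Lemma mean_delta_le : `|\sum_j W m j / n%:R * delta j| <= K7 * eta.
Proof.
have sym : \sum_i delta i * flow A phiW z i = \sum_i z i * flow A phiW delta i.
  have S x y : 2 * (\sum_i x i * flow A phiW y i) =
      \sum_i \sum_j A i j * phiW i j (y i - y j) * (x i - x j).
    exact: sum_antisym (flow_antisym A_sym phiW_odd y).
  suff : 2 * (\sum_i delta i * flow A phiW z i) =
         2 * (\sum_i z i * flow A phiW delta i) by lra.
  by rewrite !S; do 2!(apply: eq_bigr => ? _); rewrite /phiW; ring.
have e1 : \sum_i delta i * flow A phiW z i = \sum_j W m j / n%:R * delta j.
  transitivity (\sum_i (W m i / n%:R * delta i - wbar * delta i)).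
    by apply: eq_bigr => i _; rewrite z_flow; ring.
  by rewrite sumrB -mulr_sumr delta0 mulr0 subr0.
have e2 : \sum_i z i * flow A phiW delta i =
    \sum_i z i * b i - \sum_i z i * rem i.
  rewrite -sumrB; apply: eq_bigr => i _; rewrite -mulrBr; congr (_ * _).
  rewrite -delta_flow /flow /rem -sumrB; apply: eq_bigr => j _.
  by rewrite /phiW; ring.
rewrite -e1 sym e2; apply: le_trans (ler_normB _ _) _.
by have := z_noise_le; have := z_rem_le; rewrite /K7 /mean_cst -/k5 -/k1; lra.
Qed.

Let K8 := lin_cst k.

Lemma neighbour_linear_le : `|\sum_j A m j * (W m j * delta j)| <= K8 * (s ^+ 2 * eta).
Proof.
(* Write [delta = v + f], then [A = (A - p) + p] on the [f] part, and return from [p f] to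
   [p delta - p v]. The diagonal is corrected separately: [row_bern] excludes [m], where
   [A m m - p = - p]. *)
have split : \sum_j A m j * (W m j * delta j) =
   \sum_j A m j * (W m j * v j) + \sum_(j | j != m) (A m j - p) * (W m j * f j)
   - p * (W m m * f m) - p * \sum_j W m j * v j
   + s ^+ 2 * (\sum_j W m j / n%:R * delta j).
  have -> : s ^+ 2 * (\sum_j W m j / n%:R * delta j) = p * \sum_j W m j * delta j.
    rewrite -nps -mulrA mulrCA; congr (_ * _); rewrite mulr_sumr.
    by apply: eq_bigr => j _; field; rewrite gt_eqF.
  have -> : \sum_(j | j != m) (A m j - p) * (W m j * f j) =
     \sum_j (A m j - p) * (W m j * f j) + p * (W m m * f m).
    have Amm : A m m = 0 by rewrite /A edge_irr.
    by rewrite [in RHS](bigD1 m) //= Amm; ring.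
  suff -> : \sum_j A m j * (W m j * delta j) = \sum_j A m j * (W m j * v j) +
      \sum_j (A m j - p) * (W m j * f j) - p * (\sum_j W m j * v j) +
      p * (\sum_j W m j * delta j) by ring.
  rewrite !mulr_sumr -sumrN -!big_split /=.
  by apply: eq_bigr => j _; rewrite /v; ring.
have [_ p1] := andP p01.
have h1 : `|\sum_j A m j * (W m j * v j)| <= 2 * k6 * (s ^+ 2 * eta).
  apply: le_trans (_ : 2 * s * (k6 * tau) <= _); last first.
    have -> : 2 * k6 * (s ^+ 2 * eta) = 2 * s * (k6 * (s * eta)) by ring.
    by rewrite ler_wpM2l ?ler_wpM2l //; nneg.
  apply: norm_le_sqr; first by nneg.
  have := cauchy_schwarz (fun=> 1) (fun j => W m j * v j) (A_ge0 m).
  have -> : \sum_j A m j * (1 * (W m j * v j)) = \sum_j A m j * (W m j * v j).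
    by apply: eq_bigr => j _; rewrite mul1r.
  have -> : \sum_j A m j * 1 ^+ 2 = \sum_j A m j.
    by apply: eq_bigr => j _; rewrite expr1n mulr1.
  move=> /le_trans; apply.
  have h : \sum_j A m j * (W m j * v j) ^+ 2 <= (k6 * tau) ^+ 2.
    apply: le_trans v_le; apply: ler_sum => j _; rewrite exprMn mulrA.
    rewrite ler_piMl ?sqr_ge0 // mulr_ile1 ?sqr_ge0 //.
    by case/andP: (A01 m j).
  apply: le_trans (_ : 3 * s ^+ 2 * (k6 * tau) ^+ 2 <= _).
    by apply: ler_pM => //; apply: sumr_ge0 => j _; nneg.
  have : 0 <= s ^+ 2 * (k6 * tau) ^+ 2 by nneg.
  lra.
have h2 : `|\sum_(j | j != m) (A m j - p) * (W m j * f j)| <=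
    25 * (k5 + 3 * k6 + 2 * k1) * (s ^+ 2 * eta).
  apply: le_trans row_bern _; rewrite -mulrA ler_wpM2l //.
  have t1 : a ^+ 4 * normInf f <= (k5 + k6) * (s ^+ 2 * eta).
    apply: le_trans (_ : a ^+ 4 * ((k5 + k6) * tau) <= _).
      by rewrite ler_wpM2l ?loo_sup_le //; nneg.
    by rewrite mulrCA ler_wpM2l //; nneg.
  have t2 : a ^+ 2 * Num.sqrt (p * nrm2 f) <=
      2 * k1 * (s ^+ 2 * eta) + 2 * k6 * (s ^+ 2 * eta).
    apply: le_trans (_ : a ^+ 2 * (2 * k1 * (s * tau / a) + 2 * k6 * tau) <= _).
      by rewrite ler_wpM2l ?sqrt_p_nrm2 //; nneg.
    have -> : a ^+ 2 * (2 * k1 * (s * tau / a) + 2 * k6 * tau) =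
       2 * k1 * (s * (a * tau)) + 2 * k6 * (a * (a * tau)).
      by field; rewrite gt_eqF.
    have -> : s ^+ 2 * eta = s * (a * tau) by rewrite -s_eta; ring.
    rewrite lerD2l ler_wpM2l ?ler_wpM2r //; nneg.
  lra.
have h3 : `|p * (W m m * f m)| <= (k5 + k6) * (s ^+ 2 * eta).
  apply: le_trans (_ : (k5 + k6) * tau <= _); last first.
    rewrite ler_wpM2l //; first by nneg.
    apply: le_trans tau_s _.
    have -> : s ^+ 2 * eta = s * (s * eta) by ring.
    by rewrite ler_peMl //; nneg.
  apply: le_trans loo_sup_le; apply: le_trans (normInf_ge f m).
  rewrite !normrM (ger0_norm p0) (ger0_norm (W0 m m)) mulrA ler_piMl //.
  by rewrite mulr_ile1.
have h4 : `|p * \sum_j W m j * v j| <= k6 * (s ^+ 2 * eta).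
  apply: le_trans (_ : s * (k6 * tau) <= _); last first.
    have -> : k6 * (s ^+ 2 * eta) = s * (k6 * (s * eta)) by ring.
    by rewrite ler_wpM2l ?ler_wpM2l //; nneg.
  apply: norm_le_sqr; first by nneg.
  have cs := cauchy_schwarz1 (W m) v.
  have w : \sum_j W m j ^+ 2 <= n%:R.
    apply: le_trans (_ : \sum_(j < n) 1 <= _); first exact: ler_sum.
    by rewrite sumr_const card_ord.
  rewrite [leLHS]exprMn [leRHS]exprMn.
  apply: le_trans (_ : p ^+ 2 * (n%:R * (k6 * tau) ^+ 2) <= _).
    rewrite ler_wpM2l ?sqr_ge0 //; apply: le_trans cs _.
    by apply: ler_pM; rewrite ?nrm2_ge0 ?v_le // sumr_ge0 // => j _; nneg.
  have -> : s ^+ 2 * (k6 * tau) ^+ 2 = n%:R * p * (k6 * tau) ^+ 2.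
    by rewrite nps.
  have -> : p ^+ 2 * (n%:R * (k6 * tau) ^+ 2) = p * (n%:R * p * (k6 * tau) ^+ 2) by ring.
  by apply: ler_piMl => //; nneg.
have h5 : `|s ^+ 2 * (\sum_j W m j / n%:R * delta j)| <= K7 * (s ^+ 2 * eta).
  rewrite normrM (ger0_norm (sqr_ge0 s)) mulrCA ler_wpM2l ?sqr_ge0 //.
  exact: mean_delta_le.
move: h1 h2 h3 h4 h5; rewrite split !ler_norml => /andP[? ?] /andP[? ?] /andP[? ?].
by move=> /andP[? ?] /andP[? ?]; rewrite /K8 /lin_cst -/k1 -/k5 -/k6 -/K7; apply/andP; split; lra.
Qed.

Let d := \sum_j A m j * W m j.
Let K9 := err_cst k.

(** Linearising row [m] gives [d * delta m - b m] as the weighted sum over the neighbours minus a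
    remainder. The neighbour terms are of order [eta] after division by [d], while the remainder
    also contains [delta m ^+ 2], which produces the relative error. *)
Lemma expansion_bound :
  `|delta m - b m / d| <= 8 * k * k5 * (a ^+ 3 / s) * `|b m / d| + 2 * K9 * eta.
Proof.
have sc0 : 0 < s ^+ 2 * eta by rewrite mulr_gt0 ?exprn_gt0.
have deg0 : 0 < \sum_j A m j.
  by apply: lt_le_trans (deg_ge m); rewrite divr_gt0 ?exprn_gt0.
have d_ge : c * (\sum_j A m j) <= d.
  rewrite mulr_sumr; apply: ler_sum => j _; rewrite mulrC ler_wpM2l //.
  by case/andP: (W_bounds m j).
have d0 : 0 < d by apply: lt_le_trans d_ge; rewrite mulr_gt0.
have key : d * delta m - b m = \sum_j A m j * (W m j * delta j) - rem m.
  rewrite -delta_flow /flow /rem /d mulr_suml -!sumrB; apply: eq_bigr => j _; ring.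
have h1 := neighbour_linear_le; have h2 := rem_le m; have h3 := neighbour_sum_eta.
have h4 : \sum_j A m j * (delta m - delta j) ^+ 2 <=
    2 * (\sum_j A m j) * delta m ^+ 2 + 2 * Q.
  have -> : 2 * (\sum_j A m j) * delta m ^+ 2 + 2 * Q =
     \sum_j A m j * (2 * delta m ^+ 2 + 2 * delta j ^+ 2).
    rewrite /Q [2 * _]mulrC -mulrA mulr_suml mulr_sumr -big_split.
    by apply: eq_bigr => j _ /=; ring.
  apply: ler_sum => j _; rewrite ler_wpM2l //; have := sqr_ge0 (delta m + delta j); nra.
have h5 : `|d * delta m - b m| <= 4 * (\sum_j A m j) * delta m ^+ 2 +
    (K8 + 4 * K4 * (k5 ^+ 2 + 2)) * (s ^+ 2 * eta).
  rewrite key; apply: le_trans (ler_normB _ _) _; lra.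
pose X := delta m - b m / d.
have h6 : d * `|X| = `|d * delta m - b m|.
  rewrite -[X in X * _](gtr0_norm d0) -normrM; congr `|_|.
  by rewrite /X; field; rewrite gt_eqF.
have deg_d : \sum_j A m j <= k * d.
  have -> : \sum_j A m j = k * (c * \sum_j A m j) by rewrite mulrA (mulrC k) ck mul1r.
  by rewrite ler_wpM2l // ltW.
have s_d : s ^+ 2 <= 8 * k * d.
  by have := deg_ge m; lra.
have K8p : 0 <= K8 + 4 * K4 * (k5 ^+ 2 + 2).
  by have := le_trans ler01 K4_ge1 => ?; rewrite /K8 /lin_cst -/k1 -/k5 -/k6 -/K7 /K7 /mean_cst -/k5 -/k1; nneg.
have h7 : `|X| <= 4 * k * delta m ^+ 2 + K9 * eta.
  rewrite -(ler_pM2l d0) h6; apply: le_trans h5 _.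
  have u1 : (\sum_j A m j) * delta m ^+ 2 <= k * d * delta m ^+ 2.
    by rewrite ler_wpM2r ?sqr_ge0.
  have u2 : s ^+ 2 * ((K8 + 4 * K4 * (k5 ^+ 2 + 2)) * eta) <=
            8 * k * d * ((K8 + 4 * K4 * (k5 ^+ 2 + 2)) * eta).
    by rewrite ler_wpM2r // mulr_ge0 // ltW.
  rewrite /K9 /err_cst -/K8 -/K4 -/k5; lra.
(* One factor [delta m] is replaced by its sup bound [k5 tau], at most [k5 a^3 / s]. The other is
   then compared with [b m / d], and the resulting multiple of [|X|] is absorbed by [h9]. *)
have h8 : delta m ^+ 2 <= k5 * (a ^+ 3 / s) * `|delta m|.
  rewrite -[leLHS]real_normK ?num_real // expr2 ler_wpM2r //.
  apply: le_trans (delta_le m) _; apply: le_trans delta_sup _.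
  rewrite ler_wpM2l //; first by nneg.
  rewrite ler_pdivlMr // mulrC; apply: le_trans tau_le _.
  by rewrite ler_weXn2l.
have h9 : 4 * k * k5 * (a ^+ 3 / s) <= 1 / 2.
  have : 8 * k * k5 * a ^+ 3 / s <= 1 by rewrite ler_pdivrMr // mul1r.
  lra.
have h10 : `|delta m| <= `|b m / d| + `|X|.
  have -> : delta m = b m / d + X by rewrite /X addrC subrK.
  exact: ler_normD.
have u3 : 4 * k * delta m ^+ 2 <= 4 * k * (k5 * (a ^+ 3 / s) * `|delta m|).
  by rewrite ler_wpM2l //; nneg.
rewrite (_ : 4 * k * (k5 * _ * _) = 4 * k * k5 * (a ^+ 3 / s) * `|delta m|) in u3;
  last by ring.
set e := 4 * k * k5 * (a ^+ 3 / s) in h9 u3.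
have e0 : 0 <= e by rewrite /e; nneg.
have u4 : e * `|delta m| <= e * (`|b m / d| + `|X|) by rewrite ler_wpM2l.
have u5 : e * `|X| <= 1 / 2 * `|X| by rewrite ler_wpM2r.
have -> : 8 * k * k5 * (a ^+ 3 / s) * `|b m / d| = 2 * (e * `|b m / d|).
  by rewrite /e; ring.
rewrite -/X; lra.
Qed.

End Expansion.

End DeterministicBounds.

(** * Good event *)

Lemma card_le_setC (n : nat) (S : {set 'I_n}) :
  (2 * #|S| <= n)%N -> (n <= 2 * #|~: S|)%N.
Proof.
have := cardsC S; rewrite card_ord; move: #|S| #|~: S| => x y e; lia.
Qed.

Section RandomEvents.
Variables (R : realType) (n L : nat) (p : R) (theta : 'I_n -> R).
Hypothesis hp : 0 <= p <= 1.
Hypothesis L0 : (0 < L)%N.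
Implicit Types w : Omega n L.

Definition noise_sum w i : R := \sum_j adj R w i j * noise theta w i j.

Lemma bvecE w : bvec w theta =1 noise_sum w.
Proof.
move=> i; rewrite /noise_sum (bigD1 i) //= adj_diag mul0r add0r.
by [].
Qed.

Lemma dvecE w i : dvec w theta i = \sum_j adj R w i j * dpsi (theta i - theta j).
Proof. by rewrite [RHS](bigD1 i) //= adj_diag mul0r add0r. Qed.

Lemma Prob_forall (T : finType) (E : T -> Omega n L -> Prop) (e : R) :
  (forall t, Prob p theta (fun w => ~ E t w) <= e) ->
  Prob p theta (fun w => ~ (forall t, E t w)) <= #|T|%:R * e.
Proof.
move=> h; apply: (le_trans _ (Prob_exists_le hp h)).
by apply: Prob_le => // w /existsNP.
Qed.

Lemma Prob_and (E E' : Omega n L -> Prop) (e e' : R) :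
  Prob p theta (fun w => ~ E w) <= e -> Prob p theta (fun w => ~ E' w) <= e' ->
  Prob p theta (fun w => ~ (E w /\ E' w)) <= e + e'.
Proof.
move=> h h'; apply: (le_trans _ (lerD h h')); apply: (le_trans _ (Prob_or theta hp _ _)).
by apply: Prob_le => // w /not_andP.
Qed.

Lemma Prob_never (E : Omega n L -> Prop) : (forall w, ~ E w) -> Prob p theta E = 0.
Proof. by move=> h; rewrite /Prob big_pred0 // => w; apply/asboolPn/h. Qed.

Lemma noise_sum_linear w (u : 'I_n -> R) : \sum_i u i * noise_sum w i =
  \sum_(i < n) \sum_(j < n | (i < j)%N) adj R w i j * ((u i - u j) * noise theta w i j).
Proof.
pose G i j := adj R w i j * noise theta w i j.
have Ga i j : G j i = - G i j.
  rewrite /G adj_sym; have [->|ij] := eqVneq i j.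
    by rewrite adj_diag !mul0r oppr0.
  by rewrite noise_antisym // mulrN.
have := sum_antisym u Ga; rewrite -sum_lt_sym; first last.
- by move=> i; rewrite subrr mulr0.
- by move=> i j; rewrite Ga; ring.
move=> h; have {h} -> : \sum_i u i * noise_sum w i =
    \sum_(i < n) \sum_(j < n | (i < j)%N) G i j * (u i - u j).
  by apply: (@mulfI _ 2); rewrite ?pnatr_eq0.
by do 2!(apply: eq_bigr => ? _); rewrite /G; ring.
Qed.

Lemma dirichlet_lt w (u : 'I_n -> R) : dirichlet (adj R w) u =
  2 * \sum_(i < n) \sum_(j < n | (i < j)%N) adj R w i j * (u i - u j) ^+ 2.
Proof.
rewrite sum_lt_sym // => [i j|i]; last by rewrite subrr expr0n mulr0.
by rewrite adj_sym -(opprB (u i)) sqrrN.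
Qed.

(** [noise_tail] for [z i j = u i - u j]: the compensator [2 / L] times the sum over [i < j] is the
    energy divided by [L]. A direction [u] built from the graph is allowed, as needed for the
    potentials. *)
Lemma linear_noise_tail (u : Omega n L -> 'I_n -> R) (t : R) :
  (forall el b w, u (set_outcome el b w) = u w) ->
  Prob p theta (fun w => ~ (\sum_i u w i * noise_sum w i <=
    dirichlet (adj R w) (u w) / L%:R + t)) <= expR (- t).
Proof.
move=> hu; have LR : L%:R != 0 :> R by rewrite pnatr_eq0 -lt0n.
apply: (le_trans _ (@noise_tail _ _ _ _ theta hp L0 (fun w i j => u w i - u w j) t _)).
  apply: Prob_le => // w /negP; rewrite -ltNge => h.
  under eq_bigr do under eq_bigr do rewrite mulrBr.
  under eq_bigr do rewrite sumrB; rewrite sumrB -noise_sum_linear.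
  have -> : \sum_(i < n) \sum_(j < n | (i < j)%N)
      adj R w i j * (2 / L%:R * (u w i - u w j) ^+ 2) = dirichlet (adj R w) (u w) / L%:R.
    rewrite dirichlet_lt [RHS]mulrAC [RHS]mulr_sumr; apply: eq_bigr => i _.
    by rewrite [RHS]mulr_sumr; apply: eq_bigr => j _; ring.
  lra.
by move=> el b w; rewrite hu.
Qed.

Lemma linear_noise_abs_tail (u : Omega n L -> 'I_n -> R) (t : R) :
  (forall el b w, u (set_outcome el b w) = u w) ->
  Prob p theta (fun w => ~ (`|\sum_i u w i * noise_sum w i| <=
    dirichlet (adj R w) (u w) / L%:R + t)) <= 2 * expR (- t).
Proof.
move=> hu; have h1 := linear_noise_tail t hu.
have := @linear_noise_tail (fun w i => - u w i) t _.
move=> /(_ (fun el b w => _)) h2.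
rewrite [leRHS]mulr_natl [leRHS]mulr2n; apply: (le_trans _ (Prob_and h1 (h2 _))); last first.
  by move=> el b w; rewrite hu.
apply: Prob_le => // w; apply: contra_not => -[a1 a2].
rewrite ler_norml; apply/andP; split=> //.
have -> : dirichlet (adj R w) (u w) = dirichlet (adj R w) (fun i => - u w i).
  by do 2!(apply: eq_bigr => ? _); congr (_ * _); rewrite -sqrrN; congr (_ ^+ 2); ring.
rewrite lerNl -sumrN; apply: le_trans a2; rewrite le_eqVlt; apply/orP; left.
by apply/eqP; apply: eq_bigr => i _; rewrite mulNr.
Qed.

Lemma edge_noise_tail (lam t : R) (i0 j0 : 'I_n) : 0 < lam -> i0 != j0 ->
  Prob p theta (fun w => ~ (lam * (adj R w i0 j0 * `|noise theta w i0 j0|) <=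
    2 / L%:R * lam ^+ 2 + t)) <= 2 * expR (- t).
Proof.
move=> lam0.
wlog ij : i0 j0 / (i0 < j0)%N.
  move=> h ne; have [lt|lt|/val_inj e] := ltngtP i0 j0; first exact: h.
    apply: (le_trans _ (h j0 i0 lt _)); last by rewrite eq_sym.
    apply: Prob_le => // w; apply: contra_not.
    by rewrite adj_sym noise_antisym // normrN.
  by rewrite e eqxx in ne.
move=> _.
have T (e : R) : e ^+ 2 = lam ^+ 2 ->
    Prob p theta (fun w => ~ (e * (adj R w i0 j0 * noise theta w i0 j0) <=
    2 / L%:R * lam ^+ 2 + t)) <= expR (- t).
  move=> e2.
  pose z (w : Omega n L) (i j : 'I_n) := if (i == i0) && (j == j0) then e else 0.
  apply: (le_trans _ (@noise_tail _ _ _ _ theta hp L0 z t _)) => //.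
  apply: Prob_le => // w /negP; rewrite -ltNge => h.
  rewrite (bigD1 i0) //= (bigD1 j0) //= /z !eqxx /=.
  rewrite big1 ?addr0 => [|j /andP[_ /negbTE ->]]; last first.
    by rewrite /=; ring.
  rewrite big1 ?addr0 => [|i /negbTE ->]; last first.
    by rewrite big1 // => j _ /=; ring.
  rewrite e2 mulrBr; have /andP[A0 A1] := adj01 R w i0 j0.
  have : adj R w i0 j0 * (2 / L%:R * lam ^+ 2) <= 2 / L%:R * lam ^+ 2.
    by rewrite ler_piMl // mulr_ge0 ?sqr_ge0 // divr_ge0.
  lra.
have T1 := T lam erefl; have T2 := T (- lam) (sqrrN _).
rewrite [leRHS]mulr_natl [leRHS]mulr2n; apply: (le_trans _ (Prob_and T1 T2)).
apply: Prob_le => // w; apply: contra_not => -[h1 h2].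
have /andP[A0 A1] := adj01 R w i0 j0.
have [hn|hn] := lerP 0 (noise theta w i0 j0).
  by rewrite ger0_norm.
by rewrite ltr0_norm //; move: h2; rewrite mulNr -mulrN -mulrN.
Qed.

Variables (a s tau : R).
Hypothesis n0 : (0 < n)%N.
Hypothesis a1 : 1 <= a.
Hypothesis s0 : 0 < s.
Hypothesis nps : n%:R * p = s ^+ 2.
Hypothesis tauE : tau = a ^+ 2 / (s * Num.sqrt L%:R).
Hypothesis as_le : 96 * a ^+ 4 <= s ^+ 2.
Hypothesis an_le : a ^+ 4 <= n%:R.

Variables (W : 'I_n -> 'I_n -> R) (f z : Omega n L -> 'I_n -> 'I_n -> R).
Hypothesis W01 : forall i j, 0 <= W i j <= 1.
Hypothesis f_set_adj : forall m j b w, f (set_adj m j b w) m = f w m.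
Hypothesis z_set_outcome : forall el b w, z (set_outcome el b w) = z w.

Let Lr : R := Num.sqrt L%:R.
(** In the application [a^4 = ln n], so [expR (- t)] is [n^-12]; the union over ordered pairs spends
    two powers. *)
Let t := 12 * a ^+ 4.
Let a0 : 0 < a. Proof. exact: lt_le_trans a1. Qed.
Let p0 : 0 <= p. Proof. by case/andP: hp. Qed.
Let nR : 0 < n%:R :> R. Proof. by rewrite ltr0n. Qed.
Let LR : 0 < L%:R :> R. Proof. by rewrite ltr0n. Qed.
Let Lr0 : 0 < Lr. Proof. by rewrite sqrtr_gt0. Qed.
Let LrE : L%:R = Lr ^+ 2. Proof. by rewrite sqr_sqrtr // ltW. Qed.
Let sqn0 : 0 < Num.sqrt n%:R :> R. Proof. by rewrite sqrtr_gt0. Qed.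
Let sqnE : n%:R = Num.sqrt n%:R ^+ 2 :> R. Proof. by rewrite sqr_sqrtr // ltW. Qed.
Let tau0 : 0 < tau. Proof. by rewrite tauE divr_gt0 ?exprn_gt0 // mulr_gt0. Qed.

Definition degree_event w := forall m, \sum_j adj R w m j <= 3 * s ^+ 2.

Definition cut_event w := forall S : {set 'I_n}, (2 * #|S| <= n)%N ->
  s ^+ 2 / 8 * #|S|%:R <= \sum_(i in S) \sum_(j in ~: S) adj R w i j.

Definition edge_noise_event w := forall i j,
  adj R w i j * `|noise theta w i j| <= 14 * s * tau.

(* The [lam]'s are the parameters of the exponential moments. *)
Let lam4 := a ^+ 2 * Lr / s.
Let lam5 := Lr / s.
Let lam6 := a ^+ 4 * Num.sqrt n%:R / tau.

Definition node_noise_event w := forall i,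
  `|\sum_j (lam4 * (j == i)%:R) * noise_sum w j| <=
  dirichlet (adj R w) (fun j => lam4 * (j == i)%:R) / L%:R + t.

(** Evaluated at the signs of the noise itself this bounds its l1 norm; the extra [n] in the
    threshold pays for the [2^n] patterns. *)
Definition sign_noise_event w := forall sg : {ffun 'I_n -> bool},
  \sum_j (lam5 * (-1) ^+ sg j) * noise_sum w j <=
  dirichlet (adj R w) (fun j => lam5 * (-1) ^+ sg j) / L%:R + (n%:R + t).

Definition potential_noise_event w := forall m,
  `|\sum_j (lam6 * z w m j) * noise_sum w j| <=
  dirichlet (adj R w) (fun j => lam6 * z w m j) / L%:R + t.

Definition row_sqr_event w := forall m, \sum_j adj R w m j * f w m j ^+ 2 <=
  2 * p * nrm2 (f w m) + 24 * a ^+ 4 * normInf (f w m) ^+ 2.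

Definition row_bern_event w := forall m,
  `|\sum_(j | j != m) (adj R w m j - p) * (W m j * f w m j)| <=
  25 * (a ^+ 4 * normInf (f w m) + a ^+ 2 * Num.sqrt (p * nrm2 (f w m))).

(** * Probabilities of the individual events *)

Lemma degree_event_prob :
  Prob p theta (fun w => ~ degree_event w) <= n%:R * expR (- t).
Proof.
rewrite -[n in n%:R]card_ord; apply: Prob_forall => m.
have h01 w (j : 'I_n) : 0 <= (fun _ _ => 1 : R) w j <= 1 by rewrite /= ler01 lexx.
apply: (le_trans _ (@row_tail _ _ _ _ theta hp m (fun _ _ => 1) t h01 _)) => //.
apply: Prob_le => // w /negP; rewrite -ltNge sumr_const card_ord => h.
have -> : \sum_j adj R w m j * 1 = \sum_j adj R w m j.
  by apply: eq_bigr => j _; rewrite mulr1.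
apply: le_lt_trans h.
rewrite (_ : 2 * p * n%:R = 2 * s ^+ 2); last by rewrite -nps; ring.
clear h01; have : 0 <= a ^+ 4 by rewrite exprn_ge0 // ltW.
by rewrite /t; have := as_le; lra.
Qed.

Lemma edge_noise_event_prob :
  Prob p theta (fun w => ~ edge_noise_event w) <= n%:R ^+ 2 * (2 * expR (- t)).
Proof.
have -> : n%:R ^+ 2 = #|{: 'I_n * 'I_n}|%:R :> R.
  by rewrite card_prod card_ord natrM.
apply: le_trans (_ : Prob p theta (fun w => ~ (forall x : 'I_n * 'I_n,
  adj R w x.1 x.2 * `|noise theta w x.1 x.2| <= 14 * s * tau)) <= _).
  by apply: Prob_le => // w; apply: contra_not => h i j; exact: (h (i, j)).
apply: Prob_forall => -[i j] /=.
have [<-|ij] := eqVneq i j.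
  rewrite Prob_never ?mulr_ge0 ?expR_ge0 // => w; apply; rewrite adj_diag mul0r.
  by rewrite !mulr_ge0 // ltW.
have lam0 : 0 < a ^+ 2 * Lr by rewrite mulr_gt0 ?exprn_gt0.
apply: (le_trans _ (edge_noise_tail t lam0 ij)).
apply: Prob_le => // w; apply: contra_not.
have -> : 2 / L%:R * (a ^+ 2 * Lr) ^+ 2 + t = a ^+ 2 * Lr * (14 * s * tau).
  by rewrite tauE -/Lr LrE /t; field; rewrite !gt_eqF.
by rewrite ler_pM2l.
Qed.

Lemma node_noise_event_prob :
  Prob p theta (fun w => ~ node_noise_event w) <= n%:R * (2 * expR (- t)).
Proof.
by rewrite -[n in n%:R]card_ord; apply: Prob_forall => i; exact: linear_noise_abs_tail.
Qed.

Lemma potential_noise_event_prob :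
  Prob p theta (fun w => ~ potential_noise_event w) <= n%:R * (2 * expR (- t)).
Proof.
rewrite -[n in n%:R]card_ord; apply: Prob_forall => i.
apply: (@linear_noise_abs_tail (fun w j => lam6 * z w i j)) => el b w.
by rewrite z_set_outcome.
Qed.

Lemma sign_noise_event_prob :
  Prob p theta (fun w => ~ sign_noise_event w) <= expR (- t).
Proof.
apply: le_trans (_ : #|{ffun 'I_n -> bool}|%:R * expR (- (n%:R + t)) <= _).
  by apply: Prob_forall => sg; exact: linear_noise_tail.
rewrite card_ffun card_bool card_ord natrX opprD expRD mulrA ler_piMl ?expR_ge0 //.
rewrite expRN ler_pdivrMr ?expR_gt0 // mul1r.
have -> : expR n%:R = expR 1 ^+ n :> R by rewrite -expRM_natl mulr1.
rewrite lerXn2r ?nnegrE ?expR_ge0 //.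
by have := expR_ge1Dx (1 : R).
Qed.

(** [row_tail] needs values in [[0, 1]], so [f^2] is divided by its squared sup norm, which like [f]
    does not see the edges at [m]. A vanishing norm is treated apart, as the quotient is then 0 by
    convention. *)
Lemma row_sqr_event_prob :
  Prob p theta (fun w => ~ row_sqr_event w) <= n%:R * expR (- t).
Proof.
rewrite -[n in n%:R]card_ord; apply: Prob_forall => m.
pose F w := normInf (f w m).
pose g w j := f w m j ^+ 2 / F w ^+ 2.
have F0 w : 0 <= F w by exact: normInf_ge0.
have fF w j : f w m j ^+ 2 <= F w ^+ 2.
  by rewrite -[leLHS]real_normK ?num_real // ler_pXn2r ?nnegrE ?normInf_ge.
have g01 w j : 0 <= g w j <= 1.
  rewrite /g divr_ge0 ?sqr_ge0 //=.
  have [->|ne] := eqVneq (F w) 0; first by rewrite expr0n invr0 mulr0.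
  by rewrite ler_pdivrMr ?mul1r // exprn_gt0 // lt_def ne F0.
have gi j b w : g (set_adj m j b w) = g w by rewrite /g /F f_set_adj.
apply: (le_trans _ (row_tail theta hp t g01 gi)).
apply: Prob_le => // w /negP; rewrite -ltNge -/(F w) => h.
have [e|ne] := eqVneq (F w) 0.
  have f0 j : f w m j = 0.
    by apply/eqP; rewrite -sqrf_eq0 eq_le sqr_ge0 andbT (le_trans (fF w j)) // e expr0n.
  move: h; rewrite e expr0n mulr0 addr0 big1 => [|j _]; last by rewrite f0 expr0n mulr0.
  rewrite ltNge mulr_ge0 ?nrm2_ge0 //; exact: mulr_ge0.
have F2 : 0 < F w ^+ 2 by rewrite exprn_gt0 // lt_def ne F0.
rewrite -(ltr_pM2r F2).
have -> : (\sum_j adj R w m j * g w j) * F w ^+ 2 = \sum_j adj R w m j * f w m j ^+ 2.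
  by rewrite mulr_suml; apply: eq_bigr => j _; rewrite /g -!mulrA mulVf ?mulr1 // gt_eqF.
have e : (\sum_j g w j) * F w ^+ 2 = nrm2 (f w m).
  by rewrite mulr_suml; apply: eq_bigr => j _; rewrite /g -!mulrA mulVf ?mulr1 // gt_eqF.
have -> : (2 * p * (\sum_j g w j) + 2 * t) * F w ^+ 2 =
    2 * p * nrm2 (f w m) + 24 * a ^+ 4 * F w ^+ 2.
  by rewrite -e /t; ring.
exact: h.
Qed.

(** The normaliser [D] is the smallest natural one for which [|g| <= 1/2] and the compensator
    [2 p g^2] sums to at most [a^4 / 2]. The constant is [25 = 2 * (12 + 1/2)]: tail plus
    compensator, times the 2 in [2 * D]. The boolean selects the sign of the deviation. *)
Lemma row_bern_event_prob :
  Prob p theta (fun w => ~ row_bern_event w) <= n%:R * (2 * expR (- t)).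
Proof.
rewrite -[n in n%:R]card_ord; apply: Prob_forall => m.
pose F w := normInf (f w m).
pose D w := F w + Num.sqrt (p * nrm2 (f w m)) / a ^+ 2.
have F0 w : 0 <= F w by exact: normInf_ge0.
have pn0 w : 0 <= p * nrm2 (f w m) by rewrite mulr_ge0 ?nrm2_ge0.
have S0 w : 0 <= Num.sqrt (p * nrm2 (f w m)) / a ^+ 2.
  by rewrite divr_ge0 ?sqrtr_ge0 ?exprn_ge0 // ltW.
have D0 w : 0 <= D w by rewrite addr_ge0.
pose g (e : bool) w j := (-1) ^+ e * (W m j * f w m j) / (2 * D w).
have Wf w j : `|W m j * f w m j| <= D w.
  have /andP[w0 w1] := W01 m j.
  rewrite normrM (ger0_norm w0); apply: le_trans (ler_piMl _ w1) _ => //.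
  by apply: le_trans (normInf_ge (f w m) j) _; rewrite lerDl.
have gE e w j : g e w j ^+ 2 = (W m j * f w m j) ^+ 2 / (4 * D w ^+ 2).
  rewrite /g !exprMn -exprM mulnC exprM sqrrN expr1n expr1n mul1r.
  by rewrite exprVn exprMn; congr (_ / (_ * _)); ring.
have g12 e w j : `|g e w j| <= 1 / 2.
  have [De|ne] := eqVneq (D w) 0.
    by rewrite /g De mulr0 invr0 mulr0 normr0 divr_ge0.
  have Dp : 0 < D w by rewrite lt_def ne D0.
  rewrite /g normrM normfV normrM normrX normrN1 expr1n mul1r.
  rewrite (gtr0_norm (_ : 0 < 2 * D w)) ?mulr_gt0 // ler_pdivrMr ?mulr_gt0 //.
  by have := Wf w j; lra.
have gi e j b w : g e (set_adj m j b w) = g e w by rewrite /g /D /F f_set_adj.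
have T e := row_bernstein theta hp t (g12 e) (gi e).
rewrite [leRHS]mulr_natl [leRHS]mulr2n; apply: (le_trans _ (lerD (T false) (T true))).
apply: (le_trans _ (Prob_or theta hp _ _)); apply: Prob_le => // w /negP.
rewrite -ltNge -/(F w); set X := \sum_(j | j != m) _ => h.
have [De|ne] := eqVneq (D w) 0.
  have Wf0 j : W m j * f w m j = 0.
    by apply/eqP; rewrite -normr_le0 (le_trans (Wf w j)) // De.
  move: h; rewrite /X big1 => [|j _]; last by rewrite Wf0 mulr0.
  rewrite normr0 ltNge mulr_ge0 // addr_ge0 // mulr_ge0 ?sqrtr_ge0 ?exprn_ge0 //.
    exact: ltW.
  exact: ltW.
have Dp : 0 < D w by rewrite lt_def ne D0.
have sE e : \sum_(j | j != m) ((adj R w m j - p) * g e w j - 2 * p * g e w j ^+ 2) =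
   (-1) ^+ e * X / (2 * D w) -
   2 * p * (\sum_(j | j != m) (W m j * f w m j) ^+ 2) / (4 * D w ^+ 2).
  rewrite sumrB /X mulr_sumr mulr_suml mulr_sumr mulr_suml; congr (_ - _).
    by apply: eq_bigr => j _; rewrite /g; ring.
  by apply: eq_bigr => j _; rewrite gE mulrA.
have small : 2 * p * (\sum_(j | j != m) (W m j * f w m j) ^+ 2) / (4 * D w ^+ 2) <=
    a ^+ 4 / 2.
  rewrite ler_pdivrMr ?mulr_gt0 ?exprn_gt0 //.
  have h1 : \sum_(j | j != m) (W m j * f w m j) ^+ 2 <= nrm2 (f w m).
    rewrite /nrm2 [leRHS](bigD1 m) //=; apply: le_trans (_ : \sum_(j | j != m) f w m j ^+ 2 <= _).
      apply: ler_sum => j _; rewrite exprMn ler_piMl ?sqr_ge0 //.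
      by have /andP[w0 w1] := W01 m j; rewrite expr_le1.
    by rewrite lerDr sqr_ge0.
  have h2 : p * nrm2 (f w m) <= a ^+ 4 * D w ^+ 2.
    have -> : a ^+ 4 * D w ^+ 2 = (a ^+ 2 * D w) ^+ 2 by ring.
    have aD : 0 <= a ^+ 2 * D w by rewrite mulr_ge0 ?sqr_ge0.
    rewrite -[leLHS]sqr_sqrtr // ler_pXn2r ?nnegrE ?sqrtr_ge0 //.
    rewrite /D mulrDr [X in _ <= _ + X]mulrC divfK ?expf_neq0 ?gt_eqF //.
    by rewrite lerDr mulr_ge0 // exprn_ge0 // ltW.
  have := ler_wpM2l p0 h1; move: h2.
  set U := \sum_(j | j != m) _; set V := D w ^+ 2; set Z := nrm2 _.
  lra.
have tail : 25 * a ^+ 4 * D w < `|X|.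
  move: h; rewrite (_ : 25 * (_ + _) = 25 * a ^+ 4 * D w) //.
  by rewrite /D -/(F w); field; rewrite gt_eqF.
have tail2 : 25 / 2 * a ^+ 4 < `|X| / (2 * D w).
  by rewrite ltr_pdivlMr ?mulr_gt0 //; lra.
have at0 : 0 <= a ^+ 4 by rewrite exprn_ge0 // ltW.
rewrite !sE; have [X0|X0] := lerP 0 X; [left|right].
  by rewrite expr0 mul1r; move: tail2; rewrite ger0_norm // /t; lra.
by rewrite expr1 mulN1r; move: tail2; rewrite ltr0_norm // /t; lra.
Qed.

Hypothesis ne_small : n%:R * expR (- t) <= 1 / 2.

Lemma sum_set_expr (x : R) : \sum_(S : {set 'I_n}) x ^+ #|S| = (1 + x) ^+ n.
Proof.
transitivity (\prod_(i < n) (x + 1)); last first.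
  by rewrite prodr_const card_ord addrC.
rewrite bigA_distr; apply: eq_bigr => S _.
by rewrite -big_mkcond prodr_const.
Qed.

(** A small set satisfies [|~: S| >= n / 2], so its failure probability is at most [x^|S|]. By the
    binomial theorem the sum over nonempty sets is [(1 + x)^n - 1], at most [2 n x] once
    [n x <= 1/2]. The empty set never fails. *)
Lemma cut_event_prob :
  Prob p theta (fun w => ~ cut_event w) <= 2 * n%:R * expR (- t).
Proof.
pose x := expR (- (s ^+ 2 / 8)).
have xt : x <= expR (- t).
  by rewrite ler_expR lerN2 /t; have := as_le; lra.
have x0 : 0 < x := expR_gt0 _.
pose P (S : {set 'I_n}) := (S != finset.set0) && (2 * #|S| <= n)%N.
pose E (S : {set 'I_n}) (w : Omega n L) :=
  \sum_(i in S) \sum_(j in ~: S) adj R w i j < p * #|S|%:R * #|~: S|%:R / 4.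
have half (S : {set 'I_n}) : (2 * #|S| <= n)%N ->
    s ^+ 2 / 8 * #|S|%:R <= p * #|S|%:R * #|~: S|%:R / 4.
  move=> hS; have hc : n%:R <= 2 * #|~: S|%:R :> R.
    by rewrite -natrM ler_nat; exact: card_le_setC.
  have ps : 0 <= p * #|S|%:R by rewrite mulr_ge0.
  have := ler_wpM2l ps hc; rewrite -nps; lra.
apply: le_trans (_ : Prob p theta (fun w => exists2 S, P S & E S w) <= _).
  apply: Prob_le => // w /existsNP[S /not_implyP[hS /negP]]; rewrite -ltNge => h.
  exists S; last by apply: lt_le_trans h _; exact: half.
  rewrite /P hS andbT; apply: contraL h => /eqP ->.
  by rewrite cards0 mulr0 -leNgt big_set0.
apply: le_trans (Prob_exists theta hp P E) _.
apply: le_trans (_ : \sum_(S | P S) x ^+ #|S| <= _).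
  apply: ler_sum => S /andP[_ hS]; apply: le_trans (cut_tail L theta hp S) _.
  by rewrite /x -expRM_natr ler_expR mulNr lerN2; exact: half.
apply: le_trans (_ : \sum_(S : {set 'I_n} | S != finset.set0) x ^+ #|S| <= _).
  rewrite big_mkcond [leRHS]big_mkcond; apply: ler_sum => S _; rewrite /P.
  by case: (S != _) => //=; case: ifP => // _; rewrite exprn_ge0 // ltW.
have e : 1 + \sum_(S : {set 'I_n} | S != finset.set0) x ^+ #|S| = (1 + x) ^+ n.
  by rewrite -sum_set_expr [RHS](bigD1 finset.set0) //= cards0 expr0.
have nx : n%:R * x <= n%:R * expR (- t) by rewrite ler_wpM2l.
have nx0 : 0 <= n%:R * x by rewrite mulr_ge0 // ltW.
have h1 : (1 + x) ^+ n <= expR (n%:R * x).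
  rewrite expRM_natl lerXn2r ?nnegrE ?expR_ge0 ?expR_ge1Dx //.
  by rewrite addr_ge0 // ltW.
have h2 : expR (n%:R * x) <= 1 + n%:R * x + 2 * (n%:R * x) ^+ 2.
  by apply: expR_le_quad; rewrite ger0_norm //; have := ne_small; lra.
have h3 : 2 * (n%:R * x) ^+ 2 <= n%:R * x.
  by have := ne_small; move: nx nx0; set X := n%:R * x; nra.
lra.
Qed.

Definition good_event w :=
  degree_event w /\ cut_event w /\ edge_noise_event w /\ node_noise_event w /\
  sign_noise_event w /\ potential_noise_event w /\ row_sqr_event w /\
  row_bern_event w.

(** The eight failure bounds add up to [2 n^2 + 10 n + 1] times [expR (- t)]. *)
Lemma good_event_prob :
  Prob p theta (fun w => ~ good_event w) <= 13 * n%:R ^+ 2 * expR (- t).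
Proof.
have e0 := expR_gt0 (- t).
have n1 : 1 <= n%:R :> R by rewrite ler1n.
apply: le_trans (Prob_and degree_event_prob (Prob_and cut_event_prob
  (Prob_and edge_noise_event_prob (Prob_and node_noise_event_prob
  (Prob_and sign_noise_event_prob (Prob_and potential_noise_event_prob
  (Prob_and row_sqr_event_prob row_bern_event_prob))))))) _.
set e := expR _ in e0 *.
have h1 : e <= n%:R * e by rewrite ler_peMl // ltW.
have h2 : n%:R * e <= n%:R * (n%:R * e) by rewrite ler_peMl // mulr_ge0 // ltW.
lra.
Qed.

(** * Consequences of the good event *)

Lemma good_noise_le w : good_event w -> forall i,
  `|noise_sum w i| <= 18 * s ^+ 2 * tau.
Proof.
move=> [hd [_ [_ [hn _]]]] i.
have l0 : 0 < lam4 by rewrite divr_gt0 // mulr_gt0 // exprn_gt0.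
have := hn i.
have -> : \sum_j (lam4 * (j == i)%:R) * noise_sum w j = lam4 * noise_sum w i.
  rewrite (bigD1 i) //= eqxx mulr1 big1 ?addr0 // => j /negbTE ->.
  by rewrite mulr0 mul0r.
have : dirichlet (adj R w) (fun j => lam4 * (j == i)%:R) <= 2 * lam4 ^+ 2 * (3 * s ^+ 2).
  apply: le_trans (_ : \sum_j \sum_l adj R w j l *
      (lam4 ^+ 2 * (j == i)%:R + lam4 ^+ 2 * (l == i)%:R) <= _).
    apply: ler_sum => j _; apply: ler_sum => l _; rewrite ler_wpM2l ?adj_ge0 //.
    have l2 := sqr_ge0 lam4.
    by case: (j == i); case: (l == i); rewrite ?mulr1n ?mulr0n; nra.
  have y0 j : 0 <= lam4 ^+ 2 * (j == i)%:R by rewrite mulr_ge0 ?sqr_ge0.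
  apply: le_trans (sum_sym_deg (@adj_sym R n L w) hd y0) _.
  rewrite (bigD1 i) //= eqxx mulr1 big1 ?addr0 => [|j /negbTE ->]; last first.
    by rewrite mulr0.
  by rewrite le_eqVlt; apply/orP; left; apply/eqP; ring.
set X := dirichlet _ _ => hX; rewrite normrM (gtr0_norm l0) => h.
rewrite -(ler_pM2l l0); apply: le_trans h _.
(* [lam4] gives energy and tail the same order: with [lam4 * s^2 * tau = a^4], the identity reads
   [18 = 6 + 12]. *)
have -> : lam4 * (18 * s ^+ 2 * tau) = 2 * lam4 ^+ 2 * (3 * s ^+ 2) / L%:R + t.
  by rewrite /lam4 tauE -/Lr LrE /t; field; rewrite !gt_eqF.
by rewrite lerD2r ler_pM2r ?invr_gt0.
Qed.

Lemma good_noise_l1 w : good_event w ->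
  \sum_i `|noise_sum w i| <= 25 * n%:R * s ^+ 2 * tau / a ^+ 2.
Proof.
move=> [hd [_ [_ [_ [hs _]]]]].
have l0 : 0 < lam5 by rewrite divr_gt0.
have := hs [ffun i => noise_sum w i < 0].
have -> : \sum_j lam5 * (-1) ^+ [ffun i => noise_sum w i < 0] j * noise_sum w j =
          lam5 * \sum_i `|noise_sum w i|.
  rewrite mulr_sumr; apply: eq_bigr => i _; rewrite ffunE -mulrA; congr (_ * _).
  by have [h|h] := ltrP (noise_sum w i) 0; rewrite ?expr1 ?mulN1r ?expr0 ?mul1r
    ?(ltr0_norm h) ?(ger0_norm h).
pose u (j : 'I_n) : R := lam5 * (-1) ^+ [ffun i => noise_sum w i < 0] j.
have hX : dirichlet (adj R w) u <= 12 * s ^+ 2 * n%:R * lam5 ^+ 2.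
  have y0 (j : 'I_n) : 0 <= (fun=> 2 * lam5 ^+ 2) j by rewrite mulr_ge0 ?sqr_ge0.
  apply: le_trans (_ : \sum_j \sum_l adj R w j l * (2 * lam5 ^+ 2 + 2 * lam5 ^+ 2) <= _).
    apply: ler_sum => j _; apply: ler_sum => l _; rewrite ler_wpM2l ?adj_ge0 //.
    have e i : u i ^+ 2 = lam5 ^+ 2 by rewrite /u exprMn sqrr_sign mulr1.
    by clear y0; have := sqr_ge0 (u j + u l); have := e j; have := e l; lra.
  apply: le_trans (sum_sym_deg (@adj_sym R n L w) hd y0) _.
  rewrite sumr_const card_ord -[X in _ * X]mulr_natl.
  by rewrite le_eqVlt; apply/orP; left; apply/eqP; ring.
move=> h; rewrite -(ler_pM2l l0); apply: le_trans h _.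
(* Here [lam5 * s^2 * tau / a^2 = 1]: the energy gives [12 n], and the threshold [n + t] is at most
   [13 n] because [a^4 <= n]. *)
have -> : lam5 * (25 * n%:R * s ^+ 2 * tau / a ^+ 2) =
    12 * s ^+ 2 * n%:R * lam5 ^+ 2 / L%:R + 13 * n%:R.
  by rewrite /lam5 tauE -/Lr LrE; field; rewrite !gt_eqF.
apply: lerD; first by rewrite ler_pM2r ?invr_gt0 //; exact: hX.
by rewrite /t; have := an_le; lra.
Qed.

Lemma good_potential w m : good_event w ->
  `|\sum_j z w m j * noise_sum w j| <=
  tau / Num.sqrt n%:R * (s ^+ 2 * n%:R * dirichlet (adj R w) (z w m) + 12).
Proof.
move=> [_ [_ [_ [_ [_ [hz _]]]]]].
have l0 : 0 < lam6 by rewrite divr_gt0 // mulr_gt0 // exprn_gt0.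
have := hz m.
have -> : \sum_j lam6 * z w m j * noise_sum w j = lam6 * \sum_j z w m j * noise_sum w j.
  by rewrite mulr_sumr; apply: eq_bigr => j _; rewrite mulrA.
have -> : dirichlet (adj R w) (fun j => lam6 * z w m j) =
          lam6 ^+ 2 * dirichlet (adj R w) (z w m).
  rewrite /dirichlet mulr_sumr; apply: eq_bigr => i _; rewrite mulr_sumr.
  by apply: eq_bigr => j _; ring.
rewrite normrM (gtr0_norm l0) => h; rewrite -(ler_pM2l l0); apply: le_trans h _.
rewrite le_eqVlt; apply/orP; left; apply/eqP.
have e : a ^+ 2 = tau * s * Lr by rewrite tauE -/Lr; field; rewrite !gt_eqF.
have aE : a ^+ 4 = (tau * s * Lr) ^+ 2 by rewrite -e; ring.
rewrite /lam6 /t sqnE sqrtr_sqr (ger0_norm (sqrtr_ge0 _)).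
set q := Num.sqrt n%:R; have q0 : 0 < q by exact: sqn0.
by rewrite aE LrE; field; rewrite !gt_eqF.
Qed.

(** Cheeger with cut constant [s^2 / 8] and degree bound [3 s^2]; the quotient
    [(s^2 / 8)^2 / (3 s^2)] is the 192. *)
Lemma good_poincare w : good_event w -> forall x : 'I_n -> R, \sum_i x i = 0 ->
  s ^+ 2 / 192 * nrm2 x <= dirichlet (adj R w) x.
Proof.
move=> [hd [hc _]] x x0.
have h0 : 0 < s ^+ 2 / 8 by rewrite divr_gt0 ?exprn_gt0.
have D0 : 0 < 3 * s ^+ 2 by rewrite mulr_gt0 ?exprn_gt0.
have := cheeger n0 (@adj_ge0 R n L w) (@adj_sym R n L w) h0 D0 hc hd x0.
have -> // : (s ^+ 2 / 8) ^+ 2 / (3 * s ^+ 2) = s ^+ 2 / 192.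
by field; rewrite !gt_eqF.
Qed.

Lemma good_degree_ge w : good_event w -> (1 < n)%N -> forall i,
  s ^+ 2 / 8 <= \sum_j adj R w i j.
Proof.
move=> [_ [hc _]] n1 i; have := hc [set i]; rewrite cards1 => /(_ n1).
rewrite mulr1 big_set1 => /le_trans; apply.
rewrite big_mkcond; apply: ler_sum => j _.
by case: ifP => // _; exact: adj_ge0.
Qed.

End RandomEvents.

(** * Expansion for fixed n *)

Section FlowSolution.
Variables (R : realType) (n : nat).

(** A solution chosen as a function of the data alone, so that equal data give equal solutions:
    independence of the edges at [m] becomes an equation. The default 0 makes it total outside the
    good event. *)
Definition flow_sol (alpha : 'I_n -> 'I_n -> R) (phi : 'I_n -> 'I_n -> R -> R)
    (b : 'I_n -> R) : 'I_n -> R :=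
  match pselect (exists x : 'I_n -> R,
      \sum_i x i = 0 /\ forall i, flow alpha phi x i = b i) with
  | left h => projT1 (cid h)
  | right _ => fun=> 0
  end.

Lemma flow_solP alpha phi b :
  (exists x, \sum_i x i = 0 /\ forall i, flow alpha phi x i = b i) ->
  \sum_i flow_sol alpha phi b i = 0 /\
  forall i, flow alpha phi (flow_sol alpha phi b) i = b i.
Proof. by rewrite /flow_sol => h; case: pselect => // h'; case: cid. Qed.

End FlowSolution.

Lemma sum_antisym0 (R : realType) (n : nat) (G : 'I_n -> 'I_n -> R) :
  (forall i j, G j i = - G i j) -> \sum_i \sum_j G i j = 0.
Proof.
move=> hG; have := sum_antisym (fun=> 1) hG.
rewrite [RHS]big1 => [|i _]; last by rewrite big1 // => j _; rewrite subrr mulr0.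
under eq_bigr do rewrite mul1r.
by move/eqP; rewrite mulf_eq0 pnatr_eq0 => /eqP.
Qed.

Lemma MLE_expansion (R : realType) (K : R) : 0 <= K ->
  exists C : R, 0 < C /\
  forall (n L : nat) (p : R) (theta : 'I_n -> R) (a s : R),
  (1 < n)%N -> 0 < p <= 1 -> (0 < L)%N ->
  (forall i j, theta i - theta j <= K) -> \sum_i theta i = 0 ->
  1 <= a -> 0 < s -> n%:R * p = s ^+ 2 -> a ^+ 4 = ln n%:R ->
  C * a ^+ 3 <= s ->
  1 - 13 / n%:R ^+ 10 <= Prob p theta (fun w : Omega n L =>
    exists th : 'I_n -> R, is_MLE w th /\
    (forall th' : 'I_n -> R, is_MLE w th' -> th' =1 th) /\
    forall i, `|th i - theta i - bvec w theta i / dvec w theta i| <=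
    C * (a ^+ 3 / s) * (`|bvec w theta i / dvec w theta i| + (s * Num.sqrt L%:R)^-1)).
Proof.
(* Differences of [theta] are at most [K] and the perturbations will be at most 1/2, so within [B]
   the truncation is inactive. *)
move=> K0; pose B := K + 1.
have B0 : 0 <= B by rewrite /B; lra.
pose c := slope B; pose k := c^-1.
have c0 : 0 < c := slope_gt0 B.
have c1 : c <= 1 := slope_le1 B0.
have k0 : 0 < k by rewrite invr_gt0.
have ck : c * k = 1 by rewrite mulfV // gt_eqF.
have [x4 x5 x9] := csts_gt0 k0.
have x6 : 0 <= 8 * k * sup_cst k by nneg.
have x7 : 0 <= 768 * k ^+ 2 * nbr_cst k by nneg.
pose C := 96 + 768 * k ^+ 2 * nbr_cst k + 8 * k * sup_cst k + 4 * sup_cst k +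
  2 * err_cst k.
have C0 : 0 < C by rewrite /C; lra.
have [C96 C768 C8k C4k C2k] : [/\ 96 <= C, 768 * k ^+ 2 * nbr_cst k <= C,
    8 * k * sup_cst k <= C, 4 * sup_cst k <= C & 2 * err_cst k <= C].
  by rewrite /C; split; lra.
clearbody C.
exists C; split=> // n L p theta a s n1 /andP[p0 p1] L0 hth th0 a1 s0 nps aln hs.
have a0 : 0 < a by exact: lt_le_trans a1.
have a3 : 0 < a ^+ 3 by rewrite exprn_gt0.
have a31 : 1 <= a ^+ 3 by rewrite exprn_ege1.
have small x : 0 <= x -> x <= C -> x * a ^+ 3 <= s.
  by move=> _ xC; apply: le_trans hs; rewrite ler_wpM2r // ltW.
have s96 : 96 * a ^+ 3 <= s by exact: small.
have as4 x : 0 <= x -> x <= C -> x * a ^+ 4 <= s ^+ 2.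
  move=> x0 xC; have -> : x * a ^+ 4 = x * a ^+ 3 * a by ring.
  rewrite expr2; apply: ler_pM; rewrite ?small ?mulr_ge0 ?(ltW a3) ?(ltW a0) //.
  apply: le_trans s96; apply: le_trans (_ : a ^+ 3 <= _).
    by rewrite -[leLHS]expr1 ler_weXn2l.
  by rewrite ler_peMl ?(ltW a3) // ler1n.
have n0 : (0 < n)%N by exact: ltnW.
have nR : 0 < n%:R :> R by rewrite ltr0n.
pose tau := a ^+ 2 / (s * Num.sqrt L%:R).
have Lr1 : 1 <= Num.sqrt L%:R :> R.
  by rewrite -[leLHS]sqrtr1 ler_sqrt ?ler1n.
have Lr0 : 0 < Num.sqrt L%:R :> R by exact: lt_le_trans Lr1.
have tau0 : 0 < tau by rewrite divr_gt0 ?exprn_gt0 ?mulr_gt0.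
have tau_le : s * tau <= a ^+ 2.
  have -> : s * tau = a ^+ 2 / Num.sqrt L%:R by rewrite /tau; field; rewrite !gt_eqF.
  by rewrite ler_pdivrMr // ler_peMr ?sqr_ge0.
have hth' i j : `|theta i - theta j| <= K.
  by rewrite ler_norml hth andbT lerNl opprB.
pose phi i j x := psit B (theta i - theta j + x) - psi (theta i - theta j).
pose W i j := dpsi (theta i - theta j).
have hB i j : `|theta i - theta j| <= B by rewrite (le_trans (hth' i j)) // /B lerDl.
have phi_zero i j : phi i j 0 = 0 by rewrite /phi addr0 psit_id // subrr.
have phi_odd i j x : phi j i (- x) = - phi i j x.
  have e1 : theta j - theta i + - x = - (theta i - theta j + x) by ring.
  by rewrite /phi e1 -(opprB (theta i) (theta j)) (psitN B0) psiN; ring.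
have shiftE (T x y : R) : T + x - (T + y) = x - y by ring.
have phiB i j x y : psit B (theta i - theta j + x) - psit B (theta i - theta j + y) =
    phi i j x - phi i j y by rewrite /phi; ring.
have phi_mono i j x y : c * (x - y) ^+ 2 <= (phi i j x - phi i j y) * (x - y).
  have := psit_mono B0 (theta i - theta j + x) (theta i - theta j + y).
  by rewrite shiftE phiB.
have phi_lip i j x y : `|phi i j x - phi i j y| <= `|x - y|.
  have := psit_lip B0 (theta i - theta j + x) (theta i - theta j + y).
  by rewrite shiftE phiB.
have phi_psi i j x : `|x| <= 1 / 2 ->
    phi i j x = psi (theta i - theta j + x) - psi (theta i - theta j).
  move=> hx; rewrite /phi psit_id //; apply: le_trans (ler_normD _ _) _.
  by have := hth' i j; rewrite /B; lra.
have phi_taylor i j x : `|x| <= 1 / 2 -> `|phi i j x - W i j * x| <= 2 * x ^+ 2.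
  by move=> hx; rewrite phi_psi //; exact: psi_taylor.
have W_bounds i j : c <= W i j <= 1.
  by rewrite /W (dpsi_ge (hB i j)); case/andP: (dpsi_le1 (theta i - theta j)).
have W01 i j : 0 <= W i j <= 1 by exact: dpsi_le1.
have W_sym : symmetric_fun W.
  move=> i j; rewrite /W -(opprB (theta j)); set x := theta j - theta i.
  rewrite /dpsi expRN; have ex := expR_gt0 x.
  by field; rewrite !gt_eqF ?addr_gt0.
pose phiW i j x := W i j * x.
have phiW_odd i j x : phiW j i (- x) = - phiW i j x by rewrite /phiW W_sym mulrN.
have phiW_mono i j x y : c * (x - y) ^+ 2 <= (phiW i j x - phiW i j y) * (x - y).
  have -> : (phiW i j x - phiW i j y) * (x - y) = W i j * (x - y) ^+ 2.
    by rewrite /phiW; ring.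
  rewrite ler_wpM2r ?sqr_ge0 //.
  by case/andP: (W_bounds i j).
have phiW_lip i j x y : `|phiW i j x - phiW i j y| <= `|x - y|.
  have /andP[w0 w1] := W01 i j.
  by rewrite /phiW -mulrBr normrM ger0_norm // ler_piMl.
pose wbar m := (\sum_j W m j / n%:R) / n%:R.
pose Am (w : Omega n L) m i j : R := if (i == m) || (j == m) then p else adj R w i j.
pose bm (w : Omega n L) m i : R := \sum_j (if (i == m) || (j == m) then 0 else
  adj R w i j * noise theta w i j).
pose f w m := flow_sol (Am w m) phi (bm w m).
pose z (w : Omega n L) m := flow_sol (adj R w) phiW (fun i => W m i / n%:R - wbar m).
(* [Am] and [bm] overwrite every entry that meets [m], so both are unchanged when an edge at [m] is
   redrawn. *)
have f_set_adj (m j : 'I_n) b w : f (set_adj m j b w) m = f w m.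
  have eA i i' : (i == m) || (i' == m) = false ->
      adj R (set_adj m j b w) i i' = adj R w i i'.
    by move/norP => [/negbTE im /negbTE i'm]; rewrite adj_set_adj_neq ?im ?i'm ?andbF.
  rewrite /f; congr flow_sol.
    apply/funext => i; apply/funext => i'; rewrite /Am.
    by case: ifP => // /eA.
  apply/funext => i; rewrite /bm; apply: eq_bigr => i' _.
  by case: ifP => // h; rewrite eA // /noise ybar_set_adj.
have z_set_outcome el b w : z (set_outcome el b w) = z w by [].
have p01 : 0 <= p <= 1 by rewrite ltW.
have tauE : tau = a ^+ 2 / (s * Num.sqrt L%:R) by [].
have as96 : 96 * a ^+ 4 <= s ^+ 2 by exact: as4.
have an : a ^+ 4 <= n%:R by rewrite aln ltW // ln_sublinear.
have e12 : expR (- (12 * a ^+ 4)) = (n%:R ^+ 12)^-1.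
  by rewrite aln expRN expRM_natl lnK ?posrE.
have n2 : 2 <= n%:R :> R by rewrite ler_nat.
have ne_small : n%:R * expR (- (12 * a ^+ 4)) <= 1 / 2.
  have -> : n%:R * expR (- (12 * a ^+ 4)) = (n%:R ^+ 11)^-1.
    by rewrite e12; field; rewrite gt_eqF.
  rewrite div1r lef_pV2 ?posrE ?exprn_gt0 //.
  apply: le_trans n2 _; rewrite -[leLHS]expr1 ler_weXn2l // ler1n //.
have := good_event_prob theta p01 L0 n0 a1 s0 nps tauE as96 W01 f_set_adj
  z_set_outcome ne_small.
have -> : 13 * n%:R ^+ 2 * expR (- (12 * a ^+ 4)) = 13 / n%:R ^+ 10.
  by rewrite e12; field; rewrite gt_eqF.
set good := good_event _ _ _ _ _ _ _ _ => hgood.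
apply: le_trans (_ : Prob p theta good <= _).
  by rewrite Prob_compl // lerD2l lerN2.
apply: Prob_le => // w G.
have P := good_poincare n0 s0 G.
have Dge := good_degree_ge G n1.
have [Dle [_ [Exi [_ [_ [_ [Frow Fbern]]]]]]] := G.
have ble := good_noise_le L0 a1 s0 tauE G.
have bl1 := good_noise_l1 L0 a1 s0 tauE an G.
have lam0 : 0 < s ^+ 2 / 192 by rewrite divr_gt0 ?exprn_gt0.
have s28 : 28 <= s by clear -s96 a31; lra.
have na i j : adj R w j i * noise theta w j i = - (adj R w i j * noise theta w i j).
  rewrite adj_sym; have [->|ij] := eqVneq i j; first by rewrite adj_diag !mul0r oppr0.
  by rewrite noise_antisym // mulrN.
have [d0 dflow] : \sum_i flow_sol (adj R w) phi (noise_sum theta w) i = 0 /\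
    forall i, flow (adj R w) phi (flow_sol (adj R w) phi (noise_sum theta w)) i =
              noise_sum theta w i.
  apply: flow_solP; apply: (flow_solvable (adj01 R w) (@adj_sym R n L w) phi_odd c0
    phi_mono phi_lip lam0 P).
  exact: sum_antisym0 na.
set delta := flow_sol _ _ _ in d0 dflow.
have Am01 m i j : 0 <= Am w m i j <= 1.
  by rewrite /Am; case: ifP => // _; exact: adj01.
have Am_sym m : symmetric_fun (Am w m) by move=> i j; rewrite /Am orbC adj_sym.
have PAm m x : \sum_i x i = 0 -> s ^+ 2 / 192 / 2 * nrm2 x <= dirichlet (Am w m) x.
  move=> x0; apply: (@leave_one_out_poincare R n (adj R w) _ p m x (adj01 R w)
    (@adj_sym R n L w) P) => //.
  - rewrite ler_pdivlMr //; have : 28 ^+ 2 <= s ^+ 2 by rewrite ler_pXn2r ?nnegrE // ltW.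
    by clear; lra.
  - by rewrite nps ler_pdivrMr // ler_peMr ?sqr_ge0 // ler1n.
have lam1 : 0 < s ^+ 2 / 192 / 2 by rewrite divr_gt0.
have fP m : \sum_i f w m i = 0 /\ forall i, flow (Am w m) phi (f w m) i = bm w m i.
  apply: flow_solP; apply: (flow_solvable (Am01 m) (Am_sym m) phi_odd c0
    phi_mono phi_lip lam1 (PAm m)).
  apply: sum_antisym0 => i j; rewrite orbC; case: ifP => _; first by rewrite oppr0.
  exact: na.
have zP m : \sum_i z w m i = 0 /\
    forall i, flow (adj R w) phiW (z w m) i = W m i / n%:R - wbar m.
  apply: flow_solP; apply: (flow_solvable (adj01 R w) (@adj_sym R n L w) phiW_odd c0
    phiW_mono phiW_lip lam0 P).
  rewrite sumrB sumr_const card_ord -[X in _ - X]mulr_natr /wbar divfK ?subrr //.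
  by rewrite gt_eqF.
have c01 : 0 < c <= 1 by rewrite c0.
have as768 : 768 * k ^+ 2 * nbr_cst k * a ^+ 4 <= s ^+ 2.
  exact: as4.
have as3 : a ^+ 3 <= s by clear -s96 a31; lra.
have k5s : 8 * k * sup_cst k * a ^+ 3 <= s by exact: small.
have Mhalf : sup_cst k * tau <= 1 / 4.
  have h4 : 4 * sup_cst k * a ^+ 3 <= s by apply: small => //; rewrite mulr_ge0 // ltW.
  have h23 : a ^+ 2 <= a ^+ 3 by rewrite ler_weXn2l.
  rewrite -(ler_pM2l s0); have := ler_wpM2l (ltW x5) tau_le.
  have := ler_wpM2l (ltW x5) h23; move: (sup_cst k) h4 => y h4; clear -h4; lra.
have dsup : normInf delta <= sup_cst k * tau.
  exact: (delta_sup n0 c01 ck a1 s28 tau0 p01 nps (AijC w) phi_zero phi_odd phi_mono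
    phi_lip Dle Dge P Exi ble bl1 d0 dflow (fun m => (fP m).1) (fun m => (fP m).2)
    Frow as768).
have dclose i j : `|delta i - delta j| <= 1 / 2.
  apply: le_trans (ler_normB _ _) _.
  have := normInf_ge delta i; have := normInf_ge delta j; clear -dsup Mhalf; lra.
(* As differences of [delta] are at most 1/2, the truncated link agrees with [psi] there, and the
   solution satisfies the genuine likelihood equations. *)
have st i : \sum_j adj R w i j *
    (psi ((theta i + delta i) - (theta j + delta j)) - ybar R w i j) = 0.
  have := dflow i; rewrite /flow /noise_sum => /eqP; rewrite -subr_eq0 -sumrB => /eqP e.
  rewrite -[RHS]e; apply: eq_bigr => j _; rewrite phi_psi ?dclose // /noise.
  have -> : theta i + delta i - (theta j + delta j) =
            theta i - theta j + (delta i - delta j) by ring.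
  ring.
have th1 : \sum_i (theta i + delta i) = 0 by rewrite big_split /= th0 d0 addr0.
exists (fun i => theta i + delta i); split; first exact: stationary_is_MLE.
split=> [th' hMLE i|i]; first exact: (stationary_MLE_unique lam0 P th1 st hMLE).
have -> : theta i + delta i - theta i = delta i by rewrite addrC addKr.
rewrite bvecE dvecE.
have EB := expansion_bound n0 c01 ck a1 s28 tau0 p01 nps (AijC w) phi_zero phi_odd
  phi_mono phi_lip Dle Dge P Exi ble bl1 d0 dflow (fun m => (fP m).1)
  (fun m => (fP m).2) Frow as768 as3 tau_le (Aii w) W_sym W_bounds phi_taylor k5s
  (zP i).1 (zP i).2 (good_potential L0 n0 a1 s0 tauE i G) (Fbern i) Mhalf.
apply: le_trans EB _.
have -> : a * tau / s = a ^+ 3 / s * (s * Num.sqrt L%:R)^-1.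
  by rewrite /tau; field; rewrite !gt_eqF.
set X := `|_ / _|; set Y := (s * Num.sqrt L%:R)^-1; set e := a ^+ 3 / s.
have e0 : 0 <= e by rewrite divr_ge0 ?(ltW a3) ?(ltW s0).
have Y0 : 0 <= Y by rewrite invr_ge0 mulr_ge0 ?sqrtr_ge0 ?(ltW s0).
have X0 : 0 <= X by exact: normr_ge0.
have t1 : 8 * k * sup_cst k * (e * X) <= C * (e * X).
  by apply: ler_wpM2r => //; exact: mulr_ge0.
have t2 : 2 * err_cst k * (e * Y) <= C * (e * Y).
  by apply: ler_wpM2r => //; exact: mulr_ge0.
clear -t1 t2; lra.
Qed.

(** * Asymptotic form *)

(* A deviation [e] with [|e| <= d1 |B| + d2] is split in the proportion of the
   two terms of its bound; when the bound is 0 the division returns 0 = e. *)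
Lemma split_deviation (R : realType) (e B d1 d2 : R) : 0 <= d1 -> 0 <= d2 ->
  `|e| <= d1 * `|B| + d2 ->
  let q := e / (d1 * `|B| + d2) in
  [/\ B + e = (1 + q * d1 * Num.sg B) * B + q * d2,
      `|q * d1 * Num.sg B| <= d1 & `|q * d2| <= d2].
Proof.
move=> d10 d20 he; set T := d1 * `|B| + d2 in he *; move=> q.
have T0 : 0 <= T by rewrite addr_ge0 ?mulr_ge0.
have q1 : `|q| <= 1.
  have [T1|T1] := eqVneq T 0; first by rewrite /q T1 invr0 mulr0 normr0.
  by rewrite /q normrM normfV (ger0_norm T0) ler_pdivrMr ?mul1r // lt_def T1.
have qT : q * T = e.
  have [T1|T1] := eqVneq T 0; last by rewrite /q divfK.
  by move: he; rewrite T1 normr_le0 => /eqP ->; rewrite mulr0.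
clearbody q; split.
- rewrite mulrDl mul1r -addrA; congr (_ + _).
  have -> : q * d1 * Num.sg B * B = q * (d1 * (Num.sg B * B)) by ring.
  by rewrite -normrEsg -[e in LHS]qT mulrDr.
- rewrite !normrM (ger0_norm d10); apply: le_trans (_ : d1 * `|Num.sg B| <= _).
    by rewrite ler_wpM2r // ler_piMl.
  by rewrite ler_piMr // normr_sg; case: (B != 0).
- by rewrite normrM (ger0_norm d20) ler_piMl.
Qed.

Local Open Scope classical_set_scope.
Local Open Scope ring_scope.

Theorem theorem2p2 (R : realType) (p : nat -> R) (L : nat -> nat) (kappa : nat -> R)
  (thetas : forall n : nat, 'I_n -> R)
  (hp : forall n, 0 < p n <= 1)
  (hL : forall n, (0 < L n)%N)
  (hkappa : forall n, 0 < kappa n)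
  (htheta : forall n, Theta (kappa n) (thetas n))
  (hkappaO1 : exists K : R, forall n, kappa n <= K)
  (hnp : (fun n : nat => n%:R * p n / (ln (n%:R : R)) `^ (3 / 2)) @ \oo --> +oo) :
  exists (eps1 eps2 : forall n : nat, Omega n (L n) -> 'I_n -> R)
         (delta1 delta2 : nat -> R) (C : R),
    delta1 @ \oo --> (0 : R) /\ delta2 @ \oo --> (0 : R) /\
    forall n : nat, (2 <= n)%N ->
      1 - C / n%:R ^+ 10 <=
      Prob (p n) (thetas n)
        (fun w : Omega n (L n) =>
           (exists th : 'I_n -> R, is_MLE w th) /\
           (forall th : 'I_n -> R, is_MLE w th ->
              forall i : 'I_n,
                th i - thetas n i =
                  (1 + eps1 n w i) * (bvec w (thetas n) i / dvec w (thetas n) i)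
                  + eps2 n w i) /\
           normInf (eps1 n w) <= delta1 n /\
           normInf (eps2 n w) <= delta2 n / Num.sqrt (n%:R * p n * (L n)%:R)).
Proof.
have [K hK] := hkappaO1.
have K0 : 0 <= K by apply: le_trans (hK 0%N); exact: ltW.
have [C0 [C0p main]] := MLE_expansion K0.
pose X n : R := n%:R * p n / (ln (n%:R : R)) `^ (3 / 2).
(* This is [a^3 / s], because [a^6 = (ln n)^(3/2)] and [s^2 = n p]; [hnp] says that it tends to
   0. *)
pose ep n : R := Num.sqrt (X n)^-1.
have hX : X @ \oo --> +oo := hnp.
have ep0 : ep @ \oo --> (0 : R).
  have h : (X n)^-1 @[n --> \oo] --> (0 : R).
    apply/gtr0_cvgV0 => //.
    by have /cvgryPgt /(_ 0) := hX.
  rewrite -[X in _ --> X](sqrtr0 R).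
  exact: (@continuous_cvg _ _ _ _ _ _ (@Num.sqrt R) 0 (@sqrt_continuous R 0) h).
have Cep0 : (fun n => C0 * ep n) @ \oo --> (0 : R).
  rewrite -[X in _ --> X](mulr0 C0); exact: cvgMr.
(* The two requirements of the fixed-[n] result: [ln n >= 1] gives [1 <= a], and [C0 * ep n <= 1] is
   [C0 * a^3 <= s]. *)
have [N hN] : exists N : nat, forall n, (N <= n)%N -> 1 <= ln (n%:R : R) /\ C0 * ep n <= 1.
  have /cvgryPge /(_ (C0 ^+ 2 + 1)) [N1 _ hN1] := hX.
  have [N2 hN2] : exists N2 : nat, expR 1 <= N2%:R :> R.
    by exists (Num.bound (expR 1 : R)); apply/ltW; rewrite archi_boundP ?expR_ge0.
  exists (maxn N1 N2) => n; rewrite geq_max => /andP[n1 n2]; split.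
    rewrite -[leLHS]expRK ler_ln ?posrE ?expR_gt0 //.
      by apply: le_trans hN2 _; rewrite ler_nat.
    by apply: lt_le_trans (expR_gt0 1) _; apply: le_trans hN2 _; rewrite ler_nat.
  have X1 : C0 ^+ 2 <= X n by apply: le_trans (hN1 n n1); rewrite lerDl.
  have X0 : 0 < X n by apply: lt_le_trans X1; rewrite exprn_gt0.
  rewrite /ep (sqrtrV (ltW X0)) ler_pdivrMr ?sqrtr_gt0 // mul1r.
  by rewrite -[leLHS](ger0_norm (ltW C0p)) -sqrtr_sqr ler_wsqrtr.
pose rt n := Num.sqrt (n%:R * p n * (L n)%:R).
(* The error vectors must be functions of the sample point, so an estimator is selected by choice,
   with default 0; on the good event uniqueness identifies it with every estimator. *)
pose hat n (w : Omega n (L n)) : 'I_n -> R :=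
  if pselect (exists th : 'I_n -> R, is_MLE w th) is left h then projT1 (cid h)
  else fun=> 0.
pose B n (w : Omega n (L n)) i := bvec w (thetas n) i / dvec w (thetas n) i.
pose q n (w : Omega n (L n)) i := (hat n w i - thetas n i - B n w i) /
  (C0 * ep n * `|B n w i| + C0 * ep n / rt n).
exists (fun n w i => q n w i * (C0 * ep n) * Num.sg (B n w i)).
exists (fun n w i => q n w i * (C0 * ep n / rt n)).
exists (fun n => C0 * ep n), (fun n => C0 * ep n), (13 + N%:R ^+ 10).
split=> //; split=> // n n2.
have n0 : 0 < n%:R :> R by rewrite ltr0n (leq_trans _ n2).
(* For the finitely many [n < N] the summand [N^10] of the constant makes the claimed lower bound
   nonpositive. *)
have [nN|Nn] := ltnP n N.
  apply: (@le_trans _ _ 0).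
    rewrite subr_le0 ler_pdivlMr ?exprn_gt0 // mul1r.
    have : n%:R ^+ 10 <= N%:R ^+ 10 :> R by rewrite lerXn2r ?nnegrE ?ler0n // ler_nat ltnW.
    lra.
  by apply: Prob_ge0; have /andP[/ltW -> ->] := hp n.
have [ln1 ep1] := hN n Nn.
have ln0 : 0 < ln (n%:R : R) by apply: lt_le_trans ln1.
have pn0 : 0 < p n by have /andP[] := hp n.
have np0 : 0 < n%:R * p n by rewrite mulr_gt0.
pose a : R := ln (n%:R : R) `^ (1 / 4); pose s := Num.sqrt (n%:R * p n).
have a4 : a ^+ 4 = ln n%:R.
  rewrite -powR_mulrn ?powR_ge0 // -powRrM.
  have -> : 1 / 4 * 4%:R = 1 :> R by lra.
  by rewrite powRr1 // ltW.
have a6 : (a ^+ 3) ^+ 2 = ln n%:R `^ (3 / 2).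
  rewrite -exprM -powR_mulrn ?powR_ge0 // -powRrM; congr (_ `^ _).
  by have -> : (3 * 2)%N%:R = 6 :> R by []; lra.
have a1 : 1 <= a.
  rewrite leNgt; apply/negP => a1; have : a ^+ 4 < 1 by rewrite exprn_ilt1 ?powR_ge0.
  by rewrite a4 ltNge ln1.
have a0 : 0 < a ^+ 3 by rewrite exprn_gt0 // (lt_le_trans _ a1).
have s0 : 0 < s by rewrite sqrtr_gt0.
have ss : n%:R * p n = s ^+ 2 by rewrite sqr_sqrtr // ltW.
have epE : ep n = a ^+ 3 / s.
  rewrite /ep /X ss -a6 invf_div -expr_div_n sqrtr_sqr ger0_norm //.
  by rewrite divr_ge0 // ltW.
have as1 : C0 * a ^+ 3 <= s by move: ep1; rewrite epE mulrA ler_pdivrMr // mul1r.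
have rtE : rt n = s * Num.sqrt (L n)%:R by rewrite /rt sqrtrM // ltW.
have L0 : 0 < (L n)%:R :> R by rewrite ltr0n hL.
have rt0 : 0 < rt n by rewrite rtE mulr_gt0 // sqrtr_gt0.
have d0 : 0 <= C0 * ep n by rewrite mulr_ge0 ?(ltW C0p) // sqrtr_ge0.
have hthK i j : thetas n i - thetas n j <= K.
  by apply: le_trans (hK n); have [] := htheta n.
have := main n (L n) (p n) (thetas n) a s n2 (hp n) (hL n) hthK (htheta n).2 a1 s0 ss a4 as1.
set P1 := Prob _ _ _; set P2 := Prob _ _ _ => P1ge.
apply: (@le_trans _ _ (1 - 13 / n%:R ^+ 10)).
  rewrite lerD2l lerN2 ler_wpM2r ?invr_ge0 ?exprn_ge0 ?ler0n //.
  by rewrite lerDl exprn_ge0.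
apply: le_trans P1ge _; rewrite /P1 /P2; apply: Prob_le; first by have /andP[/ltW -> ->] := hp n.
move=> w [th [thM [thU thB]]].
have hatE i : hat n w i = th i.
  rewrite /hat; case: pselect => [h|[]]; last by exists th.
  exact: (thU _ (projT2 (cid h))).
have dev i := @split_deviation R (hat n w i - thetas n i - B n w i) (B n w i)
  (C0 * ep n) (C0 * ep n / rt n) d0 (divr_ge0 d0 (ltW rt0)).
have hdev i : `|hat n w i - thetas n i - B n w i| <=
    C0 * ep n * `|B n w i| + C0 * ep n / rt n.
  rewrite hatE; apply: le_trans (thB i) _.
  by rewrite epE rtE mulrDr.
split; first by exists th.
split=> [th' th'M i|].
  rewrite (thU _ th'M) -hatE; have [<- _ _] := dev i (hdev i).
  by rewrite [RHS]addrC subrK.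
split; apply: normInf_le => [|i] //; last 1 first.
- by have [] := dev i (hdev i).
- by have [] := dev i (hdev i).
- by rewrite divr_ge0 // ltW.
Qed.
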